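(* There exists $\beta_h>0$ such that for every $\beta\in[0,\beta_h)$, for $\mathsf{P}_{\mu_{cr}}$-almost every infinite Lorentzian triangulation $T\in\mathbb{LT}_\infty$, the Gibbs measure for the Ising model on $T$ at inverse temperature $\beta$ is unique.
   Context: **Lorentzian triangulations.** Let ${\sf C}=S^1\times[0,\infty)$ and ${\sf C}_N=S^1\times[0,N]$. A Lorentzian triangulation $T$ of ${\sf C}$ (resp. ${\sf C}_N$) is a connected graph $G$ (loops and multiple edges allowed, finitely or countably many vertices) embedded in the cylinder, all of whose faces are triangles (a face is a connected component of the complement of $G$; it is a triangle if its boundary meets precisely three edges), such that the graph and its triangles cover the cylinder, each triangle lies in some strip $S^1\times[j,j+1]$ and has all its vertices and exactly one of its edges on the boundary $(S^1\times\{j\})\cup(S^1\times\{j+1\})$ of the strip, and the number of edges on each circle $S^1\times\{j\}$ is positive and finite. Throughout there is exactly one edge on $S^1\times\{0\}$. The triangulation is rooted: it carries a root triangle with ordered vertices $(x,y,z)$, where the root vertex $x$ and the directed root edge $(x,y)$ lie on $S^1\times\{0\}$ (so here the root edge is a loop and $x=y$). Triangulations are considered up to homeomorphisms respecting the root vertex and the directed root edge. $\mathbb{LT}_\infty$ and $\mathbb{LT}_N$ denote the sets of such rooted Lorentzian triangulations of ${\sf C}$ and ${\sf C}_N$ respectively (the number of edges on the top circle of ${\sf C}_N$ is not fixed). **The measure $\mathsf{P}_{\mu_{cr}}$.** Let $F(T)$ be the number of triangles of $T\in\mathbb{LT}_N$ and $\mathsf{P}_{N,\mu}(T)=e^{-\mu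 F(T)}/\sum_{T'\in\mathbb{LT}_N}e^{-\mu F(T')}$. Put $\mu_{cr}=\ln 2$. $\mathsf{P}_{\mu_{cr}}$ is the probability measure on $\mathbb{LT}_\infty$ that is the weak limit of $\mathsf{P}_{N,\mu_{cr}}$ as $N\to\infty$ (for each fixed $M$, the law of the restriction of the triangulation to ${\sf C}_M$ converges); this limit is known to exist. **Ising model.** For $T\in\mathbb{LT}_\infty$ let $T_N$ be its restriction to ${\sf C}_N$, $V(T_N)$ its vertex set, and $\partial T_N$ the set of vertices of $T$ on $S^1\times\{N+1\}$. Spins take values in $\{-1,1\}$. For a boundary configuration $\partial\sigma\in\{-1,1\}^{\partial T_N}$ and $\sigma\in\{-1,1\}^{V(T_N)}$ let $$H_N(\sigma|\partial\sigma)=-\sum_{\langle v,v'\rangle:\,v,v'\in V(T_N)}\sigma_v\sigma_{v'}-\sum_{\langle v,v'\rangle:\,v\in V(T_N),\,v'\in\partial T_N}\sigma_v\,\partial\sigma_{v'},$$ with sums over edges of $T$, and let $P^T_{N,\partial\sigma}(\sigma)$ be proportional to $\exp\{-\beta H_N(\sigma|\partial\sigma)\}$. A Gibbs measure for the Ising model on $T$ at inverse temperature $\beta$ is a probability measure on $\{-1,1\}^{V(T)}$ (product $\sigma$-algebra) that is a weak limit, along some subsequence of $N\to\infty$, of measures $P^T_{N,\partial\sigma}$ for some sequence of boundary conditions $\partial\sigma$. *)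

(* Defs.v *)
From HB Require Import structures.
From mathcomp Require Import all_boot all_order all_algebra.
From mathcomp Require Import all_classical all_reals all_analysis.

Set Implicit Arguments.
Unset Strict Implicit.
Unset Printing Implicit Defensive.

Import Order.TTheory GRing.Theory Num.Theory.
Import numFieldNormedType.Exports.

Local Open Scope classical_set_scope.
Local Open Scope ring_scope.

(* Rooted Lorentzian triangulations, up to homeomorphisms preserving the root
   vertex and the directed root edge, are represented combinatorially.

   A triangle of the strip S^1 x [j, j+1] has exactly one horizontal edge: it
   points up ([true]) if this edge lies on the lower circle S^1 x {j}, and down
   ([false]) if it lies on the upper circle S^1 x {j+1}.  Going once around the
   strip in the direction of the root edge, starting from the triangle that
   stands on the root edge of the lower circle, the strip is read as a word
   w : seq bool, which determines it up to homeomorphism.  The root triangle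
   (x, y, z) of this strip has its apex z on the upper circle; the root vertex
   of S^1 x {j+1} is z, and the root edge of S^1 x {j+1} is the edge that
   leaves z in the direction of the root edge of S^1 x {j}, i.e. the base of
   the first down triangle of the word.  This rule propagates the root from
   S^1 x {0} to every circle and hence names every triangle of the
   triangulation, so that the sequence of words is a complete invariant of the
   rooted homeomorphism class.  A sequence of words comes from a triangulation
   iff each word starts with an up triangle, every circle has at least one
   edge, the edge counts of adjacent strips match on their common circle, and
   S^1 x {0} has one edge. *)

Definition lower_edges (w : seq bool) : nat := count id w.
Definition upper_edges (w : seq bool) : nat := count negb w.

Definition is_strip (w : seq bool) : bool := head false w && (false \in w).

Definition glued (w w' : seq bool) : bool := upper_edges w == lower_edges w'.

(* Triangulations of S^1 x [0, N]. *)
Definition LT (N : nat) : set (seq (seq bool)) :=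
  [set s | [/\ size s = N, all is_strip s,
               lower_edges (head [:: true] s) = 1%N & sorted glued s]].

(* Triangulations of S^1 x [0, +oo[. *)
Record LTinf := MkLTinf {
  strip :> nat -> seq bool ;
  stripP : forall j, is_strip (strip j) ;
  strip_bottom : lower_edges (strip 0) = 1%N ;
  strip_glued : forall j, glued (strip j) (strip j.+1) }.

(* The restriction of T to S^1 x [0, M]. *)
Definition restr (T : LTinf) (M : nat) : seq (seq bool) := mkseq T M.

Lemma restr_LT (T : LTinf) (M : nat) : LT M (restr T M).
Proof.
split; first exact: size_mkseq.
- by apply/allP => w /mapP[j _ ->]; exact: stripP.
- by case: M => [|M] //=; exact: strip_bottom.
- rewrite /restr /mkseq; case: M => [//|M] /=.
  by elim: M 0%N => [//|M IH] j /=; rewrite strip_glued IH.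
Qed.

HB.instance Definition _ := gen_eqMixin LTinf.
HB.instance Definition _ := gen_choiceMixin LTinf.

Definition LTinf_point : LTinf :=
  @MkLTinf (fun=> [:: true; false]) (fun=> isT) erefl (fun=> isT).
HB.instance Definition _ := isPointed.Build LTinf LTinf_point.

(* LTinf with the sigma-algebra generated by the restrictions to S^1 x [0, M],
   each of which takes countably many values. *)
Definition LTspace : Type := g_sigma_algebraType
  [set A : set LTinf | exists M s, A = [set T | restr T M = s]].
HB.instance Definition _ := Measurable.on LTspace.

(* Number of triangles. *)
Definition ntriangles (s : seq (seq bool)) : nat := sumn (map size s).

Section MeasureOnTriangulations.
Variable R : realType.

Definition weight (mu : R) (s : seq (seq bool)) : \bar R :=
  (expR (- mu * (ntriangles s)%:R))%:E.

(* The partition function is finite (and nonzero) at mu = mu_cr, so that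
   [fine] loses nothing there. *)
Definition P_fin (N : nat) (mu : R) (A : set (seq (seq bool))) : R :=
  fine (\esum_(s in LT N `&` A) weight mu s) / fine (\esum_(s in LT N) weight mu s).

Definition mu_cr : R := ln 2.

(* For each M the law under P_fin N mu of the restriction to S^1 x [0, M]
   converges, as N -> oo, to its law under P.  LT M is countable and discrete,
   so weak convergence to a probability measure is convergence of the mass of
   each point. *)
Definition local_weak_limit (mu : R)
    (P : probability LTspace R) : Prop :=
  forall (M : nat) (s : seq (seq bool)), LT M s ->
    (P_fin N mu [set t | take M t = s])%:E @[N --> \oo]
      --> P [set T : LTspace | restr T M = s].

End MeasureOnTriangulations.

(* Number of edges, and of vertices, on S^1 x {j}. *)
Definition width (T : LTinf) (j : nat) : nat := lower_edges (T j).

Lemma width_gt0 (T : LTinf) (j : nat) : (0 < width T j)%N.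
Proof.
by have := stripP T j; rewrite /width /lower_edges /is_strip; case: (T j) => [//|[]].
Qed.

Definition vertex (T : LTinf) : Type := {j : nat & 'I_(width T j)}.

(* The i-th vertex of S^1 x {j} after its root vertex, counted cyclically. *)
Definition vtx (T : LTinf) (j i : nat) : vertex T :=
  Tagged (fun j => 'I_(width T j)) (Ordinal (ltn_pmod i (width_gt0 T j))).

(* The horizontal edges on S^1 x {j} join [vtx T j i] and [vtx T j i.+1], for
   i < width T j.  The other edges of the strip j separate two successive
   triangles of its cyclic word: for k < size (T j), the k-th such edge is the
   one between triangles k-1 and k, and the horizontal edges that precede it
   on the two circles are the bases of the triangles 0, ..., k-1. *)
Definition lower_end (T : LTinf) (j k : nat) : vertex T :=
  vtx T j (lower_edges (take k (T j))).
Definition upper_end (T : LTinf) (j k : nat) : vertex T :=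
  vtx T j.+1 (upper_edges (take k (T j))).

(* {-1, 1}^V(T), and the same with the product sigma-algebra; the boolean b
   stands for the value [spin b] in {-1, 1}. *)
Definition config (T : LTinf) : Type := vertex T -> bool.

Definition config_space (T : LTinf) : Type := g_sigma_algebraType
  [set A : set (config T) | exists v b, A = [set s | s v = b]].
HB.instance Definition _ (T : LTinf) := Measurable.on (config_space T).

(* V(T_N): the vertices on the circles S^1 x {j}, j <= N. *)
Definition vertex_fin (T : LTinf) (N : nat) : finType :=
  {j : 'I_N.+1 & 'I_(width T j)}.

(* The configuration equal to sigma on V(T_N) and to tau elsewhere. *)
Definition patch_config (T : LTinf) (N : nat)
    (sigma : {ffun vertex_fin T N -> bool}) (tau : config T) : config T :=
  fun v => let: existT j i := v in
    match @idP (j < N.+1)%N with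
    | ReflectT h =>
        sigma (@existT 'I_N.+1 (fun j => 'I_(width T j)) (Ordinal h) i)
    | ReflectF _ => tau (@existT nat (fun j => 'I_(width T j)) j i)
    end.

Section Ising.
Variable R : realType.

Definition spin (b : bool) : R := if b then 1 else -1.

(* H_N(sigma | tau), with s the configuration equal to sigma on V(T_N) and to
   the boundary condition tau elsewhere: only the spins on S^1 x {j}, j <= N+1,
   enter.  The first two sums run over the edges inside T_N, the last one over
   the edges between V(T_N) and the circle S^1 x {N+1}.  Multiple edges and
   loops are counted with their multiplicity. *)
Definition hamiltonian (T : LTinf) (N : nat) (s : config T) : R :=
  - ((\sum_(0 <= j < N.+1) \sum_(0 <= i < width T j)
        spin (s (vtx T j i)) * spin (s (vtx T j i.+1)))
     + \sum_(0 <= j < N) \sum_(0 <= k < size (T j))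
        spin (s (lower_end T j k)) * spin (s (upper_end T j k)))
  - \sum_(0 <= k < size (T N))
        spin (s (lower_end T N k)) * spin (s (upper_end T N k)).

Definition boltzmann (T : LTinf) (beta : R) (N : nat) (tau : config T)
    (sigma : {ffun vertex_fin T N -> bool}) : R :=
  expR (- beta * hamiltonian N (patch_config sigma tau)).

(* P^T_{N, tau}(sigma) *)
Definition P_ising (T : LTinf) (beta : R) (N : nat) (tau : config T)
    (sigma : {ffun vertex_fin T N -> bool}) : R :=
  boltzmann beta tau sigma
  / \sum_(sigma' : {ffun vertex_fin T N -> bool}) boltzmann beta tau sigma'.

(* Integral of f against P^T_{N, tau}, a measure on {-1, 1}^V(T_N) viewed on
   {-1, 1}^V(T) by freezing the spins outside T_N to tau.  The values of tau
   beyond S^1 x {N+1} do not affect the limits below. *)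
Definition E_ising (T : LTinf) (beta : R) (N : nat) (tau : config T)
    (f : config T -> R) : R :=
  \sum_(sigma : {ffun vertex_fin T N -> bool})
    P_ising beta tau sigma * f (patch_config sigma tau).

(* The test functions are the continuous functions for the product topology;
   they are bounded, as {-1, 1}^V(T) is compact. *)
Definition is_gibbs (T : LTinf) (beta : R)
    (m : probability (config_space T) R) : Prop :=
  exists (N : nat -> nat) (tau : forall n : nat, config T),
    {homo N : k l / (k < l)%N} /\
    forall f : {ptws vertex T -> bool} -> R, continuous f ->
      E_ising beta (N k) (tau (N k)) f @[k --> \oo]
        --> Rintegral m setT f.

(* Measures are compared on measurable sets only. *)
Definition unique_gibbs (T : LTinf) (beta : R) : Prop :=
  exists m : probability (config_space T) R, is_gibbs beta m /\
    forall m' : probability (config_space T) R, is_gibbs beta m' ->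
      forall A : set (config_space T), measurable A -> m' A = m A.

End Ising.

(* Main.v *)
(* Disagreement percolation with two independent copies of the model.  Writing
   the product of the two Boltzmann weights on an edge as c (1 + r) with
   0 <= r <= q (1 + r), q = 1 - exp (-4 beta), and expanding the product over the
   edges, the influence of the boundary on the spins up to level m is at most the
   number of self-avoiding walks of length m that start on level m, times q^m:
   if the open edges do not connect level m to the boundary, exchanging the two
   copies on the open cluster cancels the contribution.

   The walks are counted on average.  At mu_cr the law of T on S^1 x [0, M] is at
   most the width of the top circle times the product of 2^-|word| over the
   strips.  Given the widths, a vertical edge of a strip is a lattice point on
   the path coded by the word, so the weight of the words through prescribed
   points is a product of binomial probabilities over the gaps, and prescribing
   one more point on a given row or column costs a bounded factor in total.
   Hence the expected number of walks of length m in strips of width <= 64^m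
   grows at most exponentially in m, and Borel-Cantelli gives, for small q and
   almost every T, infinitely many m for which the bound above is at most 2^-m.

   Uniform decay makes the expectations of cylinder functions converge to limits
   that do not depend on the boundary conditions; the Gibbs measure is the image
   of Lebesgue measure on [0, 1[ under a map built from these limits. *)
Require Import Defs.
From HB Require Import structures.
From mathcomp Require Import all_boot all_order all_algebra.
From mathcomp Require Import all_classical all_reals all_analysis.
From mathcomp Require Import ring lra zify.

Set Implicit Arguments.
Unset Strict Implicit.
Unset Printing Implicit Defensive.

Import Order.TTheory GRing.Theory Num.Theory.
Import numFieldNormedType.Exports.
Local Open Scope classical_set_scope.
Local Open Scope ring_scope.

(** * A submultiplicative majorant of binomial probabilities *)

(** Vertex degrees have no uniform bound, so no contraction criterion holds uniformly in T and walks
    can be controlled only on average. The steps of a walk are therefore coded by lattice points on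
    the words rather than by vertices: a vertical edge becomes one prescribed point of a random
    lattice path, and degrees never enter. [kap] has the height n^(-1/2) and the spread n^(1/2) of
    the local limit theorem, but a Cauchy tail instead of a Gaussian one; its inverse is thus
    quadratic in the deviation, which makes it nearly subadditive. A walk of length m that starts on
    level m stays at or below level 2m, and one good m serves all volumes N >= 2m at once; this is
    why infinitely many m suffice. The cap 64^m is crude: it is exceeded with probability at most of
    order 2^(-m), and its powers, being exponential in m, are absorbed by q^m. The two copies live
    in volumes N <= N' with unrelated boundary conditions, so that a single estimate yields both the
    Cauchy property and the independence of the limit from the boundary. *)

Section Kernel.
Variable R : realType.
Implicit Types x y : nat.

(* [pbin x y] is the probability that a fair coin shows x heads in x + y tosses.
   [kap] dominates it (up to the factor 3) and has two properties that [pbin]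
   lacks: uniformly bounded sums along rows and columns, and an inverse [gapN]
   that is subadditive up to the factor 2. *)
Definition gapN x y : R :=
  (2 * (x + y).+1%:R + (x%:R - y%:R) ^+ 2) / Num.sqrt (x + y).+1%:R.

Definition kap x y : R := (gapN x y)^-1.

Definition pbin x y : R := 'C(x + y, x)%:R / 2 ^+ (x + y).

Lemma sqrtS_gt0 n : 0 < Num.sqrt n.+1%:R :> R.
Proof. by rewrite sqrtr_gt0 ltr0n. Qed.

Lemma gapN_gt0 x y : 0 < gapN x y.
Proof.
rewrite divr_gt0 ?sqrtS_gt0// ltr_pwDl ?sqr_ge0// mulr_gt0 ?ltr0n//.
Qed.

Lemma kap_gt0 x y : 0 < kap x y. Proof. by rewrite invr_gt0 gapN_gt0. Qed.
Lemma kap_ge0 x y : 0 <= kap x y. Proof. exact/ltW/kap_gt0. Qed.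

Lemma kapC x y : kap x y = kap y x.
Proof. by rewrite /kap /gapN (addnC y) -[in RHS]sqrrN opprB. Qed.

Lemma pbin_ge0 x y : 0 <= pbin x y.
Proof. by rewrite divr_ge0 ?exprn_ge0. Qed.

Lemma pbinC x y : pbin x y = pbin y x.
Proof. by rewrite /pbin (addnC y) -bin_sub ?leq_addr// addKn. Qed.

Lemma sqrD_le (a b : R) : (a + b) ^+ 2 <= 2 * a ^+ 2 + 2 * b ^+ 2.
Proof. by have := sqr_ge0 (a - b); rewrite sqrrB sqrrD !mulr2n; lra. Qed.

(* [gapN = 2 sqrt s + d^2 / sqrt s] with [s] nearly additive and [d] additive. *)
Lemma gapND x1 y1 x2 y2 :
  gapN (x1 + x2) (y1 + y2) <= 2 * (gapN x1 y1 + gapN x2 y2).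
Proof.
pose u n : R := Num.sqrt n.+1%:R.
have u0 n : 0 < u n by exact: sqrtS_gt0.
have uu n : u n * u n = n.+1%:R by rewrite -expr2 sqr_sqrtr.
have E x y : gapN x y = 2 * u (x + y)%N + (x%:R - y%:R) ^+ 2 / u (x + y)%N.
  by rewrite /gapN mulrDl -/(u _) -(uu (x + y)%N) mulrA mulfK // gt_eqF.
rewrite !E.
set a := u (x1 + x2 + _)%N; set b := u (x1 + y1)%N; set c := u (x2 + y2)%N.
have ba : b <= a by rewrite ler_sqrt ?ltr0n// ler_nat; lia.
have ca : c <= a by rewrite ler_sqrt ?ltr0n// ler_nat; lia.
have abc : a <= b + c.
  rewrite -(ler_pXn2r (n:=2)) ?nnegrE// ?addr_ge0 ?ltW ?u0//.
  rewrite sqrrD !expr2 !uu.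
  have : 0 < b * c by rewrite mulr_gt0 ?u0.
  rewrite -!natr1 !natrD mulr2n; lra.
rewrite !natrD.
set d1 : R := x1%:R - y1%:R; set d2 : R := x2%:R - y2%:R.
have -> : x1%:R + x2%:R - (y1%:R + y2%:R) = d1 + d2 by rewrite /d1 /d2; ring.
have H d e : e <= a -> 0 < e -> d ^+ 2 / a <= d ^+ 2 / e.
  by move=> ea e0; rewrite ler_wpM2l ?sqr_ge0// lef_pV2 ?posrE ?u0.
have := H d1 b ba (u0 _); have := H d2 c ca (u0 _).
have : (d1 + d2) ^+ 2 / a <= (2 * d1 ^+ 2 + 2 * d2 ^+ 2) / a.
  rewrite ler_wpM2r ?invr_ge0 ?(ltW (u0 _))//.
  exact: sqrD_le.
have := u0 (x1 + y1)%N; have := u0 (x2 + y2)%N; rewrite -/b -/c.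
rewrite mulrDl -!mulrA; lra.
Qed.

(** Since 1/(ab) = (1/(a+b)) (1/a + 1/b), the quasi-subadditivity of [gapN] becomes a bound on the
    product by the unsplit kernel times a sum. Each term of that sum can then be summed along a row
    or a column. *)
Lemma kapM x1 y1 x2 y2 :
  kap x1 y1 * kap x2 y2 <=
  2 * kap (x1 + x2) (y1 + y2) * (kap x1 y1 + kap x2 y2).
Proof.
have := gapND x1 y1 x2 y2; rewrite /kap.
have := gapN_gt0 x1 y1; have := gapN_gt0 x2 y2.
have := gapN_gt0 (x1 + x2) (y1 + y2).
move: (gapN _ _) (gapN _ _) (gapN _ _) => c b a c0 b0 a0 h.
have -> : 2 / a * (c^-1 + b^-1) = (c^-1 * b^-1) * ((2 * (c + b)) / a).
  by field; rewrite !gt_eqF.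
rewrite -[leLHS]mulr1 ler_wpM2l ?mulr_ge0 ?invr_ge0 ?(ltW a0) ?(ltW b0)//.
by rewrite ler_pdivlMr// mul1r.
Qed.

(** The left side is nonincreasing in h: successive central probabilities have ratio (2h+1)/(2h+2),
    and (2h+1)(2h+3) <= (2h+2)^2. *)
Lemma pbin_center h : pbin h h ^+ 2 * (2 * h + 1)%:R <= 1.
Proof.
elim: h => [|h IH]; first by rewrite /pbin bin0 expr0 divr1 expr1n mul1r.
have E : pbin h.+1 h.+1 * (2 * h + 2)%:R = pbin h h * (2 * h + 1)%:R.
  rewrite /pbin.
  have e : ('C(h.+1 + h.+1, h.+1) * h.+1 = 2 * (2 * h + 1) * 'C(h + h, h))%N.
    have := mul_bin_diag (h + h).+2 h; have := mul_bin_down (h + h).+1 h.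
    rewrite !addnS !addSn /= subSn ?leq_addr// addKn. nia.
  have -> : (2 * h + 2)%:R = 2 * h.+1%:R :> R by rewrite -natrM mulnS addnC.
  have -> : (2 ^+ (h.+1 + h.+1) : R) = 4 * 2 ^+ (h + h).
    by rewrite addnS addSn !exprS; ring.
  have e' : 'C(h.+1 + h.+1, h.+1)%:R * h.+1%:R =
     2 * (2 * h + 1)%:R * 'C(h + h, h)%:R :> R by rewrite -!natrM e.
  have p0 : (2 ^+ (h + h) : R) != 0 by rewrite expf_neq0.
  move: e' p0; move: (2 ^+ _) 'C(_, _)%:R 'C(_, _)%:R => P C0 C1 e' P0.
  have -> : C1 / (4 * P) * (2 * h.+1%:R) = (C1 * h.+1%:R) / (2 * P).
    by field.
  by rewrite e'; field.
have p0 : 0 < (2 * h + 2)%:R ^+ 2 :> R by rewrite exprn_gt0 // ltr0n; lia.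
rewrite -(ler_pM2l p0) mulrA -exprMn [_ * pbin _ _]mulrC E mulr1 exprMn.
have a0 : 0 <= (2 * h + 1)%:R :> R by [].
apply: (@le_trans _ _ ((2 * h + 1)%:R * (2 * h.+1 + 1)%:R)).
  rewrite ler_wpM2r// expr2 mulrA -[leRHS]mul1r ler_wpM2r//.
by rewrite -natrM -natrX ler_nat; nia.
Qed.

(** The constant 3 originates here: near the diagonal the squared deviation is at most 1, so [gapN]
    is at most 3 times the square root of x + y + 1. The odd case reduces to the even one, both
    central probabilities being equal. *)
Lemma pbin_le_kap_center x y : (x <= y <= x.+1)%N -> pbin x y <= 3 * kap x y.
Proof.
have P0 h : pbin h h * Num.sqrt (2 * h + 1)%:R <= 1.
  have a0 : 0 <= pbin h h * Num.sqrt (2 * h + 1)%:R.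
    by rewrite mulr_ge0 ?pbin_ge0 ?sqrtr_ge0.
  by rewrite -(@expr_le1 _ 2)// exprMn sqr_sqrtr ?pbin_center.
have K a b : pbin a b <= 3 * kap a b = (pbin a b * gapN a b <= 3).
  by rewrite /kap ler_pdivlMr ?gapN_gt0.
have D n e : 0 <= e <= 1 -> (2 * n.+1%:R + e) / Num.sqrt n.+1%:R <= 3 * Num.sqrt n.+1%:R :> R.
  move=> /andP[e0 e1]; rewrite ler_pdivrMr ?sqrtS_gt0// -mulrA -expr2 sqr_sqrtr//.
  have : 1 <= n.+1%:R :> R by rewrite ler1n.
  by lra.
move=> /andP[xy yx]; rewrite K.
have {xy yx}[->|->] : y = x \/ y = x.+1 by lia.
  apply: (le_trans (ler_wpM2l (pbin_ge0 _ _) (D _ _ _))).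
    by rewrite subrr expr0n lexx ler01.
  by rewrite mulrCA -[leRHS]mulr1 ler_wpM2l// -addn1 addnn -mul2n P0.
apply: (le_trans (ler_wpM2l (pbin_ge0 _ _) (D _ _ _))).
  by rewrite -natr1 opprD addrA subrr sub0r sqrrN expr1n ler01 lexx.
rewrite mulrCA -[leRHS]mulr1 ler_wpM2l//.
have -> : pbin x x.+1 = pbin x.+1 x.+1.
  rewrite /pbin addSn exprS invfM mulrA addnS; congr (_ / _).
  have : ('C((x + x).+2, x.+1) = 2 * 'C((x + x).+1, x))%N.
    have := @bin_sub (x + x).+1 x; rewrite subSn ?leq_addr// addKn => h.
    by rewrite binS h ?mul2n ?addnn// -addnn ltnW// ltnS leq_addr.
  by move=> ->; rewrite natrM mulrAC divff ?mul1r.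
apply: le_trans (P0 x.+1); rewrite ler_wpM2l ?pbin_ge0// ler_sqrt// ler_nat; lia.
Qed.

(** For fixed x + y, the product of [pbin] and [gapN] does not increase when |x - y| grows by 2; the
    induction descends to the central cases. *)
Lemma pbin_le_kap x y : pbin x y <= 3 * kap x y.
Proof.
wlog xy : x y / (x <= y)%N => [H|].
  by case: (leqP x y) => [/H//|/ltnW/H]; rewrite pbinC kapC.
rewrite -(subnKC xy); move: (y - x)%N => d {y xy}.
elim/ltn_ind: d x => d IH x.
case: d IH => [|[|d]] IH; try by apply: pbin_le_kap_center; lia.
have {IH} := IH d _ x.+1; rewrite (_ : (x.+1 + d = x + d.+1)%N); last by lia.
rewrite -[x.+1]addn1.
move=> /(_ ltac:(lia)).
have K a b : pbin a b <= 3 * kap a b = (pbin a b * gapN a b <= 3).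
  by rewrite /kap ler_pdivlMr ?gapN_gt0.
rewrite !K; apply: le_trans.
rewrite /gapN !mulrA.
have -> : (x + 1 + (x + d.+1) = x + (x + d.+2))%N by lia.
rewrite ler_wpM2r ?invr_ge0 ?sqrtr_ge0//.
rewrite /pbin (_ : (x + 1 + (x + d.+1) = x + (x + d.+2))%N); last by lia.
rewrite -![_ / _ * _]mulrAC ler_wpM2r ?invr_ge0 ?exprn_ge0//.
set n := (x + (x + d.+2))%N.
have e : 'C(n, x.+1)%:R * x.+1%:R = 'C(n, x)%:R * (x + d.+2)%:R :> R.
  by rewrite -!natrM mulnC mul_bin_left mulnC /n addKn.
have c0 : 0 <= 'C(n, x)%:R :> R by [].
rewrite addn1 -(ler_pM2l (ltr0Sn R x)) mulrCA [leRHS]mulrA [_ * 'C(n, _)%:R]mulrC.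
rewrite e -mulrA ler_wpM2l//.
have -> : n.+1%:R = 2 * x%:R + d%:R + 3 :> R.
  by rewrite -natrM -!natrD; congr _%:R; rewrite /n; lia.
have -> : (x + d.+2)%:R = x%:R + d%:R + 2 :> R.
  by rewrite -!natrD; congr _%:R; lia.
have -> : (x + d.+1)%:R = x%:R + d%:R + 1 :> R by rewrite addnS -natr1 natrD.
rewrite -(@natr1 R x).
have := ler0n R x; have := ler0n R d; nra.
Qed.

Lemma telescope_sumB (u : nat -> R) n :
  \sum_(0 <= d < n) (u d - u d.+1) = u 0%N - u n.
Proof.
rewrite -[LHS]opprK -sumrN; under eq_bigr do rewrite opprB.
by rewrite telescope_sumr// opprB.
Qed.

(** The potential [u] telescopes above the summand. Its first term dominates 2r/(2r^2 + d^2), its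
    second one the remaining tail of order d^(-3/2), and u 0 = 16. In the application r^2 = x + 1
    and d = |x - y|. *)
Lemma kap_column_half (r : R) n : 1 <= r ->
  \sum_(0 <= d < n) Num.sqrt (2 * r ^+ 2 + d%:R) / (2 * r ^+ 2 + d%:R ^+ 2)
    <= 20.
Proof.
move=> r1; have r0 : 0 < r by lra.
pose u d : R := 8 * r / (r + d%:R) + 8 / Num.sqrt d.+1%:R.
apply: (@le_trans _ _ (\sum_(0 <= d < n) (u d - u d.+1))); last first.
  rewrite telescope_sumB /u addr0 sqrtr1 mulfK ?gt_eqF// divr1.
  have : 0 <= 8 * r / (r + n%:R) by rewrite divr_ge0 ?addr_ge0//; lra.
  have : 0 <= 8 / Num.sqrt n.+1%:R :> R by rewrite divr_ge0 ?sqrtr_ge0.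
  lra.
apply: ler_sum => d _.
pose t : R := d%:R.
have t0 : 0 <= t by [].
have D0 : 0 < 2 * r ^+ 2 + t ^+ 2 by nra.
apply: (@le_trans _ _ ((2 * r + Num.sqrt t) / (2 * r ^+ 2 + t ^+ 2))).
  rewrite ler_wpM2r ?invr_ge0 ?(ltW D0)//.
  have s0 := sqrtr_ge0 t; have ss := sqr_sqrtr t0.
  rewrite -(ler_pXn2r (n:=2)) ?nnegrE ?sqrtr_ge0 ?addr_ge0 ?sqrtr_ge0//; last lra.
  rewrite sqr_sqrtr; last by nra.
  rewrite sqrrD ss -/t; nra.
rewrite mulrDl /u opprD addrACA; apply: lerD.
  rewrite -(@natr1 R d) -/t.
  have a0 : 0 < r + t by lra.
  have b0 : 0 < r + (t + 1) by lra.
  rewrite ler_pdivrMr// -subr_ge0.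
  have -> : (8 * r / (r + t) - 8 * r / (r + (t + 1))) * (2 * r ^+ 2 + t ^+ 2) - 2 * r =
    2 * r * ((4 * (2 * r ^+ 2 + t ^+ 2) - (r + t) * (r + (t + 1))) / ((r + t) * (r + (t + 1)))).
    by field; rewrite !gt_eqF.
  rewrite mulr_ge0//; first lra.
  rewrite divr_ge0//; last by rewrite mulr_ge0 ?(ltW a0) ?(ltW b0).
  have : 0 <= (r - t) ^+ 2 by rewrite sqr_ge0.
  nra.
set a := Num.sqrt d.+1%:R; set b := Num.sqrt d.+2%:R; set c := Num.sqrt t.
have aa : a ^+ 2 = t + 1 by rewrite sqr_sqrtr// /t -natr1.
have bb : b ^+ 2 = t + 2 by rewrite sqr_sqrtr// /t -addn2 natrD.
have a0 : 0 < a := sqrtS_gt0 _.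
have b0 : 0 < b := sqrtS_gt0 _.
have c0 : 0 <= c := sqrtr_ge0 _.
have cc : c ^+ 2 = t by rewrite sqr_sqrtr.
have ab : a <= b by rewrite ler_sqrt ?ltr0n// ler_nat.
have cb : c <= b by rewrite ler_sqrt ?ltr0n// ler_nat; lia.
have -> : 8 / a - 8 / b = 8 / (a * b * (a + b)).
  have e1 : (b - a) * (a + b) = 1 by transitivity (b ^+ 2 - a ^+ 2); [ring|rewrite aa bb; ring].
  have e2 : b - a = (a + b)^-1 by apply: (mulIf (x := a + b)); rewrite ?e1 ?mulVf// gt_eqF//; lra.
  have -> : 8 / a - 8 / b = 8 * (b - a) / (a * b) by field; rewrite !gt_eqF.
  rewrite e2; field; rewrite !gt_eqF//; lra.
have p0 : 0 < a * b * (a + b) by rewrite !mulr_gt0//; lra.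
rewrite ler_pdivlMr// mulrAC ler_pdivrMr//.
apply: (@le_trans _ _ (2 * (b ^+ 2) ^+ 2)); last first.
  have : 0 <= (t - 2) ^+ 2 by rewrite sqr_ge0.
  rewrite bb; nra.
have h1 : a * b <= b ^+ 2 by rewrite expr2 ler_wpM2r// ltW.
have h2 : c * (a + b) <= 2 * b ^+ 2 by nra.
have h0 : 0 <= a * b by rewrite mulr_ge0// ltW.
have h3 : 0 <= c * (a + b) by rewrite mulr_ge0//; lra.
have -> : c * (a * b * (a + b)) = (a * b) * (c * (a + b)) by ring.
have -> : 2 * (b ^+ 2) ^+ 2 = b ^+ 2 * (2 * b ^+ 2) by ring.
exact: ler_pM.
Qed.

Lemma kap_column x n : \sum_(0 <= y < n) kap x y <= 40.
Proof.
pose r : R := Num.sqrt x.+1%:R.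
have rr : r ^+ 2 = x.+1%:R by rewrite sqr_sqrtr.
have r1 : 1 <= r by rewrite -sqrtr1 ler_sqrt ?ltr01// ler1n.
pose g d : R := Num.sqrt (2 * r ^+ 2 + d%:R) / (2 * r ^+ 2 + d%:R ^+ 2).
have g0 d : 0 <= g d.
  by rewrite divr_ge0 ?sqrtr_ge0// addr_ge0 ?sqr_ge0// mulr_ge0 ?sqr_ge0.
(* With d = |x - y|, the quantity x + y + 1 lies between x + 1 and 2(x + 1) + d; the upper value in
   the numerator and the lower one in the denominator leave a bound that depends on d alone. *)
have H d y : (y + d = x \/ y = x + d)%N -> kap x y <= g d.
  move=> h; rewrite /kap /gapN invf_div.
  have -> : (x%:R - y%:R) ^+ 2 = d%:R ^+ 2 :> R.
    by case: h => [<-|->]; rewrite natrD; ring.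
  have s1 : x.+1%:R <= (x + y).+1%:R :> R by rewrite ler_nat; lia.
  have s2 : (x + y).+1%:R <= 2 * x.+1%:R + d%:R :> R.
    by rewrite -natrM -natrD ler_nat; lia.
  have s0 : 0 < x.+1%:R :> R by [].
  have d0 := sqr_ge0 (d%:R : R).
  have dd := ler0n R d.
  apply: ler_pM; first exact: sqrtr_ge0.
  - by rewrite invr_ge0; lra.
  - by rewrite rr ler_sqrt//; lra.
  - by rewrite lef_pV2 ?posrE ?rr; lra.
apply: (@le_trans _ _ (\sum_(0 <= d < x.+1) g d + \sum_(0 <= d < n) g d)); last first.
  have := kap_column_half x.+1 r1; have := kap_column_half n r1; rewrite -/g; lra.
have [nx|xn] := leqP n x.+1.
  apply: (@le_trans _ _ (\sum_(0 <= y < x.+1) kap x y)).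
    rewrite [leRHS](@big_cat_nat _ _ _ n)//= lerDl sumr_ge0// => *; exact: kap_ge0.
  rewrite big_nat_rev/= -[leLHS]addr0 lerD ?sumr_ge0//.
  rewrite big_nat_cond [leRHS]big_nat_cond; apply: ler_sum => i /andP[/andP[_ ix] _].
  by apply: H; lia.
rewrite (@big_cat_nat _ _ _ x.+1) ?(ltnW xn)//= lerD//.
  rewrite big_nat_rev/=.
  rewrite big_nat_cond [leRHS]big_nat_cond; apply: ler_sum => i /andP[/andP[_ ix] _].
  by apply: H; lia.
rewrite -add1n big_addn.
apply: (@le_trans _ _ (\sum_(1 <= i < n - x) g i)).
  by apply: ler_sum => i _; apply: H; lia.
rewrite [leRHS](@big_cat_nat _ _ _ (n - x))//=; last by lia.
rewrite [in leRHS]big_ltn; last by lia.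
have := g0 0%N.
have : 0 <= \sum_(n - x <= i < n) g i by rewrite sumr_ge0.
lra.
Qed.

End Kernel.

(** * Words through prescribed lattice points *)
Section Chains.
Variable R : realType.

(* The word of a strip is read as a lattice path from (0, 0): [true] increments
   the first coordinate and [false] the second.  The k-th edge between the two
   circles of the strip is the k-th lattice point on this path. *)
Definition le2 (o e : nat * nat) : bool := (o.1 <= e.1)%N && (o.2 <= e.2)%N.

Lemma le2_trans : transitive le2.
Proof. by move=> b a c; rewrite /le2; lia. Qed.

Definition kapd (o e : nat * nat) : R := kap R (e.1 - o.1) (e.2 - o.2).

Fixpoint chainw (o : nat * nat) (l : seq (nat * nat)) : R :=
  if l is e :: l' then kapd o e * chainw e l' else 1.

Fixpoint ins (e : nat * nat) (l : seq (nat * nat)) : seq (nat * nat) :=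
  if l is e' :: l' then if le2 e e' then e :: l else e' :: ins e l' else [:: e].

(** Only a gap that contains a candidate of [es] can be split, so only these gaps contribute when a
    point of [es] is inserted. *)
Fixpoint ngaps (es : seq (nat * nat)) (o : nat * nat) (l : seq (nat * nat)) : nat :=
  if l is e :: l' then has (fun c => le2 o c && le2 c e) es + ngaps es e l' else 0.

Lemma chainw_ge0 o l : 0 <= chainw o l.
Proof. by elim: l o => //= e l IH o; rewrite mulr_ge0// kap_ge0. Qed.

Lemma kapd_le o e z : le2 o e -> le2 e z ->
  kapd o e * kapd e z <= 2 * kapd o z * (kapd o e + kapd e z).
Proof.
move=> /andP[a b] /andP[c d].
have := kapM R (e.1 - o.1) (e.2 - o.2) (z.1 - e.1) (z.2 - e.2).
have E (x y w : nat) : (x <= y)%N -> (y <= w)%N -> (y - x + (w - y) = w - x)%N by lia.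
by rewrite /kapd !E.
Qed.

(** By [kapd_le] the sum is at most 2 [kapd o z] times two one-sided sums, each bounded by C. The
    factor with [has] records that a gap without candidates contributes nothing. *)
Lemma gap_sum (es : seq (nat * nat)) (C : R) o z :
  (forall o, \sum_(e <- es | le2 o e) kapd o e <= C) ->
  (forall z, \sum_(e <- es | le2 e z) kapd e z <= C) ->
  \sum_(e <- es | le2 o e && le2 e z) kapd o e * kapd e z <=
  4 * C * (has (fun c => le2 o c && le2 c z) es)%:R * kapd o z.
Proof.
move=> hl hr; have [_|/hasPn h] := boolP (has _ _); last first.
  by rewrite mulr0 mul0r big_seq_cond big1// => e /andP[/h] /negPf ->.
have k0 a b : 0 <= kapd a b by exact: kap_ge0.
apply: (@le_trans _ _ (\sum_(e <- es | le2 o e && le2 e z)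
    (2 * kapd o z * (kapd o e + kapd e z)))).
  by apply: ler_sum => e /andP[a b]; exact: kapd_le.
rewrite -mulr_sumr big_split/= mulr1.
have -> : 4 * C * kapd o z = 2 * kapd o z * (C + C) by ring.
rewrite ler_wpM2l ?mulr_ge0// lerD//.
  apply: le_trans (hl o); rewrite big_mkcondr/=; apply: ler_sum => e _.
  by case: ifP.
apply: le_trans (hr z); rewrite big_mkcond [leRHS]big_mkcond/=.
apply: ler_sum => e _; case: (le2 o e) => //=; by case: ifP.
Qed.

(* Splitting the gap (o, z) at e replaces [kapd o z] by [kapd o e * kapd e z],
   which [kapd_le] bounds by [kapd o z] times something summable in e. *)
Lemma ins_sum (es : seq (nat * nat)) (C : R) o l z :
  (forall o, \sum_(e <- es | le2 o e) kapd o e <= C) ->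
  (forall z, \sum_(e <- es | le2 e z) kapd e z <= C) ->
  path le2 o (rcons l z) ->
  \sum_(e <- es | path le2 o (rcons (ins e l) z)) chainw o (rcons (ins e l) z)
  <= 4 * C * (ngaps es o (rcons l z))%:R * chainw o (rcons l z).
Proof.
move=> hl hr; elim: l o => [|e1 l IH] o /=.
  rewrite addn0 mulr1 => /andP[oz _]; apply: le_trans (gap_sum _ _ hl hr).
  by under eq_bigr do rewrite mulr1; under eq_bigl do rewrite andbT.
move=> /andP[oe1 pl].
have k0 a b : 0 <= kapd a b by exact: kap_ge0.
rewrite natrD mulrDr mulrDl.
rewrite (bigID (fun e => le2 e e1))/=; apply: lerD.
  rewrite mulrA; apply: (le_trans _ (ler_wpM2r (chainw_ge0 _ _) (gap_sum _ _ hl hr))).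
  rewrite mulr_suml le_eqVlt; apply/orP; left; apply/eqP; apply: eq_big => [e|e].
    case: ifP => h; rewrite ?andbF//= h pl !andbT//.
  by move=> /andP[_ ->] /=; rewrite mulrA.
rewrite [leRHS]mulrCA; apply: le_trans (ler_wpM2l (k0 _ _) (IH _ pl)).
rewrite mulr_sumr big_mkcond [leRHS]big_mkcond; apply: ler_sum => e _ /=.
case: ifP => [/andP[]|_]; last first.
  by case: ifP => // _; rewrite mulr_ge0// chainw_ge0.
by move=> + /negPf h; rewrite h /= oe1 /= => ->.
Qed.

(** The flag is the direction of a vertical step. Going up, the walk stands on the lower circle and
    the first coordinate is prescribed; going down, the second one is. *)
Definition mkpt (t : bool) (a y : nat) : nat * nat := if t then (a, y) else (y, a).
Definition prj (t : bool) (e : nat * nat) : nat := if t then e.1 else e.2.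
Definition line (t : bool) (a Y : nat) : seq (nat * nat) := [seq mkpt t a y | y <- iota 0 Y].

Lemma kapd_mkpt t a b c d : kapd (mkpt t a b) (mkpt t c d) = kap R (c - a) (d - b).
Proof. by case: t => //=; rewrite /kapd/= kapC. Qed.

Lemma mkptP t e : exists a b, e = mkpt t a b.
Proof. by case: e t => a b [|]; [exists a, b|exists b, a]. Qed.

Lemma le2_mkpt t a b c d : le2 (mkpt t a b) (mkpt t c d) = (a <= c)%N && (b <= d)%N.
Proof. by case: t; rewrite /le2//= andbC. Qed.

Lemma sum_shift (f : nat -> R) (b Y : nat) : (forall i, 0 <= f i) ->
  \sum_(0 <= y < Y | (b <= y)%N) f (y - b)%N <= \sum_(0 <= y < Y) f y.
Proof.
move=> f0; have [bY|Yb] := leqP b Y; last first.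
  rewrite big_nat_cond big1 ?sumr_ge0// => i; lia.
rewrite (@big_cat_nat _ _ _ b)//= big_nat_cond big1 ?add0r; last by move=> i; lia.
rewrite [leRHS](@big_cat_nat _ _ _ (Y - b))//=; last by lia.
rewrite -{1}[b]add0n big_addn.
apply: (@le_trans _ _ (\sum_(0 <= i < Y - b) f i)); last by rewrite lerDl sumr_ge0.
rewrite le_eqVlt; apply/orP; left; apply/eqP; apply: eq_big => [i|i _].
  by rewrite leq_addl.
by rewrite addnK.
Qed.

Lemma line_suml t a Y o : \sum_(e <- line t a Y | le2 o e) kapd o e <= 40.
Proof.
rewrite big_map; have [c [d ->]] := mkptP t o.
under eq_bigr do rewrite kapd_mkpt; under eq_bigl do rewrite le2_mkpt.
case: (leqP c a) => ca; last by rewrite big_pred0_eq.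
rewrite /=. have /= := sum_shift d Y (fun i => kap_ge0 R (a - c) i).
rewrite /index_iota subn0 => h; apply: (le_trans h).
by have := kap_column R (a - c) Y; rewrite /index_iota subn0.
Qed.

Lemma line_sumr t a Y z : \sum_(e <- line t a Y | le2 e z) kapd e z <= 40.
Proof.
rewrite big_map; have [c [d ->]] := mkptP t z.
under eq_bigr do rewrite kapd_mkpt; under eq_bigl do rewrite le2_mkpt.
case: (leqP a c) => ca; last by rewrite big_pred0_eq.
rewrite /=; apply: le_trans (kap_column R (c - a) d.+1).
have -> : \sum_(0 <= y < d.+1) kap R (c - a) y =
  \sum_(0 <= y < d.+1) kap R (c - a) (d - y).
  by rewrite big_nat_rev/= add0n; apply: eq_bigr => i _; rewrite subSS.
rewrite -[Y]subn0 -/(index_iota 0 Y).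
have [Yd|dY] := leqP Y d.+1.
  rewrite [leRHS](@big_cat_nat _ _ _ Y)//= -[leLHS]addr0 lerD//.
    by rewrite big_mkcond; apply: ler_sum => i _; case: ifP => // _; exact: kap_ge0.
  by rewrite sumr_ge0// => *; exact: kap_ge0.
rewrite (@big_cat_nat _ _ _ d.+1) ?(ltnW dY)//= -[leRHS]addr0 lerD//.
  by rewrite big_mkcond; apply: ler_sum => i _; case: ifP => // _; exact: kap_ge0.
rewrite big_nat_cond big1// => i; lia.
Qed.

(** The coordinate [prj t] is monotone along a chain. A gap meets the line only if its ends lie on
    both sides of it or on it; all such gaps but the last one end on the line itself. *)
Lemma ngaps_line t a Y o l : path le2 o l ->
  (ngaps (line t a Y) o l <= (prj t o <= a)%N + count (fun e => prj t e == a) l)%N.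
Proof.
elim: l o => //= e l IH o /andP[oe /IH {}IH].
have : has (fun c => le2 o c && le2 c e) (line t a Y) -> (prj t o <= a <= prj t e)%N.
  by case/hasP => c /mapP[y _ ->]; rewrite /le2 /mkpt /prj; case: (t) => /=; lia.
have : (prj t o <= prj t e)%N by move: oe; rewrite /le2 /prj; case: (t); lia.
by case: has => [h1 /(_ isT)|h1 _]; case: eqP; lia.
Qed.

Fixpoint allw (n : nat) : seq (seq bool) :=
  if n is n'.+1 then [seq true :: w | w <- allw n'] ++ [seq false :: w | w <- allw n']
  else [:: [::]].

Lemma mem_allw n w : (w \in allw n) = (size w == n).
Proof.
elim: n w => [|n IH] [|b w] //=; first by rewrite mem_cat; apply/negbTE/norP; split; apply/mapP => -[].
rewrite mem_cat eqSS -IH; case: b.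
  rewrite mem_map; last by move=> ? ? [].
  by rewrite orbC; case: mapP => // -[].
rewrite [X in _ || X]mem_map; last by move=> ? ? [].
by case: mapP => // -[].
Qed.

Lemma big_allw_cat n m (F : seq bool -> R) :
  \sum_(w <- allw (n + m)) F w =
  \sum_(w1 <- allw n) \sum_(w2 <- allw m) F (w1 ++ w2).
Proof.
elim: n F => [|n IH] F /=; first by rewrite big_seq1.
by rewrite !big_cat/= !big_map !IH.
Qed.

Lemma sum_allw n x :
  \sum_(w <- allw n | count id w == x) (1 : R) = 'C(n, x)%:R.
Proof.
elim: n x => [|n IH] x /=; first by rewrite big_mkcond big_seq1 /= eq_sym; case: x.
rewrite big_cat/= !big_map/=; case: x => [|x].
  by rewrite big_pred0// add0r IH !bin0.
by rewrite binS natrD addrC -!IH.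
Qed.

Definition passes (w : seq bool) (e : nat * nat) : bool :=
  count id (take (e.1 + e.2) w) == e.1.

Definition sub2 (e o : nat * nat) : nat * nat := ((e.1 - o.1)%N, (e.2 - o.2)%N).

Fixpoint pchain (o : nat * nat) (l : seq (nat * nat)) : R :=
  if l is e :: l' then pbin R (e.1 - o.1) (e.2 - o.2) * pchain e l' else 1.

Lemma pchain_ge0 o l : 0 <= pchain o l.
Proof. by elim: l o => //= e l IH o; rewrite mulr_ge0// pbin_ge0. Qed.

Lemma pchain_le o l : pchain o l <= 3 ^+ size l * chainw o l.
Proof.
elim: l o => [|e l IH] o /=; first by rewrite mulr1.
rewrite exprS mulrACA ler_pM ?pbin_ge0 ?pchain_ge0//; exact: pbin_le_kap.
Qed.

(** The word is cut at its prescribed points. The pieces vary independently, and the number of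
    choices for each piece is a binomial coefficient; [sub2] moves the origin to the start of the
    remaining piece. *)
Lemma words_through o l z : path le2 o (rcons l z) ->
  \sum_(w <- allw ((z.1 - o.1) + (z.2 - o.2)) |
     (count id w == z.1 - o.1)%N && all (fun e => passes w (sub2 e o)) l)
    2 ^- size w <= pchain o (rcons l z).
Proof.
elim: l o => [|e l IH] o /=.
  move=> _; rewrite mulr1 /pbin big_seq_cond.
  under eq_bigr => w /andP[h _] do rewrite (eqP (etrans (esym (mem_allw _ _)) h)).
  rewrite -big_seq_cond -sum_allw mulr_suml.
  by under eq_bigl do rewrite andbT; under [leRHS]eq_bigr do rewrite mul1r.
move=> /andP[oe pe].
have : path le2 e (rcons l z) by [].
rewrite path_sortedE; last exact: le2_trans.
rewrite all_rcons => /andP[/andP[ez el] _].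
have -> : (z.1 - o.1 + (z.2 - o.2) =
  (e.1 - o.1 + (e.2 - o.2)) + (z.1 - e.1 + (z.2 - e.2)))%N.
  by move: oe ez; rewrite /le2; lia.
rewrite big_mkcond big_allw_cat.
apply: le_trans (ler_wpM2l (pbin_ge0 _ _ _) (IH _ pe)).
rewrite /pbin -sum_allw !mulr_suml [leRHS]big_mkcond/=.
rewrite big_seq [leRHS]big_seq; apply: ler_sum => w1; rewrite mem_allw => /eqP s1.
case: eqP => c1; last first.
  rewrite big_seq big1// => w2 _; case: ifP => // /andP[_ /andP[+ _]].
  by rewrite /passes /= -s1 take_size_cat// => /eqP.
rewrite mul1r mulr_sumr [leRHS]big_mkcond; apply: ler_sum => w2 _; case: ifP; last first.
  by move=> _; case: ifP => // _; rewrite mulr_ge0 ?invr_ge0 ?exprn_ge0.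
move=> /andP[cw /andP[_ al]]; rewrite ifT; last first.
  apply/andP; split.
    by move: cw; rewrite count_cat c1; move: oe ez; rewrite /le2; lia.
  apply/allP => -[c1' c2'] cl; have := allP al _ cl; have := allP el _ cl.
  rewrite /passes /sub2 /le2 /= => ec.
  rewrite take_cat s1 ifF; last by move: oe ec; rewrite /le2; lia.
  rewrite count_cat c1.
  have -> : (c1' - o.1 + (c2' - o.2) - (e.1 - o.1 + (e.2 - o.2)) = c1' - e.1 + (c2' - e.2))%N.
    by move: oe ec; rewrite /le2; lia.
  by move: oe ec; rewrite /le2; lia.
by rewrite size_cat exprD invfM s1.
Qed.

End Chains.

Lemma ins_perm e l : perm_eq (ins e l) (e :: l).
Proof.
elim: l => //= e' l IH; case: ifP => // _.
rewrite perm_sym (perm_catCA [:: e] [:: e'] l) /= perm_cons perm_sym.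
exact: IH.
Qed.

Lemma ins_path o e l z : path le2 o (rcons l z) -> le2 o e -> le2 e z ->
  {in l, forall c, le2 c e || le2 e c} -> path le2 o (rcons (ins e l) z).
Proof.
elim: l o => [|c l IH] o /=; first by move=> _ -> ->.
move=> /andP[oc pl] oe ez h; case: ifP => ec /=; first by rewrite oe ec pl.
rewrite oc IH//; last by move=> d dl; rewrite h// in_cons dl orbT.
by have := h c (mem_head _ _); rewrite ec orbF.
Qed.

(** Both letter counts grow with the length of the prefix, so two points of one path are comparable.
    This is what lets [ins] place a new point into the chain of the old ones. *)
Lemma passes_total w e c : (e.1 + e.2 <= size w)%N -> (c.1 + c.2 <= size w)%N ->
  passes w e -> passes w c -> le2 c e || le2 e c.
Proof.
wlog h : e c / (e.1 + e.2 <= c.1 + c.2)%N => [H|].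
  case: (leqP (e.1 + e.2) (c.1 + c.2)) => [h|/ltnW h] *; first exact: H.
  by rewrite orbC; apply: H.
rewrite /passes => es cs /eqP pe /eqP pc; rewrite orbC.
have := subnKC h; set d := (_ - _)%N => hd.
have : take (c.1 + c.2) w = take (e.1 + e.2) w ++ take d (drop (e.1 + e.2) w).
  by rewrite -hd takeD.
move/(congr1 (count id)); rewrite count_cat pe pc /le2 => H.
have := count_size id (take d (drop (e.1 + e.2) w)).
rewrite size_take size_drop => H2.
by rewrite (_ : (e.1 <= c.1)%N && (e.2 <= c.2)%N)//; move: H2; case: ifP; lia.
Qed.

(** * Counting self-avoiding walks *)

(* A step of a self-avoiding walk on vertices (level, index): the first boolean
   tells whether the step is horizontal, the second its direction; the lattice
   point is the edge used by a vertical step, and is irrelevant otherwise. *)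
Definition stepc : Type := (bool * bool * (nat * nat))%type.

Section Walks.
Variables (M : nat) (k : nat -> nat).
Implicit Types (v : nat * nat) (c : stepc) (E : nat -> seq (nat * nat)).

Definition step_to v c : nat * nat :=
  match c with
  | (true, true, _) => (v.1, v.2.+1 %% k v.1)%N
  | (true, false, _) => (v.1, (v.2 + k v.1).-1 %% k v.1)%N
  | (false, true, e) => (v.1.+1, e.2 %% k v.1.+1)%N
  | (false, false, e) => (v.1.-1, e.1 %% k v.1.-1)%N
  end.

(** A coordinate may equal the width: index [k j] is the root vertex of the circle met again at the
    end of the cyclic word, hence also the residues. *)
Definition step_valid v c : bool :=
  match c with
  | (true, _, _) => true
  | (false, true, e) =>
      [&& v.1 < M, e.1 <= k v.1, e.2 <= k v.1.+1 & e.1 %% k v.1 == v.2]%N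
  | (false, false, e) =>
      [&& 0 < v.1 <= M, e.1 <= k v.1.-1, e.2 <= k v.1 & e.2 %% k v.1 == v.2]%N
  end.

Definition step_strip v c : nat := if c.1.2 then v.1 else v.1.-1.

(** The inequality is strict because the end point of the cyclic word is the same edge as its
    origin. *)
Definition step_on_word (w : nat -> seq bool) v c : bool :=
  c.1.1 || (c.2.1 + c.2.2 < size (w (step_strip v c)))%N && passes (w (step_strip v c)) c.2.

Fixpoint pathok (w : nat -> seq bool) (V : seq (nat * nat)) v (cs : seq stepc) : bool :=
  if cs is c :: cs' then
    [&& step_valid v c, step_on_word w v c, step_to v c \notin V & pathok w (step_to v c :: V) (step_to v c) cs']
  else true.

(* [E j] collects the lattice points of strip j already visited by the walk. *)
Definition add_point v c E : nat -> seq (nat * nat) :=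
  if c.1.1 then E else fun j => if j == step_strip v c then ins c.2 (E j) else E j.

Definition ends j : nat * nat := (k j, k j.+1).

Definition chain_ok E j : bool := path le2 (0, 0)%N (rcons (E j) (ends j)).

Variable R : realType.

Definition chains_weight E : R := \prod_(j < M) chainw R (0, 0)%N (rcons (E j) (ends j)).

(** A word-free majorant: the condition that the steps lie on the words is weakened to the condition
    that the points used in each strip form a chain, and the final chains are weighted by [kap]. *)
Fixpoint walk_weight (V : seq (nat * nat)) v E (cs : seq stepc) : R :=
  if cs is c :: cs' then
    if [&& step_valid v c, step_to v c \notin V & chain_ok (add_point v c E) (step_strip v c)]
    then walk_weight (step_to v c :: V) (step_to v c) (add_point v c E) cs' else 0
  else chains_weight E.

Lemma chains_weight_ge0 E : 0 <= chains_weight E.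
Proof. by apply: prodr_ge0 => j _; exact: chainw_ge0. Qed.

Lemma walk_weight_ge0 V v E cs : 0 <= walk_weight V v E cs.
Proof.
elim: cs V v E => [|c cs IH] V v E /=; first exact: chains_weight_ge0.
by case: ifP.
Qed.

(* Self-avoidance bounds the number of visited points that lie on the row or the
   column of the current vertex, hence the number of gaps a new point can split. *)
Record walk_inv (V : seq (nat * nat)) v E : Prop := Inv {
  inv_chain : forall j, (j < M)%N -> chain_ok E j ;
  inv_ends : forall j e, e \in E j ->
    (j, e.1 %% k j)%N \in V /\ (j.+1, e.2 %% k j.+1)%N \in V ;
  inv_v : v \in V ;
  inv_lo : (count (fun e => e.1 %% k v.1 == v.2)%N (E v.1) <= 1)%N ;
  inv_hi : (0 < v.1)%N -> (count (fun e => e.2 %% k v.1 == v.2)%N (E v.1.-1) <= 1)%N }.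

(** By [inv_ends], a stored point on the row or column of the new vertex would make that vertex
    visited already. Freshness therefore gives count 0 before the step, and the point just inserted
    raises it to at most 1. *)
Lemma inv_step V v E c : walk_inv V v E -> step_valid v c -> step_to v c \notin V ->
  chain_ok (add_point v c E) (step_strip v c) -> walk_inv (step_to v c :: V) (step_to v c) (add_point v c E).
Proof.
move=> [Ic Ie Iv Il Ih] okv fr ch.
have fresh_lo : count (fun e => e.1 %% k (step_to v c).1 == (step_to v c).2)%N (E (step_to v c).1) = 0%N.
  apply/eqP; rewrite eqn0Ngt -has_count; apply/hasPn => e /Ie[+ _].
  by apply: contraL => /eqP ->; rewrite -surjective_pairing.
have fresh_hi : (0 < (step_to v c).1)%N ->
    count (fun e => e.2 %% k (step_to v c).1 == (step_to v c).2)%N (E (step_to v c).1.-1) = 0%N.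
  move=> n0; apply/eqP; rewrite eqn0Ngt -has_count; apply/hasPn => e /Ie[_].
  by rewrite prednK//; apply: contraL => /eqP ->; rewrite -surjective_pairing.
have cnt P j : (count P (add_point v c E j) <= 1 + count P (E j))%N.
  rewrite /add_point; case: ifP => _; first by rewrite leq_addl.
  case: eqP => _; last by rewrite leq_addl.
  by have /permP -> := ins_perm c.2 (E j); rewrite /= leq_add2r leq_b1.
split.
- move=> j jM; have := Ic j jM; rewrite /chain_ok.
  move: ch; rewrite /chain_ok /add_point; case: ifP => // _.
  by rewrite eqxx; case: eqP => // ->.
- move=> j e; rewrite /add_point; case: ifP => [_|hv].
    by move=> /Ie[a b]; rewrite !in_cons a b !orbT.
  case: eqP => [->|_]; last by move=> /Ie[a b]; rewrite !in_cons a b !orbT.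
  rewrite (perm_mem (ins_perm _ _)) in_cons => /orP[/eqP ->|]; last first.
    by move=> /Ie[a b]; rewrite !in_cons a b !orbT.
  move: c hv okv {ch fr fresh_lo fresh_hi cnt} => [[[] []] [x y]] //= _.
    rewrite /step_strip/= => /and4P[_ _ _ /eqP ->].
    by rewrite -surjective_pairing !in_cons Iv eqxx !orbT.
  rewrite /step_strip/= => /and4P[/andP[v0 _] _ _ /eqP h].
  by rewrite prednK// h -surjective_pairing !in_cons Iv eqxx !orbT.
- exact: mem_head.
- by rewrite (leq_trans (cnt _ _))// fresh_lo.
- by move=> n0; rewrite (leq_trans (cnt _ _))// fresh_hi.
Qed.

Variable K : nat.

Definition vcodes (t : bool) : seq stepc :=
  [seq (false, t, mkpt t a b) | a <- iota 0 K.+1, b <- iota 0 K.+1].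

Definition step_list : seq stepc :=
  [:: (true, true, (0, 0)%N); (true, false, (0, 0)%N)] ++ vcodes true ++ vcodes false.

Fixpoint walk_codes (n : nat) : seq (seq stepc) :=
  if n is n'.+1 then [seq c :: cs | c <- step_list, cs <- walk_codes n'] else [:: [::]].

Arguments walk_codes : simpl never.

Lemma codesS n : walk_codes n.+1 = [seq c :: cs | c <- step_list, cs <- walk_codes n].
Proof. by []. Qed.

(* 960 = 2 * 3 * 4 * 40: the vertex occupies two columns when its index is 0 (the
   cyclic word is cut there), and three gaps can meet a column; 4 * 40 comes
   from [ins_sum]. *)
Lemma sum_vcodes V v E t : walk_inv V v E ->
  \sum_(c <- vcodes t | step_valid v c && chain_ok (add_point v c E) (step_strip v c))
     chains_weight (add_point v c E)
  <= 960 * chains_weight E.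
Proof.
move=> I; rewrite big_mkcond big_allpairs_dep.
pose j := if t then v.1 else v.1.-1.
case: (boolP (if t then v.1 < M else 0 < v.1 <= M)%N) => [lv|lv]; last first.
  rewrite big1 ?mulr_ge0 ?ler0n ?chains_weight_ge0// => a _; rewrite big1// => b _.
  by rewrite ifF//=; move: lv; case: (t) => /= /negPf ->.
have jM : (j < M)%N by rewrite /j; move: lv; case: (t) => //; lia.
pose r : R := \prod_(i < M | i != Ordinal jM) chainw R (0, 0)%N (rcons (E i) (ends i)).
have r0 : 0 <= r by apply: prodr_ge0 => i _; exact: chainw_ge0.
pose w0 : R := chainw R (0, 0)%N (rcons (E j) (ends j)).
have PE : chains_weight E = w0 * r by rewrite /chains_weight (bigD1 (Ordinal jM)).
have PU a b : chains_weight (add_point v (false, t, mkpt t a b) E) =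
    chainw R (0, 0)%N (rcons (ins (mkpt t a b) (E j)) (ends j)) * r.
  rewrite /chains_weight (bigD1 (Ordinal jM))//= /add_point/= /step_strip/= -/j eqxx; congr (_ * _).
  apply: eq_bigr => i /negPf h; case: eqP => // e; move: h.
  by rewrite -(inj_eq val_inj)/= e eqxx.
have w00 : 0 <= w0 by exact: chainw_ge0.
pose Q a := (a <= k v.1)%N && (a %% k v.1 == v.2)%N.
have [C [C0 eC eC']] : exists C : R, [/\ 0 <= C, 960 = C * 2 & 4 * 40 * 3 = C].
  by exists 480; split; [exact: ler0n|lra|lra].
apply: (@le_trans _ _ (\sum_(a <- iota 0 K.+1 | Q a) C * chains_weight E)); last first.
  rewrite eC big_const_seq iter_addr addr0 -mulrnAr.
  have h : (count Q (iota 0 K.+1) <= 2)%N.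
    apply: (@leq_trans (count (fun a => (a == v.2) || (a == k v.1)) (iota 0 K.+1))%N).
      apply: sub_count => a /andP[] /=; rewrite leq_eqVlt => /orP[->|ak]; first by rewrite orbT.
      by rewrite modn_small// => ->.
    rewrite -[X in (X <= _)%N]/(count (predU (pred1 v.2) (pred1 (k v.1))) _).
    have := count_predUI (pred1 v.2) (pred1 (k v.1)) (iota 0 K.+1).
    set c := count (predI _ _) _; set d := count (predU _ _) _.
    by rewrite !count_uniq_mem ?iota_uniq//; do 2 case: (_ \in _); lia.
  by rewrite -mulrA [2 * _]mulr_natl ler_wpM2l// ler_wpMn2l// chains_weight_ge0.
rewrite [leRHS]big_mkcond; apply: ler_sum => a _.
case: ifP => [Qa|/negbT Qa]; last first.
  rewrite big1// => b _; rewrite ifF//; apply: contraNF Qa => /andP[+ _] /=.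
  by rewrite /Q /mkpt; case: (t) => /= /and4P[_ ? ? ?]; apply/andP.
rewrite -big_mkcond/=.
apply: (@le_trans _ _ (\sum_(e <- line t a K.+1 | path le2 (0, 0)%N (rcons (ins e (E j)) (ends j)))
   chainw R (0, 0)%N (rcons (ins e (E j)) (ends j)) * r)).
  rewrite big_map big_mkcond [leRHS]big_mkcond; apply: ler_sum => b _.
  case: ifP => [/andP[_]|_].
    by rewrite /chain_ok /add_point/= /step_strip/= -/j eqxx PU => ->.
  by case: ifP => // _; rewrite mulr_ge0// chainw_ge0.
rewrite -mulr_suml PE mulrA ler_wpM2r//.
apply: (le_trans (ins_sum _ _ (inv_chain I jM))).
- exact: line_suml.
- exact: line_sumr.
rewrite -/w0 ler_wpM2r//.
have : (ngaps (line t a K.+1) (0, 0)%N (rcons (E j) (ends j)) <= 3)%N.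
  apply: (leq_trans (ngaps_line _ _ _ (inv_chain I jM))).
  rewrite -cats1 count_cat/=.
  have : (count (fun e => prj t e == a) (E j) <= 1)%N.
    have Qa' : (a %% k v.1 = v.2)%N by case/andP: Qa => _ /eqP.
    move: lv (inv_lo I) (inv_hi I); rewrite /j; case: (t) => lv h1 h2.
      by apply: leq_trans h1; apply: sub_count => e /eqP /= ->; rewrite Qa'.
    apply: leq_trans (h2 _); last by case/andP: lv.
    by apply: sub_count => e /eqP /= ->; rewrite Qa'.
  by case: (prj t _ == a); case: (_ <= a)%N; lia.
rewrite -(ler_nat R) -eC' => h; rewrite ler_wpM2l// mulr_ge0//; exact: ler0n.
Qed.

(** 1922 = 960 + 960 + 1 + 1: the two vertical directions by [sum_vcodes], and two horizontal steps
    that leave the chains unchanged. *)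
Lemma walk_weight_sum (A : R) n V v E : 1922 <= A -> walk_inv V v E ->
  \sum_(cs <- walk_codes n) walk_weight V v E cs <= A ^+ n * chains_weight E.
Proof.
move=> hA; have A0 : 0 <= A by apply: le_trans hA; exact: ler0n.
elim: n V v E => [|n IH] V v E I; first by rewrite /walk_codes big_seq1 mul1r.
rewrite codesS big_allpairs_dep.
pose ok c := step_valid v c && chain_ok (add_point v c E) (step_strip v c).
apply: (@le_trans _ _ (\sum_(c <- step_list | ok c) A ^+ n * chains_weight (add_point v c E))).
  rewrite [leRHS]big_mkcond; apply: ler_sum => c _ /=.
  rewrite /ok; case: ifP => [/andP[h1 h2]|h]; last first.
    by rewrite big1// => cs _; rewrite ifF// andbCA h andbF.
  rewrite h1 h2 andbT/=; case: (_ \notin _) (@inv_step V v E c I h1) => h3; last first.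
    rewrite big1//; apply: mulr_ge0; last exact: chains_weight_ge0.
    exact: exprn_ge0.
  by apply: IH; exact: h3.
rewrite -mulr_sumr exprSr -mulrA ler_wpM2l ?exprn_ge0//.
rewrite /step_list big_cat big_cat.
have h1 : \sum_(c <- vcodes true | ok c) chains_weight (add_point v c E) <=
    960 * chains_weight E := sum_vcodes true I.
have h2 : \sum_(c <- vcodes false | ok c) chains_weight (add_point v c E) <=
    960 * chains_weight E := sum_vcodes false I.
have h0 := chains_weight_ge0 E.
have h3 : 1922 * chains_weight E <= A * chains_weight E by rewrite ler_wpM2r.
have hh d : chains_weight (add_point v (true, d, (0, 0)%N) E) = chains_weight E by [].
apply: (@le_trans _ _ ((chains_weight E + (chains_weight E + 0)) +
    (960 * chains_weight E + 960 * chains_weight E))); last lra.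
apply: lerD; last exact: lerD.
rewrite [leLHS]big_mkcond !big_cons big_nil !hh.
by apply: lerD; [|apply: lerD => //]; case: ifP.
Qed.

Lemma alph_horizontal t : (true, t, (0, 0)%N) \in step_list.
Proof. by rewrite mem_cat; apply/orP; left; case: t. Qed.

Lemma alph_vertical t a b : (a <= K)%N -> (b <= K)%N -> (false, t, mkpt t a b) \in step_list.
Proof.
move=> aK bK; have h : (false, t, mkpt t a b) \in vcodes t.
  by apply/allpairsP; exists (a, b); rewrite !mem_iota /=; split=> //; lia.
rewrite /step_list (mem_cat _ [:: _; _] (vcodes true ++ vcodes false)) (mem_cat _ (vcodes true)).
by case: t h => h; rewrite h ?orbT.
Qed.

End Walks.

Arguments walk_codes : simpl never.
Arguments step_list : simpl never.

(** * Total weight of the words that carry a given walk *)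

Section Families.
Variables (R : realType) (k : nat -> nat).

Definition words_of (a b : nat) : seq (seq bool) := [seq w <- allw (a + b) | count id w == a].

Fixpoint strip_words (j n : nat) : seq (seq (seq bool)) :=
  if n is n'.+1 then [seq w :: ws | w <- words_of (k j) (k j.+1), ws <- strip_words j.+1 n']
  else [:: [::]].

Lemma mem_words_of a b w : (w \in words_of a b) = (lower_edges w == a) && (upper_edges w == b).
Proof.
rewrite mem_filter mem_allw /lower_edges /upper_edges.
rewrite -(count_predC id w) (@eq_count _ negb (predC id))//.
by case: eqP => //= ->; rewrite eqn_add2l.
Qed.

Lemma mem_strip_words j n ws : ws \in strip_words j n ->
  size ws = n /\ forall i, (i < n)%N -> nth [::] ws i \in words_of (k (j + i)) (k (j + i).+1).
Proof.
elim: n j ws => [|n IH] j ws /=; first by rewrite in_cons orbF => /eqP ->.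
case/allpairsP => -[w ws'] /= [hw /IH[hs hn] ->]; split; first by rewrite /= hs.
by case=> [|i] hi /=; rewrite ?addn0// addnS -addSn; apply: hn.
Qed.

Lemma prod_fams j n (g : nat -> seq bool -> R) :
  \sum_(ws <- strip_words j n) \prod_(i < n) g (j + i)%N (nth [::] ws i) =
  \prod_(i < n) \sum_(w <- words_of (k (j + i)) (k (j + i).+1)) g (j + i)%N w.
Proof.
elim: n j => [|n IH] j; first by rewrite big_seq1 !big_ord0.
rewrite /= big_allpairs_dep big_ord_recl addn0 mulr_suml; apply: eq_bigr => w _.
under [in RHS]eq_bigr do rewrite lift0 addnS -addSn.
rewrite -IH mulr_sumr; apply: eq_bigr => ws _.
rewrite big_ord_recl /= addn0; congr (_ * _).
by apply: eq_bigr => i _; rewrite /bump /= !add1n addnS -addSn.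
Qed.

Variable M : nat.
Implicit Types E : nat -> seq (nat * nat).

Definition meets (ws : nat -> seq bool) E : bool :=
  [forall j : 'I_M, all (passes (ws j)) (E j)].

(** Counts gaps rather than points, hence the successor: each gap costs one factor 3 when [pbin] is
    replaced by [kap]. *)
Definition npts E : nat := (\sum_(j < M) (size (E j)).+1)%N.

Definition fweight (ws : seq (seq bool)) : R := \prod_(i < M) 2 ^- size (nth [::] ws i).

(** For given widths the words of different strips are chosen independently, so the sum is a product
    over the strips, each factor being bounded by [words_through] and [pchain_le]. *)
Lemma sum_meets E : (forall j, (j < M)%N -> chain_ok k E j) ->
  \sum_(ws <- strip_words 0 M | meets (nth [::] ws) E) fweight ws <= 3 ^+ npts E * chains_weight M k R E.
Proof.
move=> ch.
pose g j (w : seq bool) : R := if all (passes w) (E j) then 2 ^- size w else 0.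
have -> : \sum_(ws <- strip_words 0 M | meets (nth [::] ws) E) fweight ws =
  \sum_(ws <- strip_words 0 M) \prod_(i < M) g (0 + i)%N (nth [::] ws i).
  rewrite big_mkcond; apply: eq_bigr => ws _; case: ifP => [/forallP h|/forallPn[i hi]].
    by apply: eq_bigr => i _; rewrite /g add0n h.
  by rewrite (bigD1 i)//= /g add0n (negPf hi) mul0r.
rewrite prod_fams /npts /chains_weight -prodrXr -big_split/=; apply: ler_prod => i _.
rewrite add0n; apply/andP; split.
  by apply: sumr_ge0 => w _; rewrite /g; case: ifP => // _; rewrite invr_ge0 exprn_ge0.
have := pchain_le R (0, 0)%N (rcons (E i) (ends k i)); rewrite size_rcons; apply: le_trans.
apply: le_trans (words_through R (ch i (ltn_ord i))).
rewrite /= !subn0 big_filter big_mkcond [leRHS]big_mkcond; apply: ler_sum => w _.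
rewrite /g; case: eqP => //= _.
rewrite (eq_all (a2 := fun e => passes w (sub2 e (0, 0)%N))) //.
by move=> e; rewrite /sub2 !subn0 -surjective_pairing.
Qed.

Lemma npts_up v c E : (step_strip v c < M)%N -> c.1.1 = false -> npts (add_point v c E) = (npts E).+1.
Proof.
move=> jM hv; rewrite /npts (bigD1 (Ordinal jM))//= [in RHS](bigD1 (Ordinal jM))//=.
rewrite /add_point hv eqxx (perm_size (ins_perm _ _)) /= !addSn; congr (_.+2 + _)%N.
apply: eq_bigr => i /negPf h; case: eqP => // e; move: h.
by rewrite -(inj_eq val_inj)/= e eqxx.
Qed.

(** A vertical step trades its condition on the word for one more prescribed point, which fits into
    the chain since points of one path are comparable. Horizontal steps need no factor 3, but are
    granted one so that the exponent depends only on the length of the walk. *)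
Lemma sum_paths V v E cs : (forall j, chain_ok k E j) ->
  \sum_(ws <- strip_words 0 M | meets (nth [::] ws) E && pathok M k (nth [::] ws) V v cs)
     fweight ws <= 3 ^+ (npts E + size cs) * walk_weight M k R V v E cs.
Proof.
have f0 ws : 0 <= fweight ws by apply: prodr_ge0 => i _; rewrite invr_ge0 exprn_ge0.
elim: cs V v E => [|c cs IH] V v E ch /=.
  rewrite addn0; under eq_bigl do rewrite andbT.
  by apply: sum_meets => j _; exact: ch.
case hc : (step_valid M k v c); last first.
  by rewrite big_pred0 ?mulr0// => ws; rewrite andbF.
case hf : (step_to k v c \notin V); last first.
  by rewrite big_pred0 ?mulr0// => ws; rewrite !andbF.
case hv : c.1.1.
  have upEE : add_point v c E = E by rewrite /add_point hv.
  rewrite upEE ch/=; apply: (le_trans _ (ler_wpM2r (walk_weight_ge0 _ _ _ _ _ _ _) _)); last first.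
    apply: (@ler_weXn2l _ _ _ (npts E + size cs)); first by rewrite ler1n.
    by rewrite leq_add2l.
  apply: le_trans (IH _ _ _ ch); rewrite big_mkcond [leRHS]big_mkcond.
  apply: ler_sum => ws _; case: ifP => [/and3P[-> _ ->]//|_].
  by case: ifP.
have jM : (step_strip v c < M)%N.
  move: c hc hv {hf} => [[[] []] [x y]] //=; rewrite /step_strip/=; first by case/and4P.
  by case/and4P => /andP[]; lia.
have ez : le2 c.2 (ends k (step_strip v c)).
  move: c hc hv {hf jM} => [[[] []] [x y]] //=; rewrite /step_strip/= /ends /le2 /=.
    by case/and4P => _ -> ->.
  by case/and4P => /andP[v0 _] -> h _; rewrite prednK.
have key ws : ws \in strip_words 0 M -> meets (nth [::] ws) E -> step_on_word (nth [::] ws) v c ->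
    meets (nth [::] ws) (add_point v c E) /\ chain_ok k (add_point v c E) (step_strip v c).
  move=> /mem_strip_words[_ /(_ _ jM)]; rewrite add0n mem_words_of => /andP[/eqP lw /eqP uw].
  have sw : size (nth [::] ws (step_strip v c)) = (k (step_strip v c) + k (step_strip v c).+1)%N.
    by rewrite -lw -uw /lower_edges /upper_edges -(count_predC id); congr addn; apply: eq_count.
  move=> /forallP me; rewrite /step_on_word hv => /andP[_ pc]; split.
    apply/forallP => j; rewrite /add_point hv; case: eqP => [ej|_]; last exact: me.
    by rewrite (perm_all _ (ins_perm _ _))/= me ej pc.
  rewrite /chain_ok /add_point hv eqxx; apply: ins_path => //; first exact: ch.
  move=> d dE; have := me (Ordinal jM) => /= /allP /(_ _ dE) pd.
  have dz : le2 d (ends k (step_strip v c)).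
    have := ch (step_strip v c); rewrite /chain_ok -cats1 cat_path => /andP[pl /= /andP[lz _]].
    have : path le2 (0, 0)%N (rcons (E (step_strip v c)) (ends k (step_strip v c))) by exact: ch.
    rewrite path_sortedE; last exact: le2_trans.
    move=> /andP[_]; rewrite -cats1 (sorted_pairwise (@le2_trans)) pairwise_cat.
    by move=> /and3P[/allrelP /(_ _ _ dE (mem_head _ _))].
  apply: (@passes_total (nth [::] ws (step_strip v c))) => //; rewrite sw.
    by move: ez; rewrite /le2 /ends /=; lia.
  by move: dz; rewrite /le2 /ends /=; lia.
rewrite /=; case: ifP => hch; last first.
  rewrite big_seq_cond big_pred0 ?mulr0// => ws.
  apply/negbTE/negP => /and4P[wf me on _]; have [_] := key ws wf me on.
  by rewrite hch.
rewrite addnS -addSn -(npts_up _ jM hv); apply: le_trans (IH _ _ _ _); last first.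
  move=> j; case: (eqVneq j (step_strip v c)) => [->//|/negPf jn].
  by have := ch j; rewrite /chain_ok /add_point hv jn.
rewrite big_seq_cond [leRHS]big_mkcond big_mkcond [leRHS]big_seq big_mkcondr.
rewrite [leRHS]big_mkcond/= [leLHS]big_mkcond/=.
apply: ler_sum => ws _; case: (boolP (ws \in _)) => // wf.
case: ifP => [/and3P[me on pk]|_]; last by case: ifP.
by have [-> _] := key ws wf me on; rewrite pk.
Qed.

End Families.

Definition nwalks (K M m : nat) (k : nat -> nat) (w : nat -> seq bool) : nat :=
  (\sum_(a <- iota 0 K) count (pathok M k w [:: (m, a)] (m, a)) (walk_codes K m))%N.

Fixpoint width_seqs (K n : nat) : seq (seq nat) :=
  if n is n'.+1 then [seq a :: l | a <- iota 1 K, l <- width_seqs K n'] else [:: [::]].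

Lemma mem_width_seqs K n l : (l \in width_seqs K n) = (size l == n) && all (fun a => 0 < a <= K)%N l.
Proof.
elim: n l => [|n IH] l /=; first by rewrite in_cons orbF; case: l.
apply/allpairsP/andP => [[[a l'] /= [aK lk ->]]|[]].
  by move: lk aK; rewrite IH /= mem_iota eqSS => /andP[-> ->]; split=> //; lia.
case: l => //= a l; rewrite eqSS => sl /andP[aK al]; exists (a, l); split=> //=.
  by rewrite mem_iota; lia.
by rewrite IH sl.
Qed.

Section WalkSum.
Variable R : realType.

Lemma kap_seq_sum K n a :
  \sum_(l <- width_seqs K n) \prod_(j < n) kap R (nth 0%N (a :: l) j) (nth 0%N (a :: l) j.+1)
  <= 40 ^+ n.
Proof.
elim: n a => [|n IH] a; first by rewrite big_seq1 big_ord0.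
rewrite /= big_allpairs_dep exprS.
apply: (@le_trans _ _ (\sum_(b <- iota 1 K) kap R a b * 40 ^+ n)).
  apply: ler_sum => b _; rewrite /=.
  under eq_bigr do rewrite big_ord_recl.
  rewrite -[leLHS]/(\sum_(i <- width_seqs K n) kap R a b *
    \prod_(j < n) kap R (nth 0%N (b :: i) j) (nth 0%N (b :: i) j.+1)).
  by rewrite -mulr_sumr ler_wpM2l ?kap_ge0//; exact: IH.
rewrite -mulr_suml ler_wpM2r ?exprn_ge0 ?ler0n//.
apply: le_trans (kap_column R a K.+1).
by rewrite /index_iota subn0 [leRHS]big_cons lerDr kap_ge0.
Qed.

(** With no prescribed points each strip is a single gap, of weight [kap] of its two widths. The
    exponent of 3 is made of these M gaps and of the m steps; the factor K counts starting
    indices. *)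
Lemma sum_nwalks A K M m k : 1922 <= A :> R ->
  \sum_(ws <- strip_words k 0 M) fweight R M ws * (nwalks K M m k (nth [::] ws))%:R
  <= 3 ^+ (M + m) * K%:R * A ^+ m * \prod_(j < M) kap R (k j) (k j.+1).
Proof.
move=> hA; pose E0 : nat -> seq (nat * nat) := fun=> [::].
have PE : chains_weight M k R E0 = \prod_(j < M) kap R (k j) (k j.+1).
  by apply: eq_bigr => j _; rewrite /= mulr1 /kapd /= !subn0.
have nE : npts M E0 = M by rewrite /npts sum1_card card_ord.
rewrite -PE.
have -> : \sum_(ws <- strip_words k 0 M) fweight R M ws * (nwalks K M m k (nth [::] ws))%:R =
  \sum_(a <- iota 0 K) \sum_(cs <- walk_codes K m) \sum_(ws <- strip_words k 0 M |
    meets M (nth [::] ws) E0 && pathok M k (nth [::] ws) [:: (m, a)] (m, a) cs) fweight R M ws.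
  under [RHS]eq_bigr do under eq_bigr do rewrite big_mkcond /=.
  under [RHS]eq_bigr do rewrite exchange_big /=.
  rewrite [RHS]exchange_big /=; apply: eq_bigr => ws _.
  rewrite /nwalks natr_sum mulr_sumr; apply: eq_bigr => a _.
  rewrite -sum1_count natr_sum mulr_sumr big_mkcond; apply: eq_bigr => cs _.
  have -> : meets M (nth [::] ws) E0 by apply/forallP.
  by case: ifP => //= _; rewrite mulr1.
apply: (@le_trans _ _ (\sum_(a <- iota 0 K) 3 ^+ (M + m) * (A ^+ m * chains_weight M k R E0))); last first.
  by rewrite big_const_seq iter_addr addr0 count_predT size_iota -mulr_natr; lra.
apply: ler_sum => a _.
apply: (@le_trans _ _ (\sum_(cs <- walk_codes K m) 3 ^+ (M + m) * walk_weight M k R [:: (m, a)] (m, a) E0 cs)).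
  rewrite big_seq [leRHS]big_seq; apply: ler_sum => cs hcs.
  have sz : size cs = m.
    elim: {A hA PE nE a} m cs hcs => [|m IH] cs; first by rewrite in_cons orbF => /eqP ->.
    by rewrite codesS => /allpairsP[[c cs'] /= [_ /IH <- ->]].
  rewrite -[in 3 ^+ (M + m)]nE -[in 3 ^+ (_ + m)]sz.
  exact: sum_paths.
rewrite -mulr_sumr ler_wpM2l ?exprn_ge0 ?ler0n//; apply: walk_weight_sum => //.
by split=> //=; rewrite mem_head.
Qed.

Lemma sum_all_nwalks A K M m : 1922 <= A :> R ->
  \sum_(l <- width_seqs K M) \sum_(ws <- strip_words (nth 0%N (1%N :: l)) 0 M)
     fweight R M ws * (nwalks K M m (nth 0%N (1%N :: l)) (nth [::] ws))%:R
  <= 3 ^+ (M + m) * K%:R * A ^+ m * 40 ^+ M.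
Proof.
move=> hA; have A0 : 0 <= A by apply: le_trans hA; exact: ler0n.
have := kap_seq_sum K M 1.
have c0 : 0 <= 3 ^+ (M + m) * K%:R * A ^+ m :> R.
  by rewrite !mulr_ge0 ?exprn_ge0 ?ler0n.
move=> /(ler_wpM2l c0); apply: le_trans.
by rewrite mulr_sumr; apply: ler_sum => l _; exact: sum_nwalks.
Qed.

End WalkSum.

(** * The critical Galton-Watson description of the law of T *)
Section Esum.
Variable R : realType.
Local Open Scope ereal_scope.

Lemma esumZl (T : choiceType) (I : set T) (c : R) (a : T -> \bar R) :
  (0 <= c)%R -> (forall i, I i -> 0 <= a i) ->
  \esum_(i in I) (c%:E * a i) = c%:E * \esum_(i in I) a i.
Proof.
have half (d : R) (b : T -> \bar R) : (0 <= d)%R -> (forall i, I i -> 0 <= b i) ->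
    \esum_(i in I) (d%:E * b i) <= d%:E * \esum_(i in I) b i.
  move=> d0 b0; apply: ge_ereal_sup => _ /= [X [finX XI]] <-.
  rewrite fsbig_finite// big_seq -ge0_sume_distrr -?big_seq; last first.
    by move=> i; rewrite in_fset_set// inE => /XI/b0.
  rewrite lee_wpmul2l ?lee_fin//; apply: esum_ge; exists X => //.
  by rewrite fsbig_finite.
move=> c0 a0; apply/eqP; rewrite eq_le half//=.
have [->|c1] := eqVneq c 0%R.
  by rewrite mul0e esum_ge0// => i _; rewrite mul0e.
have {c1}c0 : (0 < c)%R by rewrite lt_neqAle eq_sym c1.
have ci : (0 <= c^-1)%R by rewrite invr_ge0 ltW.
(* The reverse inequality is the same one with the inverse scalar. *)
have := half c^-1%R (fun i => c%:E * a i) ci.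
have -> : \esum_(i in I) ((c^-1)%:E * (c%:E * a i)) = \esum_(i in I) a i.
  by apply: eq_esum => i _; rewrite muleA -EFinM mulVf ?gt_eqF// mul1e.
move=> /(_ _)/(@lee_wpmul2l _ c%:E) h.
have hc : 0 <= c%:E by rewrite lee_fin ltW.
have ha i : I i -> 0 <= c%:E * a i by move=> Ii; rewrite mule_ge0 ?a0.
by apply: (le_trans (h hc ha)); rewrite muleA -EFinM mulfV ?gt_eqF// mul1e.
Qed.

Lemma esum_cons (T : choiceType) (I : set T) (J : T -> set (seq T)) (a : seq T -> \bar R) :
  (forall t s, I t -> J t s -> 0 <= a (t :: s)) ->
  \esum_(s in [set s | exists t s', [/\ I t, J t s' & s = t :: s']]) a s =
  \esum_(t in I) \esum_(s in J t) a (t :: s).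
Proof.
move=> a0; rewrite esum_esum//.
rewrite (@reindex_esum _ _ _ (I `*`` J) _ (fun p => p.1 :: p.2))//; split.
- by move=> [t s] /= [It Jt]; exists t, s.
- by move=> [t s] [t' s'] _ _ /= [-> ->].
- by move=> _ /= [t [s [It Jt ->]]]; exists (t, s).
Qed.

Lemma esum_geometric (x : R) : (0 <= x < 2)%R ->
  \esum_(a in [set: nat]) ((2 ^- a.+1 * x ^+ a)%R)%:E = ((2 - x)^-1)%:E.
Proof.
move=> /andP[x0 x2].
have h (n : nat) : (2 ^- n.+1 * x ^+ n = geometric 2^-1 (x / 2) n)%R.
  by rewrite /geometric /= exprS invfM -mulrA expr_div_n [(_ ^- n * _)%R]mulrC.
rewrite -nneseries_esumT; last by move=> n; rewrite lee_fin mulr_ge0 ?invr_ge0 ?exprn_ge0.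
have c : series (geometric 2^-1 (x / 2)) @ \oo --> (2^-1 * (1 - x / 2)^-1)%R.
  by apply: cvg_geometric_series; rewrite ger0_norm ?divr_ge0// ltr_pdivrMr// mul1r.
have -> : ((2 - x)^-1 = 2^-1 * (1 - x / 2)^-1)%R.
  by rewrite -invfM mulrBr mulr1 mulrCA divff ?mulr1.
apply: cvg_lim => //.
have -> : (fun n => \sum_(0 <= i < n) (2 ^- i.+1 * x ^+ i)%:E) =
    EFin \o series (geometric 2^-1 (x / 2)).
  by apply/funext => n /=; rewrite sumEFin; congr EFin; apply: eq_bigr => i _.
exact: cvg_comp c _.
Qed.

(* A strip word true false^a1 true false^a2 ... is the list of the offspring
   numbers a1, a2, ... of its lower edges.  At the critical point the weight of
   a triangulation is then its probability under the Galton-Watson process with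
   offspring law 2^-(a+1). *)
Definition offspring_wt (r : seq nat) : R := 2 ^- (size r + sumn r).

Lemma esum_offspring k (x : R) : (0 <= x < 2)%R ->
  \esum_(r in [set r | size r = k]) ((offspring_wt r * x ^+ sumn r)%R)%:E = ((2 - x) ^- k)%:E.
Proof.
move=> hx; have /andP[x0 x2] := hx.
elim: k => [|k IH].
  have -> : [set r : seq nat | size r = 0%N] = [set [::]].
    by apply/seteqP; split=> [[]|_ ->].
  by rewrite esum_set1 ?lee_fin /offspring_wt /= expr0 invr1 mulr1.
have -> : [set r : seq nat | size r = k.+1] =
    [set s | exists t s', [/\ [set: nat] t, [set r : seq nat | size r = k] s' & s = t :: s']].
  apply/seteqP; split=> [[//|t s] /= [sk]|_ [t [s [_ /= sk ->]]]]; last by rewrite /= sk.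
  by exists t, s.
have p0 (r : seq nat) : (0 <= offspring_wt r * x ^+ sumn r)%R.
  by rewrite mulr_ge0 ?exprn_ge0 ?invr_ge0 ?exprn_ge0.
rewrite (esum_cons (J := fun=> [set r : seq nat | size r = k])); last first.
  by move=> t s _ _; rewrite lee_fin.
transitivity (\esum_(t in [set: nat]) (((2 - x) ^- k)%:E * ((2 ^- t.+1 * x ^+ t)%R)%:E)).
  apply: eq_esum => t _; rewrite -IH muleC -esumZl//.
  - apply: eq_esum => r _; rewrite -EFinM; congr EFin.
    rewrite /offspring_wt /= (_ : (size r).+1 + (t + sumn r) = t.+1 + (size r + sumn r))%N; last by lia.
    by rewrite !exprD invfM; ring.
  - by rewrite mulr_ge0 ?exprn_ge0 ?invr_ge0 ?exprn_ge0.
  - by move=> r _; rewrite lee_fin.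
rewrite esumZl ?esum_geometric//.
- by rewrite -EFinM -invfM -exprSr.
- by rewrite invr_ge0 exprn_ge0// subr_ge0 ltW.
- by move=> t _; rewrite lee_fin mulr_ge0 ?exprn_ge0 ?invr_ge0 ?exprn_ge0.
Qed.

(** Positivity of each sum is survival: every circle must carry an edge. *)
Fixpoint gens_valid (k : nat) (rs : seq (seq nat)) : bool :=
  if rs is r :: rs' then [&& size r == k, 0 < sumn r & gens_valid (sumn r) rs']%N else true.

Definition top_width (k : nat) (rs : seq (seq nat)) : nat := last k (map sumn rs).

Definition gens_wt (rs : seq (seq nat)) : R := \prod_(r <- rs) offspring_wt r.

Definition gens_set (n k : nat) : set (seq (seq nat)) := [set rs | size rs = n /\ gens_valid k rs].

Definition gens_sum (n k : nat) (g : nat -> R) : \bar R :=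
  \esum_(rs in gens_set n k) ((gens_wt rs * g (top_width k rs))%R)%:E.

Lemma wt_ge0 rs : (0 <= gens_wt rs)%R.
Proof. by apply: prodr_ge0 => r _; rewrite invr_ge0 exprn_ge0. Qed.

Lemma Vs0 k g : (0 <= g k)%R -> gens_sum 0 k g = (g k)%:E.
Proof.
move=> g0; rewrite /gens_sum /gens_set; have -> : [set rs | size rs = 0%N /\ gens_valid k rs] = [set [::]].
  by apply/seteqP; split=> [[|? ?] []|_ ->].
by rewrite esum_set1 /gens_wt /top_width ?big_nil ?mul1r ?lee_fin.
Qed.

Lemma VsS n k g : (forall k, 0 <= g k)%R -> gens_sum n.+1 k g =
  \esum_(r in [set r | size r = k]) ((offspring_wt r)%:E *
     (if (0 < sumn r)%N then gens_sum n (sumn r) g else 0)).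
Proof.
move=> g0; rewrite /gens_sum.
have -> : gens_set n.+1 k = [set s | exists t s',
    [/\ [set r | size r = k /\ (0 < sumn r)%N] t, gens_set n (sumn t) s' & s = t :: s']].
  apply/seteqP; split=> [[|r rs] [//= [sn]] /and3P[/eqP sr s0 ok]|_ [r [rs [[sr s0] [sn ok] ->]]]].
    by exists r, rs.
  by split; rewrite /= ?sn ?sr ?eqxx ?s0.
rewrite esum_cons; last by move=> *; rewrite lee_fin mulr_ge0 ?wt_ge0.
rewrite (_ : [set r | _ /\ _] = [set r | size r = k] `&` [set r | 0 < sumn r]%N)//.
rewrite esum_mkcondr; apply: eq_esum => r sr.
rewrite (_ : (r \in [set r | 0 < sumn r]%N) = (0 < sumn r)%N); last first.
  by apply/idP/idP; rewrite inE.
case: ifP => s0; last by rewrite mule0.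
rewrite -esumZl.
- apply: eq_esum => rs _; rewrite -EFinM; congr EFin.
  by rewrite /gens_wt big_cons mulrA.
- by rewrite invr_ge0 exprn_ge0.
- by move=> *; rewrite lee_fin mulr_ge0 ?wt_ge0.
Qed.

(** The offspring law has generating function 1/(2 - x), whose n-th iterate at 0 is n/(n+1). This is
    the probability that one individual has no descendants in generation n. *)
Lemma Vs_survive n k : (0 < k)%N -> gens_sum n k (fun=> 1%R) = ((1 - (n%:R / n.+1%:R) ^+ k)%R)%:E.
Proof.
elim: n k => [|n IH] k k0.
  by rewrite Vs0// (_ : 0%:R = 0%R)// mul0r expr0n gtn_eqF// subr0.
rewrite VsS//; pose y : R := (n%:R / n.+1%:R)%R.
have y0 : (0 <= y)%R by rewrite divr_ge0.
have y1 : (y < 1)%R by rewrite ltr_pdivrMr// mul1r ltr_nat.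
transitivity (\esum_(r in [set r | size r = k]) ((offspring_wt r * (1 - y ^+ sumn r))%R)%:E).
  apply: eq_esum => r _; case: ifP => [s0|]; first by rewrite IH// -EFinM.
  by move/negbT; rewrite -eqn0Ngt => /eqP ->; rewrite expr0 subrr mulr0 mule0.
have w0 r : (0 <= offspring_wt r)%R by rewrite invr_ge0 exprn_ge0.
have h1 : (0 <= (1 : R) < 2)%R by rewrite ler01 ltr1n.
have hy : (0 <= y < 2)%R by rewrite y0 (lt_trans y1)// ltr1n.
have := esum_offspring k h1; rewrite (_ : 2 - 1 = 1)%R; last by ring.
rewrite expr1n invr1.
have -> : \esum_(r in [set r | size r = k]) ((offspring_wt r * 1 ^+ sumn r)%R)%:E =
   \esum_(r in [set r | size r = k]) (((offspring_wt r * (1 - y ^+ sumn r))%R)%:E +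
     ((offspring_wt r * y ^+ sumn r)%R)%:E).
  by apply: eq_esum => r _; rewrite -EFinD expr1n mulr1 -mulrDr subrK mulr1.
rewrite esumD; last 2 first.
- by move=> r _; rewrite lee_fin mulr_ge0// subr_ge0 exprn_ile1// ltW.
- by move=> r _; rewrite lee_fin mulr_ge0// exprn_ge0.
rewrite esum_offspring//.
have -> : ((n.+1%:R / n.+2%:R) = (2 - y)^-1 :> R)%R.
  have n0 : (0 <= n%:R :> R)%R by [].
  by rewrite /y -!natr1; field; do ?[apply/andP; split]; apply: lt0r_neq0; lra.
rewrite -exprVn; case: (\esum_(i in _) _) => [u| |]//.
by rewrite -EFinD => -[e]; congr EFin; apply/esym/eqP; rewrite subr_eq e.
Qed.

(** The map x -> 1/(2 - x) sends 1 + 1/(s+1) to 1 + 1/s, so n iterations lead from t + n to t. Only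
    an inequality is obtained because extinct families are left out of [gens_sum]. At t = k = 1 it
    bounds an exponential moment of the top width by 2. *)
Lemma Vs_top n k (t : R) : (0 < t)%R ->
  gens_sum n k (fun i => (1 + (t + n%:R)^-1) ^+ i)%R <= ((1 + t^-1) ^+ k)%:E.
Proof.
elim: n k t => [|n IH] k t t0.
  by rewrite Vs0 addr0// exprn_ge0// addr_ge0// invr_ge0 ltW.
rewrite VsS; last first.
  by move=> i; rewrite exprn_ge0// addr_ge0// invr_ge0 addr_ge0// ltW.
pose x : R := (1 + (t + 1)^-1)%R.
have t1 : (0 < t + 1)%R by rewrite addr_gt0.
have i0 : (0 <= (t + 1)^-1)%R by rewrite invr_ge0 ltW.
have i1 : ((t + 1)^-1 < 1)%R by rewrite invf_lt1// ltrDr.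
have hx : (0 <= x < 2)%R by rewrite /x; apply/andP; split; lra.
have -> : ((1 + t^-1) ^+ k = (2 - x) ^- k)%R.
  by rewrite -exprVn; congr (_ ^+ _)%R; rewrite /x; field; rewrite !gt_eqF//=; lra.
rewrite -esum_offspring//; apply: le_esum => r _.
rewrite EFinM lee_wpmul2l ?lee_fin ?invr_ge0 ?exprn_ge0//.
case: ifP => _; last by rewrite lee_fin exprn_ge0//; case/andP: hx.
have -> : (t + n.+1%:R = (t + 1) + n%:R)%R by rewrite -natr1; ring.
exact: IH.
Qed.

Definition enc_word (r : seq nat) : seq bool := flatten [seq true :: nseq a false | a <- r].

Lemma count_enc r : lower_edges (enc_word r) = size r /\ upper_edges (enc_word r) = sumn r.
Proof.
elim: r => //= a r [h1 h2]; rewrite /lower_edges /upper_edges /enc_word /= !count_cat !count_nseq.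
by rewrite -/(enc_word r) -/(lower_edges _) -/(upper_edges _) h1 h2 mul0n mul1n.
Qed.

Lemma size_enc r : size (enc_word r) = (size r + sumn r)%N.
Proof.
have [h1 h2] := count_enc r; rewrite -h1 -h2 /lower_edges /upper_edges -(count_predC id).
by congr addn; apply: eq_count.
Qed.

Lemma enc_surj w : exists a r, w = nseq a false ++ enc_word r.
Proof.
elim: w => [|b w [a [r ->]]]; first by exists 0%N, [::].
by case: b; [exists 0%N, (a :: r)|exists a.+1, r].
Qed.

Lemma enc_cat_inj a a' r r' : nseq a false ++ enc_word r = nseq a' false ++ enc_word r' -> r = r'.
Proof.
elim: r a r' a' => [|b r IH] a r' a'.
  move/(congr1 lower_edges); rewrite /lower_edges !count_cat !count_nseq !mul0n.
  by rewrite -/(lower_edges _) -/(lower_edges _) !(count_enc _).1; case: r'.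
elim: a a' => [|a IHa] [|a'] //=; last by case=> /IHa.
  case: r' => [|b' r'] //; rewrite /enc_word /= -/(enc_word r) -/(enc_word r') => -[h].
  have e := IH _ _ _ h; move: h; rewrite e => /(congr1 size).
  by rewrite !size_cat !size_nseq => /addIn ->.
by case: r' IHa.
Qed.

Lemma enc_inj : injective enc_word.
Proof. by move=> r r' h; apply: (@enc_cat_inj 0 0). Qed.

Lemma is_strip_enc r : is_strip (enc_word r) = (0 < size r)%N && (0 < sumn r)%N.
Proof.
rewrite /is_strip; congr (_ && _); first by case: r.
rewrite -(count_enc r).2 /upper_edges -has_count; apply/idP/hasP => [h|[[]]//].
by exists false.
Qed.

Lemma okrP k rs : (0 < k)%N ->
  gens_valid k rs = [&& all is_strip (map enc_word rs), (rs == [::]) || (size (head [::] rs) == k)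
    & sorted glued (map enc_word rs)].
Proof.
elim: rs k => [//|r rs IH] k k0; rewrite /= is_strip_enc.
case: (eqVneq (size r) k) => [sr|]; last by rewrite andbF.
rewrite sr k0 /=; case: (posnP (sumn r)) => //= s0; rewrite IH//.
case: rs {IH} => //= r' rs; rewrite /glued (count_enc _).1 (count_enc _).2 eq_sym.
by rewrite [sumn r == _]eq_sym; case: (size r' == _); rewrite ?andbF.
Qed.

Lemma LT_enc N : LT N = map enc_word @` gens_set N 1.
Proof.
apply/seteqP; split=> [s [sN /allP al hl so]|_ [rs [sN] + <-]]; last first.
  rewrite okrP// => /and3P[al hl so]; split=> //; first by rewrite size_map.
  by case: rs {sN al so} hl => //= r rs /eqP; rewrite (count_enc r).1.
have : exists rs, map enc_word rs = s.
  elim: s al {sN hl so} => [|w s IH] al; first by exists [::].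
  have [|rs <-] := IH; first by move=> x xs; apply: al; rewrite in_cons xs orbT.
  have /andP[hw _] := al w (mem_head _ _).
  by have [[|a] [r wE]] := enc_surj w; [exists (r :: rs); rewrite /= wE|move: hw; rewrite wE].
move=> [rs rsE]; exists rs => //; split; first by rewrite -sN -rsE size_map.
rewrite okrP// rsE so andbT; apply/andP; split; first exact/allP.
by move: hl; rewrite -rsE; case: (rs) => //= r rs'; rewrite (count_enc r).1 => ->.
Qed.

Lemma weight_enc rs : weight (mu_cr R) (map enc_word rs) = (gens_wt rs)%:E.
Proof.
rewrite /weight /mu_cr mulNr expRN expRM_natr lnK ?posrE//; congr EFin.
rewrite /gens_wt /ntriangles; elim: rs => [|r rs IH]; first by rewrite big_nil invr1.
by rewrite /= exprD invfM IH big_cons size_enc.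
Qed.

Lemma okr_cat k rs rs' : gens_valid k (rs ++ rs') = gens_valid k rs && gens_valid (top_width k rs) rs'.
Proof. by elim: rs k => //= r rs IH k; rewrite IH /top_width /= !andbA. Qed.

Lemma top_gt0 k rs : (0 < k)%N -> gens_valid k rs -> (0 < top_width k rs)%N.
Proof. by elim: rs k => //= r rs IH k _ /and3P[_ s0 /IH]; apply. Qed.

Lemma map_enc_inj A : set_inj A (map enc_word).
Proof. by move=> s t _ _; apply: inj_map; exact: enc_inj. Qed.

(** The partition function is the survival probability of one individual through N generations, that
    is 1/(N+1). Above the first M generations there is an independent process, started from their
    top width, that has to survive N - M generations. *)
Lemma P_finE N M rs : (M <= N)%N -> gens_set M 1 rs ->
  P_fin N (mu_cr R) [set t | take M t = map enc_word rs] =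
  (gens_wt rs * (1 - ((N - M)%:R / (N - M).+1%:R) ^+ top_width 1 rs) * N.+1%:R)%R.
Proof.
move=> MN [sM ok]; rewrite /P_fin.
have -> : \esum_(s in LT N) weight (mu_cr R) s = (N.+1%:R^-1)%:E.
  rewrite LT_enc esum_image; last exact: map_enc_inj.
  transitivity (gens_sum N 1 (fun=> 1%R)).
    by apply: eq_esum => s _; rewrite weight_enc mulr1.
  rewrite Vs_survive// expr1; congr EFin.
  by rewrite -(@natr1 _ N); field; rewrite natr1 pnatr_eq0.
have -> : \esum_(s in LT N `&` [set t | take M t = map enc_word rs]) weight (mu_cr R) s =
    (gens_wt rs)%:E * gens_sum (N - M) (top_width 1 rs) (fun=> 1%R).
  rewrite /gens_sum -esumZl; last 2 first.
  - exact: wt_ge0.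
  - by move=> *; rewrite lee_fin mulr1 wt_ge0.
  rewrite (@reindex_esum _ _ _ (gens_set (N - M) (top_width 1 rs)) _ (fun rs' => map enc_word (rs ++ rs'))).
    apply: eq_esum => rs' _; rewrite weight_enc -EFinM mulr1; congr EFin.
    by rewrite /gens_wt big_cat.
  split.
  - move=> rs' [sN' ok']; split.
      rewrite LT_enc; exists (rs ++ rs') => //; split; last by rewrite okr_cat ok ok'.
      by rewrite size_cat sM sN' subnKC.
    by rewrite /= map_cat take_size_cat// size_map.
  - by move=> r1 r2 _ _ /(inj_map enc_inj)/eqP; rewrite eqseq_cat// => /andP[_ /eqP].
  - move=> t [+ tM]; rewrite LT_enc => -[rs2 [s2 ok2] tE].
    have e : take M rs2 = rs.
      by apply: (inj_map enc_inj); rewrite -tM -tE -map_take.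
    exists (drop M rs2); last by rewrite -e cat_take_drop.
    split; first by rewrite size_drop s2.
    by move: ok2; rewrite -{1}(cat_take_drop M rs2) okr_cat e => /andP[].
rewrite Vs_survive; last exact: top_gt0.
by rewrite -EFinM /= invrK.
Qed.

Section Law.
Variable P : probability (LTspace) R.
Hypothesis hP : local_weak_limit (mu_cr R) P.

(** With n = N - M and k the top width, Bernoulli's inequality bounds 1 - (n/(n+1))^k by k/(n+1),
    and (N+1)/(n+1) <= 2 once N >= 2M. The limit law is thus dominated by twice a size-biased
    Galton-Watson law. *)
Lemma P_restr_le M rs : gens_set M 1 rs ->
  P [set T : LTspace | restr T M = map enc_word rs] <= (2 * (top_width 1 rs)%:R * gens_wt rs)%:E.
Proof.
move=> X; have LTs : LT M (map enc_word rs) by rewrite LT_enc; exists rs.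
apply: cvge_le (hP LTs); exists (M + M)%N => //= N /= hN.
have MN : (M <= N)%N by lia.
rewrite lee_fin P_finE//; set n := (N - M)%N; set k := top_width 1 rs.
have Nn : (N.+1%:R <= 2 * n.+1%:R :> R)%R by rewrite -natrM ler_nat /n; lia.
have bern : (1 - k%:R * n.+1%:R^-1 <= (n%:R / n.+1%:R) ^+ k :> R)%R.
  have -> : (n%:R / n.+1%:R = 1 - n.+1%:R^-1 :> R)%R.
    by rewrite -natr1; field; rewrite natr1 pnatr_eq0.
  have : (0 <= n.+1%:R^-1 :> R)%R by rewrite invr_ge0 ler0n.
  have : (n.+1%:R^-1 <= 1 :> R)%R by rewrite invf_le1 ?ltr0n// ler1n.
  move: (n.+1%:R^-1)%R => h h1 h0.
  elim: k => [|k IH]; first by rewrite mul0r subr0 expr0.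
  rewrite exprS; have := ler_wpM2l (_ : 0 <= 1 - h)%R IH; rewrite subr_ge0 => /(_ h1).
  apply: le_trans; rewrite -natr1.
  have : (0 <= k%:R * h * h)%R by rewrite !mulr_ge0.
  lra.
rewrite [leRHS]mulrC -mulrA ler_wpM2l ?wt_ge0//.
have n0 : (0 <= n.+1%:R :> R)%R by [].
have kn0 : (0 <= k%:R * n.+1%:R^-1 :> R)%R by rewrite mulr_ge0 ?invr_ge0.
apply: (@le_trans _ _ (k%:R * n.+1%:R^-1 * (2 * n.+1%:R)))%R.
  apply: ler_pM => //.
  rewrite subr_ge0 exprn_ile1// ?divr_ge0// ler_pdivrMr ?ltr0n// mul1r ler_nat//.
  by rewrite lerBlDr -lerBlDl.
by rewrite mulrCA divfK ?pnatr_eq0.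
Qed.

Lemma measurable_restr (M : nat) (S : set (seq (seq bool))) :
  measurable ([set T | S (restr T M)] : set LTspace).
Proof.
pose F n : set LTspace := if @unpickle (seq (seq bool)) n is Some s then
   if `[< S s >] then [set T : LTspace | restr T M = s] else set0 else set0.
have mF n : measurable (F n).
  rewrite /F; case: (unpickle n) => [s|]; last exact: measurable0.
  case: asboolP => _; last exact: measurable0.
  by apply: sub_sigma_algebra; exists M, s.
rewrite (_ : [set T | _] = \bigcup_n F n); first exact: bigcupT_measurable.
apply/seteqP; split=> [T ST|T [n _]].
  by exists (pickle (restr T M)) => //; rewrite /F pickleK asboolT.
by rewrite /F; case: (unpickle n) => // s; case: asboolP => // Ss /= ->.
Qed.

Lemma P_restr_sum (M : nat) (I : set (seq (seq nat))) (A : set LTspace) :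
  measurable A -> (forall T, A T -> exists2 rs, I rs & restr T M = map enc_word rs) ->
  P A <= \esum_(rs in I) P [set T : LTspace | restr T M = map enc_word rs].
Proof.
move=> mA hA.
(* [pickle_inv] answers only on genuine codes, so each [rs] occurs exactly once in the
   enumeration. *)
pose F n : set LTspace := if @pickle_inv (seq (seq nat)) n is Some rs then
   if rs \in I then [set T : LTspace | restr T M = map enc_word rs] else set0 else set0.
have mF n : measurable (F n).
  rewrite /F; case: (pickle_inv _) => [rs|]; last exact: measurable0.
  case: ifP => _; last exact: measurable0.
  exact: (measurable_restr M [set s | s = map enc_word rs]).

have AF : A `<=` \bigcup_n F n.
  move=> T /hA[rs Irs e]; exists (pickle rs) => //.
  by rewrite /F pickleK_inv ifT// inE.
have := @measure_sigma_subadditive _ _ _ P A F mF mA AF; move/le_trans; apply.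
rewrite nneseries_esumT//.
apply: (@le_trans _ _ (\esum_(n in pickle @` I) P (F n))).
  rewrite [leRHS]esum_mkcond; apply: le_esum => n _; case: ifPn => // /negP h.
  rewrite /F; case E : (pickle_inv n) => [rs|]; last by rewrite measure0.
  case: ifPn => [rI|_]; last by rewrite measure0.
  exfalso; apply: h; rewrite inE; exists rs; first by rewrite inE in rI.
  by have := @pickle_invK (seq (seq nat)) n; rewrite E.
rewrite esum_image; last by move=> x y _ _ /(pcan_inj pickleK).
by apply: le_esum => rs Irs; rewrite /F pickleK_inv ifT ?inE.
Qed.

Lemma width_top M rs (T : LTinf) : restr T M = map enc_word rs -> width T M = top_width 1 rs.
Proof.
move=> e; have sM : size rs = M by rewrite -(size_map enc_word) -e size_mkseq.
case: M e sM => [|M] e sM; first by rewrite /width (strip_bottom T); case: (rs) sM.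
have := strip_glued T M; rewrite /glued -/(width T M.+1) => /eqP <-.
have -> : T M = nth [::] (restr T M.+1) M by rewrite nth_mkseq.
rewrite e (nth_map [::]) ?sM// (count_enc _).2 /top_width.
by rewrite (last_nth 1%N) size_map sM /= (nth_map [::]) ?sM.
Qed.

Lemma binomial2 k (h : R) : (0 <= h)%R ->
  (1 + k%:R * h + k%:R * (k%:R - 1) / 2 * h ^+ 2 <= (1 + h) ^+ k)%R.
Proof.
move=> h0; elim: k => [|k IH]; first by rewrite !mul0r !addr0 expr0.
have h1 : (0 <= 1 + h)%R by lra.
rewrite [leRHS]exprS; apply: le_trans (ler_wpM2l h1 IH).
rewrite -natr1; case: k {IH} => [|k]; first by rewrite -[0%:R]/0%R; lra.
rewrite -natr1; have k0 : (0 <= k%:R :> R)%R by [].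
have : (0 <= (k%:R + 1) * k%:R / 2 * h ^+ 3)%R.
  by rewrite !mulr_ge0 ?exprn_ge0//; lra.
lra.
Qed.

(** On K < k the size-biased weight 2k is at most 2k^2/K, and k^2 <= 2 t^2 (1 + 1/t)^k with t = j +
    1 by the second-order binomial bound. By [Vs_top] the latter power has total weight at most 2,
    whence 8 t^2/K. *)
Lemma width_tail j K : (0 < K)%N ->
  P [set T : LTspace | K < width T j]%N <= (8 * j.+1%:R ^+ 2 / K%:R)%:E.
Proof.
move=> K0; pose t : R := (j.+1%:R)%R.
have t0 : (0 < t)%R by rewrite ltr0n.
have mA : measurable ([set T : LTspace | K < width T j]%N).
  have -> : [set T : LTspace | K < width T j]%N =
      [set T : LTspace | [set s | K < lower_edges (nth [::] s j)]%N (restr T j.+1)].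
    by apply/seteqP; split=> T; rewrite /= nth_mkseq.
  exact: measurable_restr.
apply: (le_trans (@P_restr_sum j [set rs | gens_set j 1 rs /\ (K < top_width 1 rs)%N] _ mA _)).
  move=> T /= KT; have := restr_LT T j; rewrite LT_enc => -[rs X e].
  by exists rs; rewrite /= -?e; [split=> //; rewrite -(@width_top j rs T)|].
pose g i : R := ((1 + (1 + j%:R)^-1) ^+ i)%R.
have g0 i : (0 <= g i)%R by rewrite exprn_ge0// addr_ge0// invr_ge0 addr_ge0.
apply: (@le_trans _ _ (\esum_(rs in [set rs | gens_set j 1 rs /\ (K < top_width 1 rs)%N])
   ((4 * t ^+ 2 / K%:R)%:E * ((gens_wt rs * g (top_width 1 rs))%R)%:E))).
  apply: le_esum => rs [X Kt]; apply: (le_trans (P_restr_le X)).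
  rewrite -EFinM lee_fin mulrC [leRHS]mulrCA ler_wpM2l ?wt_ge0//.
  have kk : ((top_width 1 rs)%:R ^+ 2 <= 2 * t ^+ 2 * g (top_width 1 rs) :> R)%R.
    have t1 : (1 <= t)%R by rewrite ler1n.
    have -> : g (top_width 1 rs) = ((1 + t^-1) ^+ top_width 1 rs)%R
      by rewrite /g /t -(@natr1 _ j) [(j%:R + 1)%R]addrC.
    have := binomial2 (top_width 1 rs) (_ : 0 <= t^-1)%R; rewrite invr_ge0 => /(_ (ltW t0)) h.
    have c0 : (0 <= 2 * t ^+ 2)%R by rewrite mulr_ge0 ?exprn_ge0 ?ltW.
    apply: le_trans (ler_wpM2l c0 h); set k : R := (_%:R)%R.
    have -> : (2 * t ^+ 2 * (1 + k / t + k * (k - 1) / 2 * t^-1 ^+ 2) =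
      2 * t ^+ 2 + 2 * t * k + k ^+ 2 - k)%R by field; rewrite gt_eqF.
    have k0 : (0 <= k)%R by []. nra.
  set k : R := (_%:R)%R in kk *.
  have Kk : (K%:R <= k)%R by rewrite ler_nat ltnW.
  have KR : (0 < K%:R :> R)%R by rewrite ltr0n.
  rewrite -(ler_pM2l KR) [leRHS](_ : _ = 2 * (2 * t ^+ 2 * g (top_width 1 rs)))%R; last first.
    by field; rewrite gt_eqF.
  nra.
rewrite esumZl; last 2 first.
- by rewrite divr_ge0 ?ler0n// mulr_ge0 ?exprn_ge0 ?ltW.
- by move=> *; rewrite lee_fin mulr_ge0 ?wt_ge0.
apply: (@le_trans _ _ ((4 * t ^+ 2 / K%:R)%:E * (2 : R)%:E)); last first.
  by rewrite -EFinM lee_fin le_eqVlt; apply/orP; left; apply/eqP; rewrite /t; ring.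
rewrite lee_wpmul2l ?lee_fin//.
  by rewrite divr_ge0 ?ler0n// mulr_ge0 ?exprn_ge0 ?ltW.
apply: (@le_trans _ _ (gens_sum j 1 g)).
  rewrite /gens_sum -[[set rs | _ /\ _]]/(gens_set j 1 `&` [set rs | K < top_width 1 rs]%N) esum_mkcondr.
  by apply: le_esum => rs _; case: ifP => // _; rewrite lee_fin mulr_ge0 ?wt_ge0.
apply: (le_trans (Vs_top _ _ ltr01)).
by rewrite lee_fin invr1 expr1.
Qed.

End Law.

End Esum.

(** * Walk counts in almost every triangulation *)

Section AlmostEvery.
Variable R : realType.

Lemma pathok_ext M k k' w w' V v cs :
  (forall j, (j <= M)%N -> k j = k' j) -> (forall j, (j < M)%N -> w j = w' j) ->
  (v.1 <= M)%N -> pathok M k w V v cs = pathok M k' w' V v cs.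
Proof.
move=> hk hw; elim: cs V v => //= c cs IH V v vM.
have okE : step_valid M k v c = step_valid M k' v c.
  case: c => [[[] []] [x y]] //=; first by case: (ltnP v.1 M) => //= h; rewrite !hk//.
  by case: (posnP v.1) => //= v0; rewrite vM /= !hk//; lia.
rewrite okE; case hok : (step_valid M k' v c) => //=.
have nE : step_to k v c = step_to k' v c.
  move: hok; case: c {okE} => [[[] []] [x y]] /=.
  - by rewrite hk.
  - by rewrite hk.
  - by case/and4P => h _ _ _; rewrite hk.
  - by case/and4P => /andP[_ h] _ _ _; rewrite hk//; lia.
have onE : step_on_word w v c = step_on_word w' v c.
  rewrite /step_on_word; case hv : c.1.1 => //=; rewrite hw//.
  move: hok hv; rewrite /step_strip; case: c {okE nE} => [[[] []] [x y]] //=; first by case/and4P.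
  by case/and4P => /andP[]; lia.
rewrite nE onE IH//; rewrite -nE; move: hok; case: c {okE nE onE} => [[[] []] [x y]] //=.
  by case/and4P.
by lia.
Qed.

Lemma nwalks_ext K M m k k' w w' : (m <= M)%N ->
  (forall j, (j <= M)%N -> k j = k' j) -> (forall j, (j < M)%N -> w j = w' j) ->
  nwalks K M m k w = nwalks K M m k' w'.
Proof.
move=> mM hk hw; apply: eq_bigr => a _; apply: eq_count => cs.
exact: pathok_ext.
Qed.

Definition walks (K M m : nat) (T : LTinf) : nat := nwalks K M m (width T) T.

Definition narrow (K M : nat) (T : LTinf) : Prop := forall j, (j <= M)%N -> (width T j <= K)%N.

Lemma restr_fams K M (T : LTinf) : narrow K M T ->
  exists l, [/\ l \in width_seqs K M, restr T M \in strip_words (nth 0%N (1%N :: l)) 0 M &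
    forall j, (j <= M)%N -> nth 0%N (1%N :: l) j = width T j].
Proof.
move=> nT; pose l := mkseq (fun j => width T j.+1) M; exists l.
have lE j : (j <= M)%N -> nth 0%N (1%N :: l) j = width T j.
  case: j => [|j] jM /=; first by rewrite /width strip_bottom.
  by rewrite nth_mkseq.
split=> //.
  rewrite mem_width_seqs size_mkseq eqxx; apply/allP => _ /mapP[j + ->].
  rewrite mem_iota => /andP[_ jM]; rewrite width_gt0 nT//.
have key : forall n i, (i + n = M)%N -> [seq T j | j <- iota i n] \in strip_words (nth 0%N (1%N :: l)) i n.
  elim=> [|n IH] i iM; first by rewrite /= in_cons eqxx.
  rewrite /= ; apply/allpairsP; exists (T i, [seq T j | j <- iota i.+1 n]); split=> //=.
    rewrite mem_words_of -[nth 0%N l i]/(nth 0%N (1%N :: l) i.+1) !lE; [|lia|lia].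
    by rewrite eqxx; exact: strip_glued.
  by apply: IH; lia.
by apply: key; rewrite add0n.
Qed.

Lemma measurable_depends (M : nat) (A : set LTspace) :
  (forall T T' : LTinf, restr T M = restr T' M -> A T -> A T') -> measurable A.
Proof.
move=> h.
rewrite (_ : A = [set T : LTspace | [set s | exists2 T', A T' & restr T' M = s] (restr T M)]).
  exact: measurable_restr.
by apply/seteqP; split=> [T AT|T [T' AT' /h]]; [exists T|apply].
Qed.

Lemma restr_le M M' (T T' : LTinf) : (M' <= M)%N -> restr T M = restr T' M ->
  (forall j, (j < M')%N -> T j = T' j).
Proof.
move=> MM e j jM; have := congr1 (nth [::] ^~ j) e.
by rewrite !nth_mkseq//; lia.
Qed.

Lemma fweight_enc rs : fweight R (size rs) (map enc_word rs) = gens_wt R rs.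
Proof.
rewrite /fweight /gens_wt (big_nth [::]) big_mkord; apply: eq_bigr => i _.
by rewrite (nth_map [::])// size_enc.
Qed.

Section Law.
Variable P : probability LTspace R.
Hypothesis hP : local_weak_limit (mu_cr R) P.
Local Open Scope ereal_scope.

Lemma P_le_sum (I : eqType) (l : seq I) (A : I -> set LTspace) (S : set LTspace) :
  measurable S -> (forall i, measurable (A i)) ->
  (forall T, S T -> exists2 i, i \in l & A i T) -> P S <= \sum_(i <- l) P (A i).
Proof.
move=> mS mA; elim: l S mS => [|i l IH] S mS hS.
  rewrite (_ : S = set0) ?measure0 ?big_nil//; apply/seteqP; split=> // T /hS[? //].
rewrite big_cons; apply: (@le_trans _ _ (P (A i `|` (S `\` A i)))).
  apply: le_measure; rewrite ?inE//.
    by apply: measurableU => //; exact: measurableD.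
  by move=> T ST; case: (pselect (A i T)) => h; [left|right].
apply: (le_trans (measureU2 _ _ _)) => //; first exact: measurableD.
rewrite leeD2l// IH//; first exact: measurableD.
move=> T [/hS[j]]; rewrite in_cons => /predU1P[->//|jl Aj _]; by exists j.
Qed.

(** Markov's inequality, summed over the finitely many restrictions of width at most K. The
    size-biasing factor of [P_restr_le] is then at most 2K, and the indicator of the event is at
    most the number of walks times x. *)
Lemma P_many_walks K M m (A x : R) : (1922 <= A)%R -> (0 < x)%R -> (m <= M)%N -> (0 < K)%N ->
  P [set T : LTspace | narrow K M T /\ (1 <= (walks K M m T)%:R * x)%R] <=
  (2 * K%:R * x * (3 ^+ (M + m) * K%:R * A ^+ m * 40 ^+ M))%:E.
Proof.
move=> hA x0 mM K0.
pose S : set LTspace := [set T | narrow K M T /\ (1 <= (walks K M m T)%:R * x)%R].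
rewrite -/S.
(* One strip more than M is read, because the width of level M is read off the lower circle of strip
   M. *)
have dep T T' : restr T M.+1 = restr T' M.+1 -> S T -> S T'.
  move=> e [nT wT]; have Tj := restr_le (leqnn _) e.
  have wj j : (j <= M)%N -> width T j = width T' j by move=> jM; rewrite /width Tj.
  split; first by move=> j jM; rewrite -wj// nT.
  by rewrite /walks -(@nwalks_ext _ _ _ (width T) _ T)// => j jM; rewrite Tj// ltnW.
have mS : measurable S by exact: measurable_depends dep.
pose L := [seq (l, ws) | l <- width_seqs K M, ws <- strip_words (nth 0%N (1%N :: l)) 0 M].
pose Ai (p : seq nat * seq (seq bool)) : set LTspace :=
  [set T | S T /\ (restr T M = p.2 /\ forall j, (j <= M)%N -> nth 0%N (1%N :: p.1) j = width T j)].
have mAi p : measurable (Ai p).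
  apply: (@measurable_depends M.+1) => T T' e [ST [rT hT]]; split; first exact: dep ST.
  have Tj := restr_le (leqnn _) e; split.
    rewrite -rT; apply: (@eq_from_nth _ [::]); rewrite !size_mkseq// => j jM.
    by rewrite !nth_mkseq// Tj// ltnW.
  by move=> j jM; rewrite hT// /width Tj.
apply: (le_trans (P_le_sum mS mAi (l := L) _)).
  move=> T ST; have [l [hl hw hk]] := restr_fams ST.1.
  exists (l, restr T M); last by split.
  by apply/allpairsPdep; exists l, (restr T M).
rewrite big_allpairs_dep.
apply: (@le_trans _ _ (\sum_(l <- width_seqs K M) \sum_(ws <- strip_words (nth 0%N (1%N :: l)) 0 M)
   (2 * K%:R * x * (fweight R M ws * (nwalks K M m (nth 0%N (1%N :: l)) (nth [::] ws))%:R))%:E)).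
  apply: lee_sum => l _; apply: lee_sum => ws _.
  have f0 : (0 <= fweight R M ws)%R by apply: prodr_ge0 => i _; rewrite invr_ge0 exprn_ge0.
  have [[T AT]|noT] := pselect (exists T, Ai (l, ws) T); last first.
    rewrite (_ : Ai _ = set0) ?measure0 ?lee_fin ?mulr_ge0 ?(ltW x0)//.
    by apply/seteqP; split=> // T AT; apply: noT; exists T.
  have [[nT wT] [/= rT kT]] := AT.
  have := restr_LT T M; rewrite LT_enc => -[rs X e].
  apply: (@le_trans _ _ (P [set T : LTspace | restr T M = map enc_word rs])).
    apply: le_measure; rewrite ?inE//.
      exact: (measurable_restr M [set s | s = map enc_word rs]).
    by move=> T' [_ [/= -> _]]; rewrite -rT.
  apply: (le_trans (P_restr_le hP X)); rewrite lee_fin.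
  have topK : ((top_width 1 rs)%:R <= K%:R :> R)%R.
    by rewrite ler_nat -(@width_top M rs T)// nT.
  have wE : gens_wt R rs = fweight R M ws.
    by rewrite -fweight_enc -rT e; case: X => ->.
  have W : (1 <= x * (nwalks K M m (nth 0%N (1%N :: l)) (nth [::] ws))%:R)%R.
    rewrite mulrC -(@nwalks_ext _ _ _ (width T) _ T)//; first by move=> j jM; rewrite kT.
    by move=> j jM; rewrite -rT nth_mkseq.
  rewrite wE -mulrA [leRHS]mulrA -![in leRHS]mulrA ler_wpM2l//.
  set nn := (nwalks _ _ _ _ _)%:R in W *.
  have -> : (K%:R * (x * (fweight R M ws * nn)) = (K%:R * fweight R M ws) * (x * nn))%R by ring.
  rewrite -[leLHS]mulr1; apply: ler_pM => //; first by rewrite mulr_ge0.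
  by rewrite ler_wpM2r.
under eq_bigr do rewrite sumEFin.
rewrite sumEFin lee_fin; under eq_bigr do rewrite -mulr_sumr.
rewrite -mulr_sumr ler_wpM2l//; first by rewrite !mulr_ge0// ltW.
exact: sum_all_nwalks.
Qed.

Lemma P_not_narrow K M : (0 < K)%N ->
  P [set T : LTspace | ~ narrow K M T] <= (8 * M.+1%:R ^+ 3 / K%:R)%:E.
Proof.
move=> K0.
pose Ai j : set LTspace := [set T | (K < width T j)%N].
have mA j : measurable (Ai j).
  apply: (@measurable_depends j.+1) => T T' e; rewrite /Ai /= /width.
  by rewrite (restr_le (leqnn _) e).
have mS : measurable [set T : LTspace | ~ narrow K M T].
  apply: (@measurable_depends M.+1) => T T' e nT nT'; apply: nT => j jM.
  by rewrite /width (restr_le (leqnn _) e)//; exact: nT'.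
apply: (le_trans (P_le_sum mS mA (l := iota 0 M.+1) _)).
  move=> T /existsNP[j /not_implyP[jM /negP]]; rewrite -ltnNge => h.
  by exists j => //; rewrite mem_iota.
apply: (@le_trans _ _ (\sum_(j <- iota 0 M.+1) (8 * M.+1%:R ^+ 2 / K%:R)%:E)).
  rewrite big_seq [leRHS]big_seq; apply: lee_sum => j; rewrite mem_iota => /andP[_ jM].
  apply: (le_trans (width_tail hP j K0)); rewrite lee_fin ler_wpM2r ?invr_ge0// ler_wpM2l//.
  by rewrite lerXn2r ?nnegrE// ler_nat.
rewrite sumEFin lee_fin big_const_seq iter_addr addr0 count_predT size_iota.
by rewrite le_eqVlt; apply/orP; left; apply/eqP; rewrite -mulr_natr exprSr; ring.
Qed.

Local Open Scope ring_scope.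

Lemma ae_few_walks : exists2 q : R, 0 < q &
  {ae P, forall T : LTspace, forall m0 : nat, exists m, [/\ (m0 <= m)%N,
    narrow (64 ^ m) (2 * m) T & (walks (64 ^ m) (2 * m) m T)%:R * q ^+ m <= 2 ^- m]}.
Proof.
have [A hA] : exists A : R, 1922 <= A by exists 1922.
have A0 : 0 < A by apply: lt_le_trans hA; rewrite ltr0n.
(* The m-th roots of the factors of [P_many_walks]: 64 twice for K^2, 2 for the base 2q of [x], 27
   for 3^(3m), A, and 1600 for 40^(2m). The last 2 leaves a probability of order 2^(-m). *)
pose D : R := 64 * 64 * 2 * 27 * A * 1600 * 2.
have D0 : 0 < D by rewrite !mulr_gt0 ?ltr0n.
pose q : R := D^-1; have q0 : 0 < q by rewrite invr_gt0.
exists q => //.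
pose K m := (64 ^ m)%N; pose M m := (2 * m)%N.
(* Failure of the bound walks * q^m <= 2^(-m) means that walks * x exceeds 1. *)
pose x m : R := (2 * q) ^+ m.
have x0 m : 0 < x m by rewrite exprn_gt0// mulr_gt0.
have K0 m : (0 < K m)%N by rewrite expn_gt0.
pose B1 m : set LTspace := [set T | ~ narrow (K m) (M m) T].
pose B2 m : set LTspace :=
  [set T | narrow (K m) (M m) T /\ 1 <= (walks (K m) (M m) m T)%:R * x m].
have mM m : (m <= M m)%N by rewrite /M; lia.
have wE T T' j : restr T (M j).+1 = restr T' (M j).+1 ->
    (narrow (K j) (M j) T <-> narrow (K j) (M j) T') /\
    walks (K j) (M j) j T = walks (K j) (M j) j T'.
  move=> e; have Tj := restr_le (leqnn _) e.
  have wj i : (i <= M j)%N -> width T i = width T' i by move=> h; rewrite /width Tj.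
  split; first by split=> h i iM; [rewrite -wj|rewrite wj]; rewrite // h.
  by apply: nwalks_ext => // i iM; rewrite Tj// ltnW.
have m1 m : measurable (B1 m).
  by apply: (@measurable_depends (M m).+1) => T T' /wE[nE _]; rewrite /B1 /= nE.
have m2 m : measurable (B2 m).
  by apply: (@measurable_depends (M m).+1) => T T' /wE[nE kE]; rewrite /B2 /= nE kE.
pose B m := B1 m `|` B2 m.
have mB m : measurable (B m) by exact: measurableU.
have PB m : (P (B m) <= (10 * 2^-1 ^+ m)%:E)%E.
  apply: (le_trans (measureU2 _ _ _)) => //.
  apply: (le_trans (leeD (P_not_narrow (M m) (K0 m)) (P_many_walks hA (x0 m) (mM m) (K0 m)))).
  rewrite -EFinD lee_fin.
  have h1 : 8 * (M m).+1%:R ^+ 3 / (K m)%:R <= 8 * 2^-1 ^+ m :> R.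
    rewrite -mulrA ler_wpM2l// ler_pdivrMr ?ltr0n// /K natrX -exprMn.
    (* 2m + 1 <= 3^m, and 27^m <= 32^m = 64^m / 2^m. *)
    apply: (@le_trans _ _ ((3 ^+ m) ^+ 3)).
      rewrite lerXn2r ?nnegrE ?exprn_ge0// -natrX ler_nat /M.
      by elim: m => // m IH; rewrite expnS; lia.
    rewrite -exprM mulnC exprM; apply: lerXn2r; rewrite ?nnegrE; lra.
  have h2 : 2 * (K m)%:R * x m * (3 ^+ (M m + m) * (K m)%:R * A ^+ m * 40 ^+ M m) = 2 * 2^-1 ^+ m.
    rewrite /K natrX /M /x (_ : (2 * m + m = 3 * m)%N); last by lia.
    rewrite !exprM.
    have -> : 2 * 64 ^+ m * (2 * q) ^+ m * ((3 ^+ 3) ^+ m * 64 ^+ m * A ^+ m * (40 ^+ 2) ^+ m) =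
      2 * ((64 * (2 * q) * (3 ^+ 3) * 64 * A * (40 ^+ 2)) ^+ m) by rewrite !exprMn; ring.
    congr (_ * _ ^+ _); rewrite /q /D; field; rewrite gt_eqF//.
  by rewrite h2; lra.
have mI m0 : measurable (\bigcap_(m in [set m | (m0 <= m)%N]) B m).
  by apply: bigcap_measurable => //; exists m0 => /=.
(* The exceptional set consists of the T for which all large m are bad. Each intersection lies in
   every [B m] with m >= m0, so it is enough that the probability of [B m] tends to 0. *)
exists (\bigcup_m0 \bigcap_(m in [set m | (m0 <= m)%N]) B m); split.
- by apply: bigcupT_measurable.
- apply/negligibleP; first exact: bigcupT_measurable.
  apply: negligible_bigcup => m0; apply/negligibleP => //.
  apply/eqP; rewrite eq_le measure_ge0 andbT.
  have c : ((10 * 2^-1 ^+ m)%:E : \bar R) @[m --> \oo] --> (0 : R)%:E.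
    have c : geometric 10 2^-1 @ \oo --> (0 : R).
      by apply: cvg_geometric; rewrite ger0_norm ?invr_ge0// invf_lt1// ltr1n.
    exact: cvg_comp c _.
  apply: cvge_ge c; exists m0 => // m /= hm.
  apply: le_trans (PB m); apply: le_measure; rewrite ?inE//.
  by move=> T /(_ m hm).
- move=> T /existsNP[m0 h]; exists m0 => // m /= hm.
  case: (pselect (narrow (K m) (M m) T)) => [nT|]; last by left.
  right; split=> //; apply: contrapT => /negP; rewrite -ltNge => lt1.
  apply: h; exists m; split=> //; rewrite -(ler_pM2r (x := 2 ^+ m)) ?exprn_gt0//.
  rewrite mulVf ?expf_neq0// -mulrA -exprMn [q * 2]mulrC ltW//.
Qed.

End Law.
End AlmostEvery.

(** * Decay of the influence of the boundary *)
Section Decouple.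
Variables (R : realType) (X I : finType).
Variables (w0 g : X -> R) (r : I -> X -> R) (q B : R) (n : nat) (Gam : seq {set I}).
Hypotheses (w0_ge0 : forall x, 0 <= w0 x) (r_ge0 : forall i x, 0 <= r i x).
Hypotheses (rq : forall i x, r i x <= q * (1 + r i x)) (q0 : 0 <= q) (q1 : q <= 1).
Hypotheses (gB : forall x, `|g x| <= B) (Gn : forall G, G \in Gam -> (n <= #|G|)%N).
Hypothesis swap0 : forall F : {set I}, (forall G, G \in Gam -> ~~ (G \subset F)) ->
  \sum_x w0 x * (\prod_(i in F) r i x) * g x = 0.

(** The sum over supersets factorizes into r on G and 1 + r off G; on G the hypothesis r <= q (1 +
    r) supplies one factor q per element. *)
Lemma sum_supersets (G : {set I}) x :
  \sum_(F : {set I} | G \subset F) \prod_(i in F) r i x <=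
  q ^+ #|G| * \prod_i (1 + r i x).
Proof.
have -> : \sum_(F : {set I} | G \subset F) \prod_(i in F) r i x =
  \prod_i (r i x + (i \notin G)%:R).
  rewrite bigA_distr big_mkcond; apply: eq_bigr => F _.
  case: ifP => [GF|/negbT /fintype.subsetPn[i iG iF]].
    rewrite big_mkcond; apply: eq_bigr => i _; case: ifP => // /negbT iF.
    by have -> : i \notin G by apply: contra iF; exact: (fintype.subsetP GF).
  by rewrite (bigD1 i)//= (negPf iF) iG mul0r.
rewrite (bigID (mem G))/= [X in _ <= _ * X](bigID (mem G))/= mulrA.
apply: ler_pM; rewrite ?prodr_ge0//; try by move=> *; rewrite addr_ge0.
  rewrite -prodr_const -big_split/=; apply: ler_prod => i iG.
  by rewrite iG addr0 r_ge0 rq.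
by apply: ler_prod => i iG; rewrite iG addrC addr_ge0//= lexx.
Qed.

(* Expand [\prod_i (1 + r i x)] over subsets F of edges: the subsets that contain
   no member of [Gam] cancel, the others cost at most [q ^+ n] each. *)
Lemma decouple :
  `|\sum_x w0 x * (\prod_i (1 + r i x)) * g x| <=
  B * (size Gam)%:R * q ^+ n * \sum_x w0 x * \prod_i (1 + r i x).
Proof.
have E x : \prod_i (1 + r i x) = \sum_(F : {set I}) \prod_(i in F) r i x.
  under eq_bigr do rewrite addrC.
  rewrite bigA_distr; apply: eq_bigr => F _; rewrite [RHS]big_mkcond.
  by apply: eq_bigr => i _.
pose hit (F : {set I}) := has (fun G : {set I} => G \subset F) Gam.
pose S (F : {set I}) x := w0 x * \prod_(i in F) r i x.
have S0 F x : 0 <= S F x by rewrite mulr_ge0// prodr_ge0.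
have -> : \sum_x w0 x * (\prod_i (1 + r i x)) * g x =
   \sum_(F : {set I} | hit F) \sum_x S F x * g x.
  transitivity (\sum_(F : {set I}) \sum_x S F x * g x).
    rewrite exchange_big; apply: eq_bigr => x _; rewrite E mulr_sumr mulr_suml.
    by apply: eq_bigr => F _.
  rewrite [RHS]big_mkcond; apply: eq_bigr => F _; case: ifP => // /hasPn h.
  by rewrite swap0.
have gB0 (x : X) : 0 <= B by apply: le_trans (normr_ge0 _) (gB x).
apply: (@le_trans _ _ (\sum_(F : {set I} | hit F) \sum_x S F x * B)).
  apply: (le_trans (ler_norm_sum _ _ _)); apply: ler_sum => F _.
  apply: (le_trans (ler_norm_sum _ _ _)); apply: ler_sum => x _.
  by rewrite normrM ger0_norm// ler_wpM2l.
apply: (@le_trans _ _ (\sum_(G <- Gam) \sum_(F : {set I} | G \subset F) \sum_x S F x * B)).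
  rewrite [leRHS](exchange_big_dep xpredT)//= big_mkcond; apply: ler_sum => F _.
  have T0 : 0 <= \sum_x S F x * B by apply: sumr_ge0 => x _; rewrite mulr_ge0// (gB0 x).
  case: ifP => [/hasP[G GG GF]|_]; last by apply: sumr_ge0.
  by rewrite (big_rem G GG)/= GF lerDl sumr_ge0.
apply: (@le_trans _ _ (\sum_(G <- Gam) \sum_x B * (q ^+ n * (w0 x * \prod_i (1 + r i x))))).
  rewrite big_seq [leRHS]big_seq; apply: ler_sum => G GG.
  rewrite exchange_big/=; apply: ler_sum => x _.
  rewrite -mulr_suml mulrC ler_wpM2l ?(gB0 x)// /S -mulr_sumr mulrCA ler_wpM2l//.
  apply: (le_trans (sum_supersets _ _)); rewrite ler_wpM2r//.
    by apply: prodr_ge0 => i _; rewrite addr_ge0.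
  by apply: ler_wiXn2l => //; exact: Gn.
rewrite big_const_seq iter_addr addr0 count_predT -mulr_natr -!mulr_sumr.
by rewrite le_eqVlt; apply/orP; left; apply/eqP; ring.
Qed.

End Decouple.

(** * Walk codes and edge paths in a triangulation *)

Section Geometry.
Variables (k : nat -> nat) (w : nat -> seq bool).
Hypothesis k_gt0 : forall j, (0 < k j)%N.
Hypothesis w_lower : forall j, lower_edges (w j) = k j.
Hypothesis w_upper : forall j, upper_edges (w j) = k j.+1.

(* Edges of the triangulation: (j, true, i) is the i-th horizontal edge of level
   j, (j, false, i) the i-th edge of the strip above level j. *)
Definition label : Type := (nat * bool * nat)%type.

Definition label_ends (e : label) : (nat * nat) * (nat * nat) :=
  let: (j, b, i) := e in
  if b then ((j, i %% k j), (j, i.+1 %% k j))%N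
  else ((j, lower_edges (take i (w j)) %% k j), (j.+1, upper_edges (take i (w j)) %% k j.+1))%N.

Definition label_valid (N : nat) (e : label) : bool :=
  let: (j, b, i) := e in (j <= N)%N && (i < if b then k j else size (w j))%N.

Definition step_label (v : nat * nat) (c : stepc) : label :=
  match c with
  | (true, true, _) => (v.1, true, v.2)
  | (true, false, _) => (v.1, true, (v.2 + k v.1).-1 %% k v.1)%N
  | (false, _, e) => (step_strip v c, false, e.1 + e.2)%N
  end.

Fixpoint walk_labels (v : nat * nat) (cs : seq stepc) : seq label :=
  if cs is c :: cs' then step_label v c :: walk_labels (step_to k v c) cs' else [::].

Lemma count_negb (s : seq bool) : upper_edges s = (size s - lower_edges s)%N.
Proof.
rewrite /upper_edges /lower_edges -(count_predC id s) addKn.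
exact: eq_count.
Qed.

Lemma left_right a m : (a < m)%N -> (((a + m).-1 %% m).+1 %% m = a)%N.
Proof.
by move=> am; rewrite -addn1 modnDml addn1 prednK ?modnDr ?modn_small//; lia.
Qed.

Lemma right_left a m : (a < m)%N -> ((a.+1 %% m + m).-1 %% m = a)%N.
Proof.
move=> am; have [e|ne] := eqVneq a.+1 m; first by rewrite e modnn add0n -e modn_small.
by rewrite (modn_small (m := a.+1)) 1?ltn_neqAle ?ne// addSn /= modnDr modn_small.
Qed.

Lemma nxt_lt v c : ((step_to k v c).2 < k (step_to k v c).1)%N.
Proof. by case: c => [[[] []] [x y]] /=; rewrite ltn_pmod. Qed.

Lemma lends_ledge M v c : (v.2 < k v.1)%N -> step_valid M k v c -> step_on_word w v c ->
  label_ends (step_label v c) = (v, step_to k v c) \/ label_ends (step_label v c) = (step_to k v c, v).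
Proof.
case: v => j a /= ak; case: c => [[[] t] [x y]] /=.
  move=> _ _; case: t => /=; [left|right]; first by rewrite modn_small.
  by rewrite modn_mod left_right.
rewrite /step_on_word /step_strip /=; case: t => /= ok /andP[sz /eqP /= pa].
  left; move: ok => /and4P[_ _ _ /eqP xa].
  rewrite count_negb size_take sz /lower_edges pa xa; congr (_, (_, _)).
  by rewrite addKn.
right; move: ok => /and4P[/andP[j0 _] _ _ /eqP ya].
by rewrite count_negb size_take sz /lower_edges pa addKn prednK// ya.
Qed.

Lemma ledge_valid M N v c : (M <= N)%N -> (v.1 <= M)%N -> (v.2 < k v.1)%N -> step_valid M k v c ->
  step_on_word w v c -> label_valid N (step_label v c).
Proof.
case: v => j a /= MN jM ak; case: c => [[[] t] [x y]] /=.
  by move=> _ _; case: t => /=; rewrite ?ltn_pmod ?ak ?andbT//; lia.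
rewrite /step_on_word /step_strip /=; case: t => /= ok /andP[-> _]; rewrite andbT; first by case/and4P: ok; lia.
by lia.
Qed.

Lemma okc_level M v c : (v.1 <= M)%N -> step_valid M k v c -> ((step_to k v c).1 <= M)%N.
Proof. by case: c => [[[] []] [x y]] //= h; [case/and4P|lia]. Qed.

(** Every later edge reaches a vertex that was new when the step was made, whereas an edge already
    traversed has both ends visited. Hence a self-avoiding walk of length m uses m distinct edges,
    which is what produces the power q^m. *)
Lemma ledges_fresh M V v cs e : (v.1 <= M)%N -> (v.2 < k v.1)%N -> v \in V ->
  pathok M k w V v cs -> e \in walk_labels v cs ->
  ((label_ends e).1 \notin V) || ((label_ends e).2 \notin V).
Proof.
elim: cs V v => //= c cs IH V v vM vk vV /and4P[ok on fr pk].
rewrite in_cons => /predU1P[->|ecs].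
  by case: (lends_ledge vk ok on) => ->; rewrite fr ?orbT.
have := IH _ _ (okc_level vM ok) (nxt_lt v c) (mem_head _ _) pk ecs.
by rewrite !in_cons !negb_or => /orP[/andP[_ ->]//|/andP[_ ->]]; rewrite orbT.
Qed.

Lemma ledges_uniq M V v cs : (v.1 <= M)%N -> (v.2 < k v.1)%N -> v \in V ->
  pathok M k w V v cs -> uniq (walk_labels v cs).
Proof.
elim: cs V v => //= c cs IH V v vM vk vV /and4P[ok on fr pk].
have vM' := okc_level vM ok; have vk' := nxt_lt v c.
rewrite (IH _ _ vM' vk' (mem_head _ _) pk) andbT; apply/negP.
move=> /(ledges_fresh vM' vk' (mem_head _ _) pk).
by case: (lends_ledge vk ok on) => -> /=; rewrite !in_cons vV eqxx !orbT.
Qed.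

Lemma ledges_valid M N V v cs e : (M <= N)%N -> (v.1 <= M)%N -> (v.2 < k v.1)%N ->
  pathok M k w V v cs -> e \in walk_labels v cs -> label_valid N e.
Proof.
move=> MN; elim: cs V v => //= c cs IH V v vM vk /and4P[ok on fr pk].
rewrite in_cons => /predU1P[->|]; first exact: ledge_valid ok on.
exact: IH (okc_level vM ok) (nxt_lt v c) pk.
Qed.

Lemma size_ledges v cs : size (walk_labels v cs) = size cs.
Proof. by elim: cs v => //= c cs IH v; rewrite IH. Qed.

Lemma step_code M K N e u v : (forall j, (j <= M)%N -> (k j <= K)%N) ->
  label_valid N e -> (label_ends e == (u, v)) || (label_ends e == (v, u)) -> (u.1 < M)%N ->
  exists c, [/\ c \in step_list K, step_valid M k u c, step_on_word w u c, step_to k u c = v & step_label u c = e].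
Proof.
move=> nar; case: e => [[j []] i] /=.
  move=> /andP[_ ik]; rewrite (modn_small ik) => /orP[/eqP[<- <-]|/eqP[<- <-]] /= jM.
    by exists (true, true, (0, 0)%N); split; rewrite ?alph_horizontal.
  by exists (true, false, (0, 0)%N); split; rewrite ?alph_horizontal //= right_left.
move=> /andP[_ isz].
set x := lower_edges _; set y := upper_edges _.
have xyi : (x + y = i)%N.
  by rewrite /x /y count_negb subnKC ?count_size// size_take isz.
have xk : (x <= k j)%N.
  by rewrite -w_lower /x /lower_edges -{2}(cat_take_drop i (w j)) count_cat leq_addr.
have yk : (y <= k j.+1)%N.
  by rewrite -w_upper /y /upper_edges -{2}(cat_take_drop i (w j)) count_cat leq_addr.
have pa : passes (w j) (x, y) by rewrite /passes /= xyi.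
move=> /orP[/eqP[<- <-]|/eqP[<- <-]] /= jM.
  exists (false, true, (x, y)); split.
  - by apply: (@alph_vertical K true);
      [apply: leq_trans xk _; apply: nar|apply: leq_trans yk _; apply: nar]; lia.
  - by rewrite /= jM xk yk eqxx.
  - by rewrite /step_on_word /= /step_strip /= xyi isz pa.
  - by [].
  - by rewrite /= /step_strip /= xyi.
exists (false, false, (x, y)); split.
- by apply: (@alph_vertical K false y x);
    [apply: leq_trans yk _; apply: nar|apply: leq_trans xk _; apply: nar]; lia.
- by rewrite /= xk yk eqxx ltnW.
- by rewrite /step_on_word /= /step_strip /= xyi isz pa.
- by [].
- by rewrite /= /step_strip /= xyi.
Qed.

Definition adj (F : label -> Prop) (u v : nat * nat) : Prop :=
  exists2 e, F e & (label_ends e == (u, v)) || (label_ends e == (v, u)).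

Lemma adj_level (F : label -> Prop) u v : adj F u v ->
  (v.1 <= u.1.+1)%N /\ (v.2 < k v.1)%N /\ (u.2 < k u.1)%N.
Proof.
case=> -[[j b] i] _; case: b => /= /orP[/eqP[<- <-]|/eqP[<- <-]] /=; rewrite !ltn_pmod//; split=> //; lia.
Qed.

(** Turns an open simple path into a walk counted by [nwalks]. A step climbs at most one level, so
    the bound on the level of u plus the length keeps the path in the strips below M, where the
    widths are controlled. *)
Lemma path_codes M K N (F : label -> Prop) u p V :
  (forall j, (j <= M)%N -> (k j <= K)%N) -> (forall e, F e -> label_valid N e) ->
  path (fun u v => `[< adj F u v >]) u p -> uniq p -> {in p, forall x, x \notin V} ->
  (u.1 + size p <= M)%N ->
  exists cs, [/\ cs \in walk_codes K (size p), pathok M k w V u cs & {in walk_labels u cs, forall e, F e}].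
Proof.
move=> nar Fv; elim: p u V => [|v p IH] u V /=.
  by exists [::]; rewrite /walk_codes mem_head.
move=> /andP[/asboolP a pp] /andP[vp up] hV uM.
have [e Fe ee] := a; have [vu _] := adj_level a.
have uM' : (u.1 < M)%N by lia.
have [c [cA ok on nE eE]] := step_code nar (Fv _ Fe) ee uM'.
have [||cs [cC pk cF]] := IH v (v :: V) pp up.
- move=> x xp; rewrite in_cons negb_or hV ?in_cons ?xp ?orbT// andbT.
  by apply: contraNneq vp => <-.
- lia.
exists (c :: cs); split.
- by rewrite codesS; apply/allpairsP; exists (c, cs).
- by rewrite /= ok on nE hV ?mem_head.
- move=> l; rewrite /= in_cons nE eE => /predU1P[->//|]; exact: cF.
Qed.

End Geometry.

(** * Exchange of two Ising copies on a cluster *)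

Section Patch.
Variable T : LTinf.

Definition code (v : vertex T) : nat * nat := (tag v, val (tagged v)).

Definition incl N (x : vertex_fin T N) : vertex T :=
  existT (fun j => 'I_(width T j)) (nat_of_ord (tag x)) (tagged x).

Lemma patch_in N (sigma : {ffun vertex_fin T N -> bool}) tau x :
  patch_config sigma tau (incl x) = sigma x.
Proof.
case: x => -[j jN] i; rewrite /incl /patch_config /=.
destruct (@idP (j < N.+1)%N) as [h|h]; last by exfalso; exact: h.
by rewrite (bool_irrelevance h jN).
Qed.

Lemma patch_out N (sigma : {ffun vertex_fin T N -> bool}) tau v :
  (N < tag v)%N -> patch_config sigma tau v = tau v.
Proof.
case: v => j i /= jN; rewrite /patch_config.
by destruct (@idP (j < N.+1)%N) as [h|h] => //; exfalso; lia.
Qed.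

Lemma inclP N (v : vertex T) : (tag v <= N)%N -> exists x : vertex_fin T N, incl x = v.
Proof.
case: v => j i /= jN; have jN' : (j < N.+1)%N by [].
by exists (existT (fun j : 'I_N.+1 => 'I_(width T j)) (Ordinal jN') i).
Qed.

Definition label_vertices (e : label) : vertex T * vertex T :=
  let: (j, b, i) := e in
  if b then (vtx T j i, vtx T j i.+1) else (lower_end T j i, upper_end T j i).

Lemma lends_vends e : label_ends (width T) T e = (code (label_vertices e).1, code (label_vertices e).2).
Proof. by case: e => [[j []] i]. Qed.

Variable R : realType.

Definition bond (s : config T) (e : label) : R :=
  spin R (s (label_vertices e).1) * spin R (s (label_vertices e).2).

Lemma bond_bound s e : -1 <= bond s e <= 1.
Proof. by rewrite /bond /spin; do 2 case: (s _); apply/andP; split; lra. Qed.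

Variable B : nat.
(** One finite type for the edges of both volumes: levels and indices are cut off at B, and the
    triples that fail [lv] are dummies on which [ratio] vanishes. *)
Definition fedge : finType := ('I_B * bool * 'I_B)%type.
Definition lab (e : fedge) : label := (val e.1.1, e.1.2, val e.2).

Definition lv N (e : label) : bool := label_valid (width T) T N e.

Lemma lab_inj : injective lab.
Proof. by move=> [[j b] i] [[j' b'] i'] [/val_inj -> -> /val_inj ->]. Qed.

Lemma energyE N s : (N < B)%N -> (forall j, (j <= N)%N -> (width T j <= B)%N) ->
  (forall j, (j <= N)%N -> (size (T j) <= B)%N) ->
  - hamiltonian R N s = \sum_(e : fedge | lv N (lab e)) bond s (lab e).
Proof.
move=> NB wB sB.
have half b (n : nat -> nat) (F : label -> R) : (forall j, (j <= N)%N -> (n j <= B)%N) ->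
    \sum_(j < B) \sum_(i < B) (if (j <= N)%N && (i < n j)%N then F (val j, b, val i) else 0) =
    \sum_(0 <= j < N.+1) \sum_(0 <= i < n j) F (j, b, i).
  move=> nB; rewrite [RHS]big_mkord (big_ord_widen B (fun j => \sum_(0 <= i < n j) F (j, b, i)))//.
  rewrite [RHS]big_mkcond; apply: eq_bigr => j _; rewrite ltnS; case: ifP => jN; last by rewrite big1.
  by rewrite big_mkord (big_ord_widen B (fun i => F (nat_of_ord j, b, i))) ?nB// [RHS]big_mkcond.
rewrite [RHS]big_mkcond.
rewrite -(pair_bigA _ (fun p i => if lv N (lab (p, i)) then bond s (lab (p, i)) else 0))/=.
rewrite -(pair_bigA _ (fun j b => \sum_(i < B) if lv N (lab ((j, b), i)) then bond s (lab ((j, b), i)) else 0))/=.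
under eq_bigr do rewrite big_bool.
rewrite big_split/= /lab /lv /label_valid /= (half true (width T) (bond s) wB).
rewrite (half false (fun j => size (T j)) (bond s) sB).
rewrite /hamiltonian opprB !opprK [X in _ = _ + X]big_nat_recr//= [LHS]addrC -addrA.
by congr (_ + (_ + _)).
Qed.

Variables (beta q : R) (N N' m K : nat).
Hypotheses (beta0 : 0 <= beta) (NN : (N <= N')%N) (mN : (2 * m <= N)%N).
Hypotheses (nar : narrow K (2 * m) T) (q1 : q <= 1) (bq : 1 - expR (- (4 * beta)) <= q).
Hypotheses (NB : (N' < B)%N) (wB : forall j, (j <= N')%N -> (width T j <= B)%N)
  (sB : forall j, (j <= N')%N -> (size (T j) <= B)%N).
Variables (tau tau' : config T) (f : config T -> R) (C0 : R).
Hypotheses (f_loc : forall s s', (forall v, (tag v <= m)%N -> s v = s' v) -> f s = f s')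
  (f_bd : forall s, `|f s| <= C0).

Definition pairs : finType := ({ffun vertex_fin T N -> bool} * {ffun vertex_fin T N' -> bool})%type.

Definition s1 (p : pairs) : config T := patch_config p.1 tau.
Definition s2 (p : pairs) : config T := patch_config p.2 tau'.

Definition mix (C : pred (nat * nat)) (s s' : config T) : config T :=
  fun v => if C (code v) then s' v else s v.

(* Exchanging the two independent copies on the cluster of the levels <= m is an
   involution that preserves the weight when no edge of F leaves the cluster. *)
Definition swap C (p : pairs) : pairs :=
  ([ffun x => mix C (s1 p) (s2 p) (incl x)], [ffun x => mix C (s2 p) (s1 p) (incl x)]).

Lemma swap1 (C : pred (nat * nat)) p : (forall v, C v -> (v.1 <= N)%N) -> s1 (swap C p) = mix C (s1 p) (s2 p).
Proof.
move=> CN; apply/funext => v; case: (leqP (tag v) N) => [/inclP[x <-]|Nv].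
  by rewrite /s1 patch_in ffunE.
rewrite /s1 /mix !patch_out// ifF//; apply/negbTE/negP => /CN /=; lia.
Qed.

Lemma swap2 (C : pred (nat * nat)) p : (forall v, C v -> (v.1 <= N)%N) -> s2 (swap C p) = mix C (s2 p) (s1 p).
Proof.
move=> CN; apply/funext => v; case: (leqP (tag v) N') => [/inclP[x <-]|Nv].
  by rewrite /s2 patch_in ffunE.
rewrite /s2 /mix !patch_out// ifF//; apply/negbTE/negP => /CN /=; lia.
Qed.

Lemma swapK (C : pred (nat * nat)) : (forall v, C v -> (v.1 <= N)%N) -> involutive (swap C).
Proof.
move=> CN p; rewrite [LHS]/swap swap1// swap2//; apply/pair_eqP; apply/andP; split; apply/eqP/ffunP => x;
 rewrite ffunE /mix; case: (C _); by rewrite /s1 /s2 patch_in.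
Qed.

(* expR (beta * x + beta * x') = expR (- 2 beta) * (1 + ratio) on every edge
   inside both volumes, with 0 <= ratio <= (1 - expR (- 4 beta)) * (1 + ratio). *)
Definition ratio (e : fedge) (p : pairs) : R :=
  if lv N (lab e) then expR (2 * beta + beta * bond (s1 p) (lab e) + beta * bond (s2 p) (lab e)) - 1 else 0.

(** The edges of the larger volume outside the smaller one carry the weight of the second copy
    alone. Both their ends lie above level N, out of reach of a swap. *)
Definition outer (p : pairs) : R :=
  expR (beta * \sum_(e : fedge | lv N' (lab e) && ~~ lv N (lab e)) bond (s2 p) (lab e)).

Lemma ratio_ge0 e p : 0 <= ratio e p.
Proof.
rewrite /ratio; case: ifP => // _; rewrite subr_ge0 -[X in X <= _]expR0 ler_expR.
have /andP[a _] := bond_bound (s1 p) (lab e); have /andP[b _] := bond_bound (s2 p) (lab e).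
have := ler_wpM2l beta0 a; have := ler_wpM2l beta0 b; lra.
Qed.

Lemma q_ge0 : 0 <= q.
Proof. by apply: le_trans bq; rewrite subr_ge0 -[leRHS]expR0 ler_expR oppr_le0 mulr_ge0. Qed.

Lemma ratio_le e p : ratio e p <= q * (1 + ratio e p).
Proof.
rewrite /ratio; case: ifP => _; last by rewrite addr0 mulr1 q_ge0.
set x := 2 * beta + _ + _; rewrite addrCA subrr addr0.
apply: (@le_trans _ _ ((1 - expR (- (4 * beta))) * expR x)); last by rewrite ler_wpM2r ?expR_ge0.
rewrite mulrBl mul1r -expRD lerB// -[leRHS]expR0 ler_expR /x.
have /andP[_ a] := bond_bound (s1 p) (lab e); have /andP[_ b] := bond_bound (s2 p) (lab e).
have := ler_wpM2l beta0 a; have := ler_wpM2l beta0 b; lra.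
Qed.

Definition diff (p : pairs) : R := f (s1 p) - f (s2 p).

(** An edge of F has its ends both inside or both outside C, and [ratio] is symmetric in the copies,
    so the weight is preserved; [diff] changes sign because C contains all the levels that f reads.
    The sum equals its own opposite. *)
Lemma swap_zero (C : pred (nat * nat)) (F : {set fedge}) :
  (forall v, C v -> (v.1 <= N)%N) -> (forall v : nat * nat, (v.1 <= m)%N -> C v) ->
  (forall e, e \in F -> lv N (lab e) ->
    C (code (label_vertices (lab e)).1) = C (code (label_vertices (lab e)).2)) ->
  \sum_p outer p * (\prod_(e in F) ratio e p) * diff p = 0.
Proof.
move=> CN Cm CF; set S := \sum_p _.
suff : S = - S by move=> h; lra.
rewrite {1}/S (reindex_inj (inv_inj (swapK CN))) -sumrN; apply: eq_bigr => p _ /=.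
rewrite -mulrN; congr (_ * _ * _).
- rewrite /outer; congr (expR (_ * _)); apply: eq_bigr => e /andP[v' v]; rewrite /bond swap2// /mix.
  have [j1 j2] : (N < tag (label_vertices (lab e)).1)%N /\ (N < tag (label_vertices (lab e)).2)%N.
    move: v v'; case: (lab e) => [[j []] i] /=; rewrite /lv /= negb_and => v /andP[_ h].
      by move: v; rewrite h orbF -ltnNge.
    by move: v; rewrite h orbF -ltnNge => jN; split=> //; lia.
  rewrite !ifF//; apply/negbTE/negP => /CN; rewrite leqNgt => /negP; apply.
    exact: j2.
  exact: j1.
- apply: eq_bigr => e eF; rewrite /ratio; case: ifP => // v; congr (expR _ - 1).
  rewrite /bond swap1// swap2// /mix (CF e eF v); case: (C _) => //.
  by rewrite -!addrA; congr (_ + _); rewrite addrC.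
- rewrite /diff swap1// swap2// opprB; congr (_ - _); apply: f_loc => v vm; rewrite /mix Cm//.
Qed.

Definition gset (a : nat) (cs : seq stepc) : {set fedge} :=
  [set e : fedge | lab e \in walk_labels (width T) (m, a) cs].

Definition Gam : seq {set fedge} :=
  [seq gset a cs | a <- [seq a <- iota 0 K | (a < width T m)%N],
     cs <- [seq cs <- walk_codes K m | pathok (2 * m) (width T) T [:: (m, a)] (m, a) cs]].

Lemma size_Gam : (size Gam <= walks K (2 * m) m T)%N.
Proof.
rewrite size_allpairs_dep /walks /nwalks sumnE big_map big_filter big_mkcond/=.
by apply: leq_sum => a _; case: ifP => // _; rewrite size_filter.
Qed.

Lemma codes_size cs n : cs \in walk_codes K n -> size cs = n.
Proof.
elim: n cs => [|n IH] cs; first by rewrite in_cons orbF => /eqP ->.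
by rewrite codesS => /allpairsP[[c cs'] /= [_ /IH <- ->]].
Qed.

Lemma Gam_card G : G \in Gam -> (m <= #|G|)%N.
Proof.
case/allpairsPdep => a [cs [+ + ->]]; rewrite !mem_filter => /andP[am _] /andP[pk csK].
have w0 := width_gt0 T; have wl j : lower_edges (T j) = width T j by [].
have wu j : upper_edges (T j) = width T j.+1 by apply/eqP; exact: strip_glued.
have m2 : (m <= 2 * m)%N by lia.
have u := ledges_uniq (M := (2 * m)%N) (v := (m, a)) w0 m2 am (mem_head _ _) pk.
rewrite -{1}(codes_size csK) -(size_ledges (width T) (m, a)).
set L := walk_labels _ _ _ in u *.
have LB l : l \in L -> exists e : fedge, lab e = l.

  move=> lL; have := ledges_valid (v := (m, a)) w0 mN m2 am pk lL.
  case: l lL => [[j b] i] _ /= /andP[jN ib].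
  have jB : (j < B)%N by lia.
  have jN' : (j <= N')%N by lia.
  have iB : (i < B)%N by apply: (leq_trans ib); case: (b); [exact: wB|exact: sB].
  by exists (Ordinal jB, b, Ordinal iB).
have : {subset L <= [seq lab e | e in gset a cs]}.
  by move=> l lL; have [e el] := LB l lL; apply/mapP; exists e; rewrite ?mem_enum ?inE ?el.
by move=> /(uniq_leq_size u); rewrite size_image.
Qed.

Lemma level_cross (A : rel (nat * nat)) x p : (forall u v, A u v -> (v.1 <= u.1.+1)%N) ->
  path A x p -> (x.1 <= m)%N -> (m <= (last x p).1)%N ->
  exists p1 p2, p = p1 ++ p2 /\ (last x p1).1 = m.
Proof.
move=> hA; elim: p x => [|y p IH] x /=; first by move=> _ a b; exists [::], [::]; split=> //=; lia.
move=> /andP[/hA yx pp] xm ml; have [xE|xn] := eqVneq x.1 m; first by exists [::], (y :: p).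
have ym : (y.1 <= m)%N by lia.
have [p1 [p2 [-> e]]] := IH y pp ym ml.
by exists (y :: p1), p2.
Qed.

Lemma level_len (A : rel (nat * nat)) x p : (forall u v, A u v -> (v.1 <= u.1.+1)%N) ->
  path A x p -> ((last x p).1 <= x.1 + size p)%N.
Proof.
move=> hA; elim: p x => [|y p IH] x /=; first by lia.
by move=> /andP[/hA yx /IH]; lia.
Qed.

Definition open_in (F : {set fedge}) (l : label) : Prop := exists2 e, e \in F & lab e = l /\ lv N l.

Definition cluster (F : {set fedge}) (v : nat * nat) : bool :=
  `[< exists x p, [/\ (x.1 <= m)%N, path (fun u v => `[< adj (width T) T (open_in F) u v >]) x p
     & last x p = v] >].

(** A path from the levels <= m to a level above N >= 2m may be taken simple. After a visit to level
    m it still climbs more than m levels, one at a time at most, so it has m further steps; these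
    form a member of [Gam] inside F. *)
Lemma cluster_bounded (F : {set fedge}) v :
  (forall G, G \in Gam -> ~~ (G \subset F)) -> cluster F v -> (v.1 <= N)%N.
Proof.
move=> hF /asboolP[x [p [xm pp lp]]]; rewrite leqNgt; apply/negP => Nv.
have w0 := width_gt0 T; have wl j : lower_edges (T j) = width T j by [].
have wu j : upper_edges (T j) = width T j.+1 by apply/eqP; exact: strip_glued.
have hA u u' : `[< adj (width T) T (open_in F) u u' >] -> (u'.1 <= u.1.+1)%N.
  by move=> /asboolP/(adj_level w0)[].
case: (shortenP pp) lp => {}p {}pp up _ lp.
have [|p1 [p2 [pE um]]] := level_cross hA pp xm; first by rewrite lp; lia.
move: pp up lp; rewrite pE cat_path last_cat => /andP[_]; set u := last x p1 in um * => pu up lu.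
have {}up : uniq (u :: p2).
  by move: up; rewrite -cat_cons lastI cat_rcons cat_uniq => /and3P[].
have sz := level_len hA pu; rewrite lu um in sz.
have sq : size (take m p2) = m by rewrite size_take; case: ltnP => //; lia.
have uk : (u.2 < width T m)%N.
  case: p2 {up sq lu pE} pu sz => [|y p2] /=; first by lia.
  by move=> /andP[/asboolP/(adj_level w0)[_ [_]]]; rewrite um.
have [|||||| cs [csK pk csF]] := @path_codes (width T) T w0 wl wu (2 * m) K N (open_in F) u (take m p2) [:: u].
- exact: nar.
- by move=> e [e' _ [_]].
- exact: take_path.
- by rewrite take_uniq//; case/andP: up.
- move=> y yp; rewrite in_cons orbF; apply: contraTneq up => <- /=.
  by rewrite (mem_take yp).
- by rewrite um sq; lia.
rewrite sq in csK.
have uE : u = (m, u.2) by rewrite -um -surjective_pairing.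
have /hF/negP : gset u.2 cs \in Gam; last apply.
  apply/allpairsPdep; exists u.2, cs; rewrite !mem_filter uk mem_iota /= add0n -uE pk csK; split=> //.
  by rewrite (leq_trans uk)// nar//; lia.
apply/fintype.subsetP => e; rewrite inE -uE => /csF[e' e'F [/lab_inj <- _]].
exact: e'F.
Qed.

Lemma swap_zero_Gam (F : {set fedge}) : (forall G, G \in Gam -> ~~ (G \subset F)) ->
  \sum_p outer p * (\prod_(e in F) ratio e p) * diff p = 0.
Proof.
move=> hF; apply: (@swap_zero (cluster F)).
- by move=> v; exact: cluster_bounded.
- by move=> v vm; apply/asboolP; exists v, [::].
- have ext u v : adj (width T) T (open_in F) u v -> cluster F u -> cluster F v.
    move=> a /asboolP[x [p [xm pp lp]]]; apply/asboolP; exists x, (rcons p v).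
    by rewrite last_rcons rcons_path pp lp; split=> //; apply/asboolP.
  move=> e eF ve; have o : open_in F (lab e) by exists e.
  apply/idP/idP; apply: ext; exists (lab e) => //; rewrite lends_vends eqxx ?orbT//.
Qed.

Definition btz (M : nat) (t : config T) (s : {ffun vertex_fin T M -> bool}) : R := boltzmann beta t s.

Lemma btz_pair p : btz tau p.1 * btz tau' p.2 =
  expR (- (2 * beta)) ^+ #|[pred e : fedge | lv N (lab e)]| * (outer p * \prod_e (1 + ratio e p)).
Proof.
have NN' j : (j <= N)%N -> (j <= N')%N by move=> h; exact: leq_trans h NN.
rewrite /btz /boltzmann !mulNr -!mulrN.
rewrite (energyE (N := N))//; last 3 first.
- exact: leq_ltn_trans NN NB.
- by move=> j /NN'; exact: wB.
- by move=> j /NN'; exact: sB.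
rewrite (energyE (N := N'))// -/(s1 p) -/(s2 p).
have lvN e : lv N e -> lv N' e.
  by case: e => [[j b] i]; rewrite /lv /= => /andP[/NN' -> ->].
have -> : \sum_(e : fedge | lv N' (lab e)) bond (s2 p) (lab e) =
    \sum_(e : fedge | lv N (lab e)) bond (s2 p) (lab e) +
    \sum_(e : fedge | lv N' (lab e) && ~~ lv N (lab e)) bond (s2 p) (lab e).
  rewrite (bigID (fun e => lv N (lab e))); congr (_ + _); apply: eq_bigl => e.
  by case h : (lv N (lab e)); rewrite ?andbF ?andbT// lvN.
rewrite mulrDr expRD -/(outer p) mulrA mulrC [RHS]mulrCA; congr (_ * _).
rewrite -expRD -mulrDr.
rewrite -big_split mulr_sumr expR_sum -prodr_const.
have -> : \prod_e (1 + ratio e p) = \prod_(e : fedge | lv N (lab e))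
    expR (2 * beta + beta * bond (s1 p) (lab e) + beta * bond (s2 p) (lab e)).
  rewrite [RHS]big_mkcond; apply: eq_bigr => e _; rewrite /ratio.
  by case: ifP; rewrite ?addr0// addrCA subrr addr0.
rewrite -big_split; apply: eq_bigr => e h; rewrite /= -expRD.
by congr expR; ring.
Qed.

Lemma E_ising_diff : `|E_ising beta N tau f - E_ising beta N' tau' f| <=
  2 * C0 * (walks K (2 * m) m T)%:R * q ^+ m.
Proof.
pose Z := \sum_(s : {ffun vertex_fin T N -> bool}) btz tau s.
pose Z' := \sum_(s : {ffun vertex_fin T N' -> bool}) btz tau' s.
have b0 M t (s : {ffun vertex_fin T M -> bool}) : 0 < btz t s by exact: expR_gt0.
have Zp : 0 < Z by rewrite /Z (bigD1 [ffun=> true])//= ltr_pwDl// sumr_ge0// => *; exact/ltW.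
have Zp' : 0 < Z' by rewrite /Z' (bigD1 [ffun=> true])//= ltr_pwDl// sumr_ge0// => *; exact/ltW.
pose W (p : pairs) := btz tau p.1 * btz tau' p.2.
have WZ : \sum_p W p = Z * Z'.
  rewrite /W -(pair_bigA _ (fun a b => btz tau a * btz tau' b))/= mulr_suml.
  by apply: eq_bigr => s _; rewrite mulr_sumr.
(* The difference of the two expectations is the expectation of [diff] under the product measure,
   here cleared of its normalization. *)
have dE : (E_ising beta N tau f - E_ising beta N' tau' f) * (Z * Z') = \sum_p W p * diff p.
  rewrite /W /diff -(pair_bigA _ (fun a b => btz tau a * btz tau' b *
     (f (patch_config a tau) - f (patch_config b tau'))))/=.
  have e1 : E_ising beta N tau f * Z =
      \sum_(s : {ffun vertex_fin T N -> bool}) btz tau s * f (patch_config s tau).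
    rewrite /E_ising mulr_suml; apply: eq_bigr => s _.
    by rewrite /P_ising -/Z mulrAC divfK ?gt_eqF.
  have e2 : E_ising beta N' tau' f * Z' =
      \sum_(s : {ffun vertex_fin T N' -> bool}) btz tau' s * f (patch_config s tau').
    rewrite /E_ising mulr_suml; apply: eq_bigr => s _.
    by rewrite /P_ising -/Z' mulrAC divfK ?gt_eqF.
  transitivity (E_ising beta N tau f * Z * Z' - Z * (E_ising beta N' tau' f * Z')); first by ring.
  rewrite e1 e2 mulr_suml [X in _ - X]mulr_suml -sumrB; apply: eq_bigr => s _.
  rewrite /Z' !mulr_sumr -sumrB; apply: eq_bigr => s' _; ring.
have ZZ : 0 < Z * Z' by rewrite mulr_gt0.
rewrite -(ler_pM2r ZZ) -{1}(gtr0_norm ZZ) -normrM dE -WZ.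
pose c := expR (- (2 * beta)) ^+ #|[pred e : fedge | lv N (lab e)]|.
have c0 : 0 <= c by rewrite exprn_ge0// expR_ge0.
have -> : \sum_p W p = c * \sum_p outer p * \prod_e (1 + ratio e p).
  by rewrite mulr_sumr; apply: eq_bigr => p _; rewrite /W btz_pair.
have -> : \sum_p W p * diff p = c * \sum_p outer p * (\prod_e (1 + ratio e p)) * diff p.
  by rewrite mulr_sumr; apply: eq_bigr => p _; rewrite /W btz_pair !mulrA.
rewrite normrM ger0_norm// mulrCA ler_wpM2l//.
have C00 : 0 <= C0 by apply: le_trans (normr_ge0 _) (f_bd (fun=> true)).
have o0 p : 0 <= outer p by exact: expR_ge0.
apply: (@le_trans _ _ ((2 * C0) * (size Gam)%:R * q ^+ m * \sum_p outer p * \prod_e (1 + ratio e p))).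
  apply: decouple => //.
  - exact: ratio_ge0.
  - exact: ratio_le.
  - exact: q_ge0.
  - move=> p; rewrite /diff; apply: (le_trans (ler_normB _ _)).
    by have := f_bd (s1 p); have := f_bd (s2 p); lra.
  - exact: Gam_card.
  - exact: swap_zero_Gam.
rewrite ler_wpM2r//.
  by apply: sumr_ge0 => p _; rewrite mulr_ge0// prodr_ge0// => e _; rewrite addr_ge0// ratio_ge0.
rewrite ler_wpM2r ?exprn_ge0 ?q_ge0// ler_wpM2l ?mulr_ge0// ler_nat; exact: size_Gam.
Qed.

End Patch.

(** * The Gibbs measure *)
Section Cylinders.
Variable V : countType.
Implicit Types (s : V -> bool) (c : seq bool) (v : V).

(* Indices that are not the code of an element of V carry the bit [false]. *)
Definition bit i s : bool := if pickle_inv i is Some v then s v else false.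
Definition word n s : seq bool := mkseq (bit^~ s) n.
Definition extend c : V -> bool := fun v => nth false c (pickle v).
Definition trunc n s := extend (word n s).

Lemma bit_pickle v s : bit (pickle v) s = s v.
Proof. by rewrite /bit pickleK_inv. Qed.

Lemma size_word n s : size (word n s) = n.
Proof. exact: size_mkseq. Qed.

Lemma wordS n s : word n.+1 s = rcons (word n s) (bit n s).
Proof. exact: mkseqS. Qed.

Lemma trunc_lt n s v : (pickle v < n)%N -> trunc n s v = s v.
Proof. by move=> vn; rewrite /trunc /extend /word nth_mkseq// bit_pickle. Qed.

Lemma pick_allw (R : pzRingType) n (F : seq bool -> R) w : size w = n ->
  \sum_(c <- allw n) F c * (w == c)%:R = F w.
Proof.
elim: n F w => [|n IH] F [|b w]//=; first by rewrite big_seq1 mulr1.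
move=> [sw]; rewrite big_cat !big_map/=.
have e x : \sum_(c <- allw n) F (x :: c) * (b :: w == x :: c)%:R =
    (b == x)%:R * F (b :: w).
  case: (eqVneq b x) => [->|h]; last by rewrite mul0r big1// => c _; rewrite eqseq_cons (negbTE h) mulr0.
  by rewrite mul1r -(IH (fun c => F (x :: c)) w sw); apply: eq_bigr => c _; rewrite eqseq_cons eqxx.
by rewrite !e; case: b {sw IH e}; rewrite ?(mul1r, mul0r, addr0, add0r).
Qed.

Lemma trunc_sum (R : realType) n (f : (V -> bool) -> R) s :
  f (trunc n s) = \sum_(c <- allw n) f (extend c) * (word n s == c)%:R.
Proof. by rewrite (pick_allw (fun c => f (extend c)))// size_word. Qed.

Lemma ptws_cvg (s_ : nat -> V -> bool) s :
  (forall v, \forall n \near \oo, s_ n v = s v) ->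
  (s_ : nat -> {ptws V -> bool}) @ \oo --> (s : {ptws V -> bool}).
Proof.
move=> h; apply/cvg_sup => v U [W] [[Y] oY <-] Wv WU.
apply: (filterS WU); case: (h v) => k _ hk; exists k => // n /= kn.
by rewrite (hk n kn).
Qed.

(* A word is good if the claim holds on its cylinder.  If the empty word is bad,
   then, as in Koenig's lemma, there is an infinite branch z of bad words, and
   continuity of f at z is violated. *)
Lemma trunc_approx (R : realType) (f : {ptws V -> bool} -> R) e : continuous f -> 0 < e ->
  exists n, forall s, `|f s - f (trunc n s)| <= e.
Proof.
move=> fc e0.
pose good c := exists n0, forall n s, (n0 <= n)%N -> word (size c) s = c -> `|f s - f (trunc n s)| <= e.
have [[n0 g]|bad] := pselect (good [::]); first by exists n0 => s; exact: g.
have goodS c : good (rcons c true) -> good (rcons c false) -> good c.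
  move=> [n1 g1] [n2 g2]; exists (maxn n1 n2) => n s; rewrite geq_max => /andP[h1 h2] hc.
  case E : (bit (size c) s); [apply: g1|apply: g2] => //; by rewrite size_rcons wordS E hc.
pose p := fix p n := if n is n'.+1 then rcons (p n') (asbool (~ good (rcons (p n') true))) else [::].
have pS n : p n.+1 = rcons (p n) (asbool (~ good (rcons (p n) true))) by [].
have sp n : size (p n) = n by elim: n => // n IH; rewrite pS size_rcons IH.
have pbad n : ~ good (p n).
  elim: n => // n IH; rewrite pS; case: asboolP => [//|/contrapT g1 g2].
  by apply: IH; exact: goodS.
have pre n k i : (i < n)%N -> nth false (p (n + k)%N) i = nth false (p n) i.
  move=> h; elim: k => [|k IH]; first by rewrite addn0.
  by rewrite addnS pS nth_rcons sp ltn_addr.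
pose z v := nth false (p (pickle v).+1) (pickle v).
(* A counterexample in the cylinder of [p n] whose truncation index is at least n; both the
   configuration and its truncation then converge pointwise to [z]. *)
have ex n : exists x : nat * (V -> bool),
  [/\ (n <= x.1)%N, word n x.2 = p n & e < `|f x.2 - f (trunc x.1 x.2)|].
  apply: contrapT => h; apply: (pbad n); exists n => k s kn; rewrite sp => sw.
  by rewrite leNgt; apply/negP => he; apply: h; exists (k, s).
have [x xP] := choice ex.
have zE n v : (pickle v < n)%N -> (x n).2 v = z v.
  move=> h; have [_ xw _] := xP n.
  rewrite -bit_pickle -(nth_mkseq false (bit^~ (x n).2) h) -/(word n _) xw.
  by rewrite -(subnKC h) pre.
have c1 : f (x n).2 @[n --> \oo] --> f z.
  apply: (@cvg_comp _ _ _ (fun n => (x n).2 : {ptws V -> bool}) f _ (nbhs (z : {ptws V -> bool})));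
    last exact: fc.
  by apply: ptws_cvg => v; exists (pickle v).+1 => // n /=; exact: zE.
have c2 : f (trunc (x n).1 (x n).2) @[n --> \oo] --> f z.
  apply: (@cvg_comp _ _ _ (fun n => trunc (x n).1 (x n).2 : {ptws V -> bool}) f _
    (nbhs (z : {ptws V -> bool}))); last exact: fc.
  apply: ptws_cvg => v; exists (pickle v).+1 => // n /= vn.
  by have [xn _ _] := xP n; rewrite trunc_lt ?zE//; apply: leq_trans xn.
have : f (x n).2 - f (trunc (x n).1 (x n).2) @[n --> \oo] --> 0 by rewrite -(subrr (f z)); exact: cvgB.
move/cvgrPdist_lt => /(_ e e0)[n _ /(_ n (leqnn n))]/=; rewrite sub0r normrN.
by have [_ _ h] := xP n; rewrite ltNge (ltW h).
Qed.
End Cylinders.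

Definition unit_lebesgue (R : realType) : set (measurableTypeR R) -> \bar R :=
  mrestr (@lebesgue_measure R) (measurable_itv `[0%R, 1%R[).
HB.instance Definition _ (R : realType) := Measure.on (@unit_lebesgue R).

Lemma unit_lebesgue_setT (R : realType) : unit_lebesgue (@setT R) = 1%E.
Proof. by rewrite /unit_lebesgue /mrestr/= setTI lebesgue_measure_itv/= lte_fin ltr01 oppr0 adde0. Qed.

HB.instance Definition _ (R : realType) :=
  Measure_isProbability.Build _ _ R (@unit_lebesgue R) (unit_lebesgue_setT R).

Section ConfigMeasurable.
Variable T : LTinf.

Definition cyl (c : seq bool) : set (config_space T) := [set s | word (size c) s = c].

Lemma measurable_spin v b : measurable ([set s : config T | s v = b] : set (config_space T)).
Proof. by apply: sub_sigma_algebra; exists v, b. Qed.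

Lemma measurable_bit i b : measurable ([set s : config T | bit i s = b] : set (config_space T)).
Proof.
rewrite /bit; case: (pickle_inv i) => [v|]; first exact: measurable_spin.
case: b.
  have -> : [set _ : config T | false = true] = set0 by apply/seteqP; split.
  exact: (@measurable0 _ (config_space T)).
have -> : [set _ : config T | false = false] = setT by apply/seteqP; split.
exact: (@measurableT _ (config_space T)).
Qed.

Lemma measurable_cyl c : measurable (cyl c).
Proof.
elim/last_ind: c => [|c b IH].
  by rewrite (_ : cyl _ = setT)//; exact/seteqP.
rewrite (_ : cyl _ = cyl c `&` [set s | bit (size c) s = b]).
  by apply: measurableI => //; exact: measurable_bit.
rewrite /cyl size_rcons; apply/seteqP; split => s /=; rewrite wordS.
  by move=> /rcons_inj[-> ->].
by move=> [-> ->].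
Qed.
End ConfigMeasurable.

(** * A probability measure with prescribed cylinder masses *)

Section Mass.
Variables (R : realType) (T : LTinf) (F : seq bool -> R).
Hypotheses (F_ge0 : forall c, 0 <= F c) (F_nil : F [::] = 1)
  (F_split : forall c, F c = F (rcons c false) + F (rcons c true))
  (F_none : forall c, pickle_inv (size c) = None :> option (vertex T) -> F (rcons c true) = 0).

(** The total mass of the words of the same length that precede c lexicographically, sorted by the
    first position where they differ from c. *)
Definition cell_left (c : seq bool) : R :=
  \sum_(i < size c) if nth false c i then F (rcons (take i c) false) else 0.

Lemma lft_rcons c b : cell_left (rcons c b) = cell_left c + if b then F (rcons c false) else 0.
Proof.
rewrite /cell_left size_rcons big_ord_recr/= nth_rcons ltnn eqxx -cats1 take_size_cat//.
by congr (_ + _); apply: eq_bigr => i _; rewrite nth_cat take_cat ltn_ord.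
Qed.

(* [0, 1[ is cut into the intervals [cell_left c, cell_left c + F c[, one for each
   word c of length n; [draw n u] is the word whose interval contains u. *)
Fixpoint draw (n : nat) (u : R) : seq bool :=
  if n is n'.+1 then
    rcons (draw n' u) (cell_left (draw n' u) + F (rcons (draw n' u) false) <= u)
  else [::].

Lemma size_draw n u : size (draw n u) = n.
Proof. by elim: n => // n IH; rewrite /= size_rcons IH. Qed.

Lemma drawP c (u : R) : 0 <= u < 1 ->
  (draw (size c) u == c) = (cell_left c <= u < cell_left c + F c).
Proof.
move=> u01; elim/last_ind: c => [|c b IH].
  by rewrite /cell_left big_ord0 add0r F_nil u01 eqxx.
rewrite size_rcons /= eqseq_rcons IH lft_rcons.
have := F_split c; have := F_ge0 (rcons c true); have := F_ge0 (rcons c false).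
case: (eqVneq (draw (size c) u) c) IH => [-> /esym/andP[l1 l2]|_ /esym/negbT IH ? ? ?].
  move=> _ _ Fc; case: b; last by rewrite eqbF_neg -ltNge l1 l2 addr0 l1.
  by rewrite eqb_id l1 l2 -addrA -Fc l2 !andbT.
rewrite (negbTE IH); apply/esym/negbTE/negP; case: b => /andP[] *;
  by case/negP: IH; apply/andP; split; lra.
Qed.

Lemma draw_nth n k u i : (i < n)%N -> nth false (draw (n + k) u) i = nth false (draw n u) i.
Proof.
move=> h; elim: k => [|k IH]; first by rewrite addn0.
by rewrite addnS /= nth_rcons size_draw ltn_addr.
Qed.

Definition rand (u : measurableTypeR R) : config_space T :=
  fun v => nth false (draw (pickle v).+1 u) (pickle v).

Lemma word_rand n (u : R) : 0 <= u < 1 -> word n (rand u) = draw n u.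
Proof.
move=> u01; apply: (@eq_from_nth _ false); rewrite size_word ?size_draw// => i ni.
rewrite nth_mkseq// -(subnKC ni) draw_nth// /bit.
case E : (pickle_inv i) => [v|].
  by have := @pickle_invK (vertex T) i; rewrite E /= /rand => ->.
(* At an index that codes no vertex, the interval for the bit [true] is empty by [F_none], so the
   draw yields the default bit of [bit]. *)
rewrite /= nth_rcons size_draw ltnn eqxx; apply/esym/negbTE/negP => h.
have := drawP (draw i.+1 u) u01; rewrite size_draw eqxx /= h lft_rcons F_none ?size_draw//.
by rewrite addr0 => /esym/andP[h1]; rewrite ltNge h1.
Qed.

Lemma measurable_draw n c : measurable ([set u | draw n u = c] : set (measurableTypeR R)).
Proof.
elim: n c => [|n IH] c /=.
  have [->|h] := eqVneq c [::]; first by rewrite (_ : mkset _ = setT)//; exact/seteqP.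
  by rewrite (_ : mkset _ = set0)//; apply/seteqP; split => // u /esym/eqP; rewrite (negbTE h).
case: (lastP c) => [|{}c b].
  by rewrite (_ : mkset _ = set0)//; apply/seteqP; split => // u /= /eqP; rewrite -size_eq0 size_rcons.
rewrite (_ : mkset _ = [set u | draw n u = c] `&` [set u | (cell_left c + F (rcons c false) <= u) = b]).
  apply: measurableI => //; case: b.
    rewrite (_ : mkset _ = `[cell_left c + F (rcons c false), +oo[%classic); first exact: measurable_itv.
    by apply/seteqP; split => u; rewrite /= in_itv/= andbT.
  rewrite (_ : mkset _ = `]-oo, cell_left c + F (rcons c false)[%classic); first exact: measurable_itv.
  by apply/seteqP; split => u; rewrite /= in_itv/= ltNge; [move=> ->|move=> /negbTE].
by apply/seteqP; split => u /=; [move=> /rcons_inj[-> ->]|move=> [-> ->]].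
Qed.

Lemma measurable_rand : measurable_fun setT rand.
Proof.
apply: (@measurability _ _ _ (config_space T) _ _
  [set A : set (config T) | exists v b, A = [set s | s v = b]]) => //_ [_ [v [b ->]] <-]; rewrite setTI.
rewrite (_ : _ @^-1` _ = \bigcup_(c in [set c | nth false c (pickle v) = b])
   [set u | draw (pickle v).+1 u = c]).
  rewrite bigcup_mkcond; apply: countable_bigcupT_measurable => // c.
  by case: ifP => // _; exact: measurable_draw.
apply/seteqP; split => u /=; first by move=> h; exists (draw (pickle v).+1 u).
by move=> [c cb uc]; rewrite /rand [draw _ _]uc.
Qed.

HB.instance Definition _ :=
  isMeasurableFun.Build _ _ (measurableTypeR R) (config_space T) rand measurable_rand.

Lemma mass_exists : exists m : probability (config_space T) R, forall c, m (cyl c) = (F c)%:E.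
Proof.
exists (distribution (@unit_lebesgue R) rand) => c.
rewrite /distribution /pushforward /unit_lebesgue /mrestr.
have F1 d : F d <= 1.
  elim/last_ind: d => [|d b]; first by rewrite F_nil.
  by have := F_split d; have := F_ge0 (rcons d true); have := F_ge0 (rcons d false); case: b; lra.
have lb : 0 <= cell_left c /\ cell_left c + F c <= 1.
  elim/last_ind: c => [|c b [IH1 IH2]]; first by rewrite /cell_left big_ord0 F_nil add0r.
  rewrite lft_rcons; have := F_split c; have := F_ge0 (rcons c true); have := F_ge0 (rcons c false).
  by case: b => *; split; lra.
transitivity (@lebesgue_measure R `[cell_left c, cell_left c + F c[%classic); last first.
  rewrite lebesgue_measure_itv/= lte_fin ltrDl.
  case: (ltP 0 (F c)) => h; first by rewrite -EFinB addrC addKr.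
  by congr EFin; apply/eqP; rewrite eq_le h F_ge0.
congr lebesgue_measure; apply/seteqP; split => u /=; rewrite !in_itv/=.
  by move=> [/eqP + u01]; rewrite word_rand// drawP.
move=> h; have u01 : 0 <= u < 1 by case: lb => ? ?; lra.
by split => //; apply/eqP; rewrite word_rand// drawP.
Qed.
End Mass.

Section Expectation.
Variables (T : LTinf) (R : realType) (beta : R).
Implicit Types (tau : config T) (f g : config T -> R).

Lemma E_ising_sum N tau (I : Type) (r : seq I) (a : I -> R) (g : I -> config T -> R) :
  E_ising beta N tau (fun s => \sum_(i <- r) a i * g i s) = \sum_(i <- r) a i * E_ising beta N tau (g i).
Proof.
rewrite /E_ising; under eq_bigr do rewrite mulr_sumr.
rewrite exchange_big/=; apply: eq_bigr => i _; rewrite mulr_sumr.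
by apply: eq_bigr => s _; rewrite mulrCA.
Qed.

Lemma P_ising_ge0 N tau (s : {ffun vertex_fin T N -> bool}) : 0 <= P_ising beta tau s.
Proof. by rewrite divr_ge0 ?expR_ge0// sumr_ge0// => *; exact: expR_ge0. Qed.

Lemma P_ising_sum N tau : \sum_(s : {ffun vertex_fin T N -> bool}) P_ising beta tau s = 1.
Proof.
rewrite -mulr_suml divff// gt_eqF// (bigD1 [ffun=> true])//= ltr_pwDl ?expR_gt0//.
by apply: sumr_ge0 => *; exact: expR_ge0.
Qed.

Lemma E_ising_ge0 N tau g : (forall s, 0 <= g s) -> 0 <= E_ising beta N tau g.
Proof. by move=> g0; apply: sumr_ge0 => s _; rewrite mulr_ge0 ?P_ising_ge0. Qed.

Lemma E_ising_close N tau f g e : (forall s, `|f s - g s| <= e) ->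
  `|E_ising beta N tau f - E_ising beta N tau g| <= e.
Proof.
move=> h; rewrite /E_ising -sumrB -[e]mul1r -(P_ising_sum N tau) mulr_suml.
apply: le_trans (ler_norm_sum _ _ _) _; apply: ler_sum => s _.
by rewrite -mulrBr normrM ger0_norm ?P_ising_ge0// ler_wpM2l// P_ising_ge0.
Qed.
End Expectation.

Section Cyl.
Variables (R : realType) (T : LTinf).

Definition cyl_ind (c : seq bool) (s : config T) : R := (word (size c) s == c)%:R.

Lemma cylf_indic c : cyl_ind c = \1_(@cyl T c).
Proof.
apply/funext => s; rewrite indicE /cyl_ind; congr (_%:R); congr nat_of_bool.
by apply/idP/idP => [/eqP h|]; [rewrite inE|rewrite inE /cyl /= => /eqP].
Qed.

Lemma cylf_trunc n (f : config T -> R) s :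
  f (trunc n s) = \sum_(c <- allw n) f (extend c) * cyl_ind c s.
Proof.
rewrite trunc_sum big_seq [RHS]big_seq; apply: eq_bigr => c.
by rewrite mem_allw => /eqP <-.
Qed.

Lemma cylf_continuous c : continuous (cyl_ind c : {ptws vertex T -> bool} -> R).
Proof.
move=> s; apply: cvg_near_cst.
have FF : Filter (nbhs (s : {ptws vertex T -> bool})) by exact: nbhs_filter.
have h n : \forall s' \near (s : {ptws vertex T -> bool}), word n s' = word n s.
  elim: n => [|n IH]; first by apply: (@filterE _ _ FF) => s'.
  have : \forall s' \near (s : {ptws vertex T -> bool}), bit n s' = bit n s.
    rewrite /bit; case: (pickle_inv n) => [v|]; last by apply: (@filterE _ _ FF).
    apply: (@proj_continuous (vertex T) (fun=> bool) v s (fun b => b = s v)).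
    by rewrite nbhs_principalE.
  by move: IH; apply: filterS2 => s' h1 h2; rewrite !wordS h1 h2.
by apply: filterS (h (size c)) => s' e; rewrite /cyl_ind e.
Qed.

Definition clevel (c : seq bool) : nat :=
  \max_(i < size c) if pickle_inv i is Some v then tag (v : vertex T) else 0%N.

Lemma cylf_local c m s s' : (clevel c <= m)%N -> (forall v, (tag v <= m)%N -> s v = s' v) ->
  cyl_ind c s = cyl_ind c s'.
Proof.
move=> cm h; rewrite /cyl_ind; congr (_ == _)%:R; apply: (@eq_from_nth _ false); rewrite !size_word// => i ic.
rewrite !nth_mkseq// /bit; case E : (pickle_inv i) => [v|//]; apply: h; apply: leq_trans cm.
by rewrite /clevel (bigD1 (Ordinal ic))//= E leq_maxl.
Qed.

Lemma cylf_split c s : cyl_ind c s = cyl_ind (rcons c false) s + cyl_ind (rcons c true) s.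
Proof.
rewrite /cyl_ind !size_rcons wordS !eqseq_rcons; case: (_ == c); last by rewrite addr0.
by case: (bit _ _); rewrite ?addr0 ?add0r.
Qed.

Lemma cylf_bound c s : `|cyl_ind c s| <= 1.
Proof. by rewrite /cyl_ind normr_nat; case: (_ == _). Qed.

End Cyl.

(** * Limits of cylinder expectations and uniqueness *)

Section Unique.
Variables (R : realType) (T : LTinf) (beta q : R).
Hypotheses (beta0 : 0 <= beta) (q1 : q <= 1) (bq : 1 - expR (- (4 * beta)) <= q).
Hypothesis few : forall m0, exists m, [/\ (m0 <= m)%N, narrow (64 ^ m) (2 * m) T &
   (walks (64 ^ m) (2 * m) m T)%:R * q ^+ m <= 2 ^- m].

Lemma E_ising_mixing m0 (f : config T -> R) (C0 e : R) :
  (forall m s s', (m0 <= m)%N -> (forall v, (tag v <= m)%N -> s v = s' v) -> f s = f s') ->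
  (forall s, `|f s| <= C0) -> 0 < e ->
  exists N0, forall N N' (tau tau' : config T), (N0 <= N)%N -> (N0 <= N')%N ->
    `|E_ising beta N tau f - E_ising beta N' tau' f| <= e.
Proof.
move=> f_loc f_bd e0.
have C00 : 0 <= C0 by apply: le_trans (normr_ge0 _) (f_bd (fun=> true)).
(* For m >= k one has 2 C0/e < k <= m < 2^m, so that 2 C0 2^(-m) <= e. *)
pose k := Num.Def.archi_bound (2 * C0 / e).
have kP : 2 * C0 <= e * k%:R.
  have h : 2 * C0 / e < k%:R by apply: archi_boundP; rewrite divr_ge0 ?mulr_ge0// ltW.
  by rewrite [leRHS]mulrC -ler_pdivrMr// ltW.
have [m [mk nar W]] := few (maxn m0 k); move: mk; rewrite geq_max => /andP[mm0 mk].
have le_e : 2 * C0 * (walks (64 ^ m) (2 * m) m T)%:R * q ^+ m <= e.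
  rewrite -mulrA; apply: (le_trans (ler_wpM2l _ W)); first by rewrite mulr_ge0.
  rewrite ler_pdivrMr ?exprn_gt0//; apply: (le_trans kP); rewrite (ler_wpM2l (ltW e0))//.
  by rewrite -natrX ler_nat; apply: ltnW; apply: leq_ltn_trans mk (ltn_expl _ _).
exists (2 * m)%N => N N' tau tau' hN hN'.
wlog NN : N N' tau tau' hN hN' / (N <= N')%N.
  move=> h; case/orP: (leq_total N N') => ?; first exact: h.
  by rewrite distrC; exact: h.
apply: le_trans le_e.
(* Any common bound on the levels, widths and word lengths of the larger volume will do. *)
pose B := (N'.+1 + \sum_(j < N'.+1) (width T j + size (T j)))%N.
have Bj j : (j <= N')%N -> (width T j + size (T j) <= B)%N.
  move=> jN; apply: leq_trans (leq_addl _ _).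
  by rewrite -ltnS in jN; rewrite (bigD1 (Ordinal jN))//= leq_addr.
apply: (@E_ising_diff T R B) => //.
- by rewrite /B addSn ltnS leq_addr.
- by move=> j /Bj; apply: leq_trans (leq_addr _ _).
- by move=> j /Bj; apply: leq_trans (leq_addl _ _).
- by move=> s s'; exact: f_loc.
Qed.

(** The constant boundary condition is an arbitrary choice; [mass_cvg] shows that every other one
    gives the same limit. *)
Definition mass (c : seq bool) : R :=
  lim (E_ising beta k (fun=> true : bool) (cyl_ind R c : config T -> R) @[k --> \oo]).

Lemma mass_cvg c (N : nat -> nat) (tau : nat -> config T) : (forall k, (k <= N k)%N) ->
  E_ising beta (N k) (tau k) (cyl_ind R c) @[k --> \oo] --> mass c.
Proof.
move=> kN; pose a k := E_ising beta k (fun=> true : bool) (cyl_ind R c : config T -> R).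
have mix e : 0 < e -> exists N0, forall N N' (tau tau' : config T), (N0 <= N)%N -> (N0 <= N')%N ->
    `|E_ising beta N tau (cyl_ind R c) - E_ising beta N' tau' (cyl_ind R c)| <= e.
  move=> e0; apply: (@E_ising_mixing (clevel T c) _ 1) => //; last exact: cylf_bound.
  by move=> m s s'; exact: cylf_local.
have ca : cvg (a @ \oo).
  apply/cauchy_cvgP; apply: cauchy_exP => e e0.
  have [N0 h] := mix _ (divr_gt0 e0 (ltr0Sn R 1)); exists (a N0); exists N0 => // k /= kN0.
  by apply: (le_lt_trans (h _ _ _ _ (leqnn _) kN0)); rewrite ltr_pdivrMr// ltr_pMr// ltr1n.
apply/cvgrPdist_lt => e e0; have e2 : 0 < e / 2 by rewrite divr_gt0.
have [N0 h] := mix _ e2.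
move/cvgrPdist_lt: ca => /(_ _ e2)[N1 _ h1].
exists (maxn N0 N1) => // k /=; rewrite geq_max => /andP[k0 k1].
have := h k (N k) (fun=> true) (tau k) k0 (leq_trans k0 (kN k)).
have := h1 k k1; rewrite -/(a k) -/(mass c) => i1 i2.
rewrite -(subrK (a k) (mass c)) -addrA (le_lt_trans (ler_normD _ _))//.
by rewrite [ltRHS](splitr e) ltr_leD.
Qed.

Lemma mass_cvg0 c : E_ising beta k (fun=> true : bool) (cyl_ind R c : config T -> R) @[k --> \oo] --> mass c.
Proof. exact: (@mass_cvg c id (fun _ _ => true)). Qed.

Lemma mass_ge0 c : 0 <= mass c.
Proof.
apply: (@limr_ge _ _ _ _ _ _); first by apply/cvg_ex; exists (mass c); exact: mass_cvg0.
by apply: nearW => k; apply: E_ising_ge0 => s; rewrite /cyl_ind ler0n.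
Qed.

Lemma mass_nil : mass [::] = 1.
Proof.
apply: cvg_lim => //; apply: cvg_near_cst; apply: nearW => k.
by rewrite -(@P_ising_sum T R beta k (fun=> true)); apply: eq_bigr => s _; rewrite mulr1.
Qed.

Lemma mass_split c : mass c = mass (rcons c false) + mass (rcons c true).
Proof.
apply: cvg_lim => //.
pose a d k := E_ising beta k (fun=> true : bool) (cyl_ind R d : config T -> R).
rewrite -/(a c) (_ : a c = a (rcons c false) + a (rcons c true)); first by apply: cvgD; exact: mass_cvg0.
apply/funext => k; rewrite /= /E_ising -[RHS]big_split; apply: eq_bigr => s _ /=.
by rewrite -mulrDr -cylf_split.
Qed.

Lemma mass_none c : pickle_inv (size c) = None :> option (vertex T) -> mass (rcons c true) = 0.
Proof.
move=> h; apply: cvg_lim => //; apply: cvg_near_cst; apply: nearW => k.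
apply: big1 => s _; rewrite /cyl_ind size_rcons wordS eqseq_rcons.
by rewrite {1}/bit h andbF mulr0.
Qed.

Lemma bounded_integrable (m : probability (config_space T) R) (g : config T -> R) C :
  measurable_fun setT (g : config_space T -> R) -> (forall s, `|g s| <= C) ->
  m.-integrable setT (EFin \o (g : config_space T -> R)).
Proof.
move=> mg gC; apply: measurable_bounded_integrable => //.
  exact: (le_lt_trans (probability_le1 m measurableT) (ltry 1)).
exists C; split; first exact: num_real.
by move=> x Cx s _; apply: le_trans (gC s) (ltW Cx).
Qed.

Lemma measurable_cylf c : measurable_fun setT (cyl_ind R c : config_space T -> R).
Proof. rewrite cylf_indic; apply: measurable_realfun.measurable_indic; exact: measurable_cyl. Qed.

Lemma Rintegral_cylf (m : probability (config_space T) R) c :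
  Rintegral m setT (cyl_ind R c) = fine (m (@cyl T c)).
Proof.
by rewrite /Rintegral cylf_indic integral_indic ?setIT//; exact: measurable_cyl.
Qed.

Lemma Rintegral_cyl_sum (m : probability (config_space T) R) (r : seq (seq bool)) (a : seq bool -> R)
    (h : config_space T -> R) : (forall s, h s = \sum_(c <- r) a c * cyl_ind R c s) ->
  m.-integrable setT (EFin \o h) /\ Rintegral m setT h = \sum_(c <- r) a c * fine (m (@cyl T c)).
Proof.
have icyl c : m.-integrable setT (EFin \o (cyl_ind R c : config_space T -> R)).
  by apply: bounded_integrable; [exact: measurable_cylf|exact: cylf_bound].
elim: r h => [|c r IH] h hE.
  have -> : h = cst 0 by apply/funext => s; rewrite hE big_nil.
  rewrite big_nil; split; last by rewrite Rintegral_cst// mul0r.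
  by apply: (@bounded_integrable _ _ 0) => // s; rewrite normr0.
have [IH1 IH2] := IH (fun s => \sum_(c <- r) a c * cyl_ind R c s) (fun=> erefl).
have -> : h = (fun s => a c * cyl_ind R c s + \sum_(c <- r) a c * cyl_ind R c s).
  by apply/funext => s; rewrite hE big_cons.
rewrite big_cons.
have ic : m.-integrable setT (EFin \o (fun s : config_space T => a c * cyl_ind R c s)).
  by have := integrableZl measurableT (a c) (icyl c).
split; first by have := integrableD measurableT ic IH1.
by rewrite RintegralD// IH2 RintegralZl// Rintegral_cylf.
Qed.

Lemma continuous_bounded (f : {ptws vertex T -> bool} -> R) : continuous f ->
  exists C, forall s, `|f s| <= C.
Proof.
move=> fc; have [n h] := trunc_approx fc (@ltr01 R).
exists (1 + \sum_(c <- allw n) `|f (extend c)|) => s.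
rewrite -(subrK (f (trunc n s)) (f s)) (le_trans (ler_normD _ _))// lerD//.
rewrite (cylf_trunc n (f : config T -> R)) (le_trans (ler_norm_sum _ _ _))//.
by apply: ler_sum => c _; rewrite normrM ler_piMr// cylf_bound.
Qed.

Lemma continuous_measurable (f : {ptws vertex T -> bool} -> R) : continuous f ->
  measurable_fun setT (f : config_space T -> R).
Proof.
move=> fc; apply: (@measurable_realfun.measurable_fun_cvg _ _ _ _
  (fun n (s : config_space T) => f (trunc n s))).
  move=> n; rewrite (_ : (fun s : config_space T => f (trunc n s)) =
    (fun s => \sum_(c <- allw n) f (extend c) * cyl_ind R c s)); last by apply/funext => s; exact: cylf_trunc.
  apply: measurable_sum => c; apply: measurable_realfun.measurable_funM => //; exact: measurable_cylf.
move=> s _; apply: (@cvg_comp _ _ _ (fun n => trunc n s : {ptws vertex T -> bool}) f _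
  (nbhs (s : {ptws vertex T -> bool}))); last exact: fc.
by apply: ptws_cvg => v; exists (pickle v).+1 => // n /=; exact: trunc_lt.
Qed.

(** Truncating f costs e/4 under m and e/4 under each finite-volume measure. The truncation is a
    finite combination of cylinder functions, whose expectations converge, at a further cost below
    e/4. *)
Lemma gibbs_of_mass (m : probability (config_space T) R) :
  (forall c, m (@cyl T c) = (mass c)%:E) -> is_gibbs beta m.
Proof.
move=> mE; exists id, (fun _ _ => true); split; first by move=> k l.
move=> f fc; apply/cvgrPdist_lt => e e0.
have e4 : 0 < e / 4 by rewrite divr_gt0.
have [n h] := trunc_approx fc e4.
pose g (s : config T) : R := f (trunc n s).
have gE : g = (fun s => \sum_(c <- allw n) f (extend c) * cyl_ind R c s).
  by apply/funext => s; exact: cylf_trunc.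
have [ig Ig] : m.-integrable setT (EFin \o (g : config_space T -> R)) /\
    Rintegral m setT (g : config_space T -> R) = \sum_(c <- allw n) f (extend c) * mass c.
  have [|i1 i2] := @Rintegral_cyl_sum m (allw n) (fun c => f (extend c)) g.
    by move=> s; rewrite gE.
  by split => //; rewrite i2; apply: eq_bigr => c _; rewrite mE.
have [C fC] := continuous_bounded fc.
have if_ : m.-integrable setT (EFin \o (f : config_space T -> R)).
  by apply: (@bounded_integrable m f C) => //; exact: continuous_measurable.
have fg : `|Rintegral m setT (f : config_space T -> R) - Rintegral m setT (g : config_space T -> R)| <= e / 4.
  rewrite -RintegralB//.
  have i_ : m.-integrable setT (EFin \o (fun s : config_space T => f s - g s)).
    by have := integrableB measurableT if_ ig.
  apply: (le_trans (le_normr_Rintegral _ _)) => //.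
  apply: (@le_trans _ _ (Rintegral m setT (fun _ : config_space T => e / 4))).
    apply: le_Rintegral => //.
    - by have := integrable_norm i_.
    - by apply: (@bounded_integrable _ _ (e / 4)) => // s; rewrite ger0_norm// ltW.
  rewrite Rintegral_cst// (_ : fine _ = 1) ?mulr1//.
  exact: (congr1 fine (probability_setT m)).
have cg : E_ising beta k (fun=> true : bool) g @[k --> \oo] --> Rintegral m setT (g : config_space T -> R).
  rewrite Ig gE; under eq_fun do rewrite E_ising_sum.
  apply: cvg_big => [|c _]; first exact: add_continuous.
  by apply: cvgMr; exact: mass_cvg0.
move/cvgrPdist_lt: cg => /(_ _ e4)[k0 _ hk]; exists k0 => // k /hk /= k1.
have := @E_ising_close T R beta k (fun=> true) f g _ h.
move: fg k1; set x := Rintegral _ _ _; set y := Rintegral _ _ _.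
set z := E_ising _ _ _ _; set w := E_ising _ _ _ _.
rewrite [`|w - z|]distrC => h1 h2 h3.
have -> : x - w = (x - y) + (y - z) + (z - w) by ring.
apply: (le_lt_trans (ler_normD _ _)); apply: (le_lt_trans (lerD (ler_normD _ _) (lexx _))).
lra.
Qed.

(** Cylinder indicators are continuous, hence admissible test functions, and a strictly increasing
    subsequence satisfies [k <= N k], as [mass_cvg] requires. *)
Lemma mass_of_gibbs (m : probability (config_space T) R) : is_gibbs beta m ->
  forall c, m (@cyl T c) = (mass c)%:E.
Proof.
move=> [N [tau [Nh lim_]]] c.
have kN k : (k <= N k)%N by elim: k => // k IH; apply: leq_ltn_trans IH (Nh _ _ _).
have <- := cvg_lim (@Rhausdorff R) (@mass_cvg c N (tau \o N) kN).
have -> := cvg_lim (@Rhausdorff R) (lim_ _ (@cylf_continuous R T c)).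
rewrite Rintegral_cylf fineK// fin_num_measure//; exact: measurable_cyl.
Qed.

(** Two cylinders are nested or disjoint, so cylinders together with the empty set form a pi-system.
    They generate the sigma-algebra because a single spin event is a countable union of
    cylinders. *)
Lemma cyl_determining (m m' : probability (config_space T) R) :
  (forall c, m (@cyl T c) = m' (@cyl T c)) -> forall A, measurable A -> m A = m' A.
Proof.
move=> mm A mA; pose G : set (set (config_space T)) := [set A | A = set0 \/ exists c, A = @cyl T c].
have GA : <<s G >> A.
  apply: smallest_sub mA; first exact: smallest_sigma_algebra.
  move=> _ [v [b ->]].
  have -> : [set s : config T | s v = b] =
      \bigcup_(c in [set c | size c = (pickle v).+1 /\ nth false c (pickle v) = b]) @cyl T c.
    apply/seteqP; split => s /=.
      move=> sv; exists (word (pickle v).+1 s); last by rewrite /cyl /mkset size_word.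
      by split; rewrite ?size_word// nth_mkseq// bit_pickle.
    by move=> [c [sc <-]] /= <-; rewrite sc nth_mkseq// bit_pickle.
  rewrite bigcup_mkcond; apply: (@countable_bigcupT_measurable _ (g_sigma_algebraType G)) => // c.
  case: ifP => _; last exact: (@measurable0 _ (g_sigma_algebraType G)).
  by apply: sub_sigma_algebra; right; exists c.
apply: (@g_sigma_algebra_measure_unique _ _ _ G _ (fun=> setT) _ _ m m' _ _ _ A GA).
- by move=> _ [->|[c ->]] //; exact: measurable_cyl.
- by move=> _; right; exists [::]; apply/seteqP.
- by apply/seteqP; split => // s _; exists 0%N.
- move=> A1 A2 [->|[c ->]]; first by rewrite set0I; left.
  move=> [->|[d ->]]; first by rewrite setI0; left.
  wlog cd : c d / (size c <= size d)%N.
    move=> w; case/orP: (leq_total (size c) (size d)) => ?; first exact: w.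
    by rewrite setIC; exact: w.
  have gens_wt (s : config T) : take (size c) (word (size d) s) = word (size c) s.
    by rewrite /word /mkseq -map_take take_iota (minn_idPl cd).
  have [e|ne] := eqVneq (take (size c) d) c; [right; exists d|left].
    apply/seteqP; split => s /= => [[//]|h]; split => //.
    by rewrite /cyl /= -gens_wt h e.
  by apply/seteqP; split => s // [/= h1 h2]; case/eqP: ne; rewrite -h2 gens_wt.
- by move=> B [->|[c ->]]; [rewrite !measure0|exact: mm].
- by move=> _; exact: (le_lt_trans (probability_le1 m measurableT) (ltry 1)).
Qed.

Lemma few_walks_unique : unique_gibbs T beta.
Proof.
have [m mE] := mass_exists mass_ge0 mass_nil mass_split mass_none.
exists m; split; first exact: gibbs_of_mass.
by move=> m' /mass_of_gibbs m'E; apply: cyl_determining => c; rewrite mE m'E.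
Qed.

End Unique.

Unset Implicit Arguments.

Theorem theorem3 (R : realType) (P : probability LTspace R)
    (hP : local_weak_limit (mu_cr R) P) :
  exists beta_h : R, 0 < beta_h /\
    forall beta : R, 0 <= beta -> beta < beta_h ->
      {ae P, forall T : LTspace, unique_gibbs T beta}.
Proof.
have [q q0 ae] := ae_few_walks hP.
(* The expansion over open edges needs q <= 1; lowering q preserves the bound on the walks. *)
pose p := Num.min q 1.
have p0 : 0 < p by rewrite lt_min q0 ltr01.
(* From 1 - exp(-4 beta) <= 4 beta, the edge parameter is below p as soon as beta < p/4. *)
exists (p / 4); split; first by rewrite divr_gt0.
move=> beta b0 bh; apply: filterS ae => T few.
apply: (@few_walks_unique R T beta p) => //.
- by rewrite ge_min lexx orbT.
- have := expR_ge1Dx (- (4 * beta)); move: bh; rewrite ltr_pdivlMr// => *; lra.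
- move=> m0; have [m [h1 h2 h3]] := few m0; exists m; split => //.
  apply: le_trans h3; rewrite ler_wpM2l// lerXn2r ?nnegrE ?(ltW p0) ?(ltW q0)//.
  by rewrite ge_min lexx.
Qed.
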